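(* Let $n\geq 3$. For every $x\in \mathbb{B}^n\setminus\{0\}$ we have \[ C(x)=C(x,\boldsymbol{n}_x), \] where $\boldsymbol{n}_x:=x/|x|$ is the unit outward normal vector to the sphere $|x|\mathbb{S}^{n-1}$ at $x$.
   Context: $\mathbb{B}^n$ is the open unit ball of $\mathbb{R}^n$, $\mathbb{S}^{n-1}=\partial\mathbb{B}^n$, and $h^\infty$ is the space of bounded harmonic functions on $\mathbb{B}^n$. For $x\in\mathbb{B}^n$, $C(x)$ denotes the smallest number such that $|\nabla u(x)|\leq C(x)\sup_{y\in\mathbb{B}^n}|u(y)|$ for all $u\in h^\infty$. For $x\in\mathbb{B}^n$ and $\boldsymbol{\ell}\in\mathbb{S}^{n-1}$, $C(x,\boldsymbol{\ell})$ denotes the smallest number such that $|\langle\nabla u(x),\boldsymbol{\ell}\rangle|\leq C(x,\boldsymbol{\ell})\sup_{y\in\mathbb{B}^n}|u(y)|$ for all $u\in h^\infty$. (Both are finite.) *)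

(* Defs.v *)
From HB Require Import structures.
From mathcomp Require Import all_boot all_order all_algebra.
From mathcomp Require Import all_classical all_reals all_analysis.
Set Implicit Arguments. Unset Strict Implicit. Unset Printing Implicit Defensive.
Import Order.TTheory GRing.Theory Num.Theory.
Import numFieldNormedType.Exports.
Local Open Scope classical_set_scope.
Local Open Scope ring_scope.

Section HarmDefs.
Variables (R : realType) (n : nat).
Local Notation V := 'rV[R]_n.

(* Euclidean norm and inner product on R^n (the library norm on matrices is the max norm). *)
Definition enorm (v : V) : R := Num.sqrt (\sum_(i < n) v 0 i ^+ 2).
Definition einner (v w : V) : R := \sum_(i < n) v 0 i * w 0 i.

Definition ebasis (i : 'I_n) : V := delta_mx 0 i.

Definition unit_ball : set V := [set x | enorm x < 1].
Definition unit_sphere : set V := [set x | enorm x = 1].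

Definition partial (i : 'I_n) (u : V -> R) : V -> R := fun x => 'D_(ebasis i) u x.
Definition grad (u : V -> R) (x : V) : V := \row_(i < n) partial i u x.

Definition harmonic_on_ball (u : V -> R) : Prop :=
  forall x, unit_ball x ->
    [/\ differentiable u x,
        (forall i, differentiable (partial i u) x),
        (forall i j, {for x, continuous (partial j (partial i u))}) &
        \sum_(i < n) partial i (partial i u) x = 0].

Definition hinf (u : V -> R) : Prop :=
  harmonic_on_ball u /\ exists M : R, forall y, unit_ball y -> `|u y| <= M.

Definition supnorm (u : V -> R) : R := sup [set `|u y| | y in unit_ball].

Definition Cgrad (x : V) : R :=
  inf [set c : R | forall u, hinf u -> enorm (grad u x) <= c * supnorm u].

Definition Cdir (x l : V) : R :=
  inf [set c : R | forall u, hinf u -> `|einner (grad u x) l| <= c * supnorm u].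

End HarmDefs.

(* Main.v *)
Require Import Defs.
From HB Require Import structures.
From mathcomp Require Import all_boot all_order all_algebra.
From mathcomp Require Import all_classical all_reals all_analysis.
From mathcomp Require Import ring lra.
Set Implicit Arguments. Unset Strict Implicit. Unset Printing Implicit Defensive.
Import Order.TTheory GRing.Theory Num.Theory.
Import numFieldNormedType.Exports.
Local Open Scope classical_set_scope.
Local Open Scope ring_scope.

(** Fix x = rho w0 with |w0| = 1 and 0 < rho < 1, and let P be the Poisson kernel of the ball.
    Differentiating the Poisson formula shows that the sharp constant for |<grad u(x), l>| is the
    spherical average over y of |<l, grad_x P(x, y)>|. The upper bound ([grad_upper]) comes from
    representing the dilations u(r .), r < 1; the lower bound ([grad_lower]) from Poisson integrals
    of smoothed signs of the kernel. As the length of a gradient is its pairing with its own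
    direction, it remains to show that this average is at least as large for l = w0 as for any other
    unit vector l.

    The surface measure itself is never constructed. A functional satisfying [mean] is positive,
    lives on a compact part of the unit sphere and obeys the divergence theorem of the sphere.
    Green's identity, the Poisson formula and the two bounds follow from these properties, so any
    normalised functional of this kind may be used, and it may be adapted to the direction l = cos
    al w0 + sin al w1.

    The comparison ([special_mean]) starts with a conformal automorphism of the sphere along w0 that
    carries the equator to the latitude where the normal derivative of P vanishes. In the new
    variable z the kernel is a constant times |mu cos al z1 + sin al z2| times a function of z1
    ([kernel_profile]), where z1 and z2 are the components of z along w0 and w1. Next the sphere is
    written as the join of the circle in the plane of w0 and w1 with a sphere in the orthogonal
    complement, and the angle phi on the circle is replaced by t with tan phi = mu tan t. The
    average becomes a constant independent of al times the integral of |cos (t - al)| g(t) over a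
    half-turn ([join_eval]). Since g is a nondecreasing function of |cos t| ([gg_mono]), the
    reflection t -> al - t, which exchanges |cos t| and |cos (t - al)|, bounds this integral by the
    one for al = 0 ([reflection_ineq]).

    The monotonicity of g is the analytic core. Up to a constant, g is the normalised integral [Jn]
    at an argument proportional to |cos t| / Del t. An elliptic substitution ([J_sub]) turns [Jn]
    into [Phi] at a parameter q that increases with the argument. In the derivative of [Phi], an
    exact derivative of vanishing integral ([ibp]) is added to the integrand; what is left is a
    nonnegative factor times the polynomial [epos], which is nonnegative ([epos_ge0]). *)

Lemma cont_pair (X Y Z : topologicalType) (f : X -> Y) (g : X -> Z) (x : X) :
  {for x, continuous f} -> {for x, continuous g} -> {for x, continuous (fun t => (f t, g t))}.
Proof. by move=> cf cg; apply: (@cvg_pair _ _ _ _ (nbhs (f x)) (nbhs (g x))). Qed.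

Lemma cont_comp2 (X Y Z W : topologicalType) (f : X -> Y) (g : X -> Z) (h : Y -> Z -> W) (x : X) :
  {for x, continuous f} -> {for x, continuous g} ->
  {for (f x, g x), continuous (fun p : Y * Z => h p.1 p.2)} ->
  {for x, continuous (fun t => h (f t) (g t))}.
Proof.
move=> cf cg ch.
by apply: (@continuous_comp _ _ _ (fun t => (f t, g t)) (fun p : Y * Z => h p.1 p.2)) => //;
  exact: cont_pair.
Qed.

(** * Positive functionals on a compact set, as an abstract integral *)

Section PosFun.
Context {R : realType} {T : topologicalType}.
Implicit Types (K : set T) (f g : T -> R).

(* Continuity on a neighbourhood of [K], so that it is stable under perturbation of parameters. *)
Definition contK (Y : topologicalType) K (f : T -> Y) := forall t, K t -> \forall s \near t, {for s, continuous f}.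

Record posfun K (L : (T -> R) -> R) : Prop := PosFun {
  pf_compact : compact K;
  pf_lin : forall a f g, contK K f -> contK K g ->
    L (fun t => a * f t + g t) = a * L f + L g;
  pf_ge0 : forall f, contK K f -> (forall t, K t -> 0 <= f t) -> 0 <= L f }.

Lemma contK_cst K (c : R) : contK K (fun=> c).
Proof. by move=> t _; apply: nearW => s; exact: cst_continuous. Qed.
Arguments contK_cst : clear implicits.

Lemma contKD K f g : contK K f -> contK K g -> contK K (fun t => f t + g t).
Proof.
by move=> hf hg t Kt; apply: filterS2 (hf t Kt) (hg t Kt) => s; exact: continuousD.
Qed.

Lemma contKM K f g : contK K f -> contK K g -> contK K (fun t => f t * g t).
Proof.
by move=> hf hg t Kt; apply: filterS2 (hf t Kt) (hg t Kt) => s; exact: continuousM.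
Qed.

Lemma contKN K f : contK K f -> contK K (fun t => - f t).
Proof. by move=> hf t Kt; apply: filterS (hf t Kt) => s; exact: continuousN. Qed.

Lemma contKB K f g : contK K f -> contK K g -> contK K (fun t => f t - g t).
Proof. by move=> hf hg; apply: contKD => //; exact: contKN. Qed.

Lemma contK_comp K f (h : R -> R) : continuous h -> contK K f -> contK K (fun t => h (f t)).
Proof.
move=> hc hf t Kt; apply: filterS (hf t Kt) => s fs.
by apply: (@continuous_comp _ _ _ f h) => //; exact: hc.
Qed.

Lemma contK_norm K f : contK K f -> contK K (fun t => `|f t|).
Proof. by apply: (@contK_comp _ _ (fun x : R => `|x|)); exact: norm_continuous. Qed.

Lemma contK_sum K (I : Type) (r : seq I) (F : I -> T -> R) :
  (forall i, contK K (F i)) -> contK K (fun t => \sum_(i <- r) F i t).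
Proof.
move=> hF; elim: r => [|i r ih].
  by under eq_fun do rewrite big_nil; exact: contK_cst.
by under eq_fun do rewrite big_cons; exact: contKD.
Qed.

Section Basics.
Variables (K : set T) (L : (T -> R) -> R) (hL : posfun K L).

Lemma pf0 : L (fun=> 0) = 0.
Proof.
have := pf_lin hL (-1) (contK_cst K 0) (contK_cst K 0).
by rewrite mulr0 addr0 mulN1r addNr.
Qed.

Lemma pfZ a f : contK K f -> L (fun t => a * f t) = a * L f.
Proof.
move=> hf; have := pf_lin hL a hf (contK_cst K 0).
by under eq_fun do rewrite addr0; rewrite pf0 addr0.
Qed.

Lemma pfD f g : contK K f -> contK K g -> L (fun t => f t + g t) = L f + L g.
Proof.
move=> hf hg; have := pf_lin hL 1 hf hg.
by under eq_fun do rewrite mul1r; rewrite mul1r.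
Qed.

Lemma pfN f : contK K f -> L (fun t => - f t) = - L f.
Proof. by move=> hf; under eq_fun do rewrite -mulN1r; rewrite pfZ // mulN1r. Qed.

Lemma pfB f g : contK K f -> contK K g -> L (fun t => f t - g t) = L f - L g.
Proof. by move=> hf hg; rewrite pfD ?pfN //; exact: contKN. Qed.

Lemma pf_sum (I : Type) (r : seq I) (F : I -> T -> R) :
  (forall i, contK K (F i)) -> L (fun t => \sum_(i <- r) F i t) = \sum_(i <- r) L (F i).
Proof.
move=> hF; elim: r => [|i r ih].
  by under eq_fun do rewrite big_nil; rewrite big_nil pf0.
under eq_fun do rewrite big_cons; rewrite big_cons pfD ?ih //; exact: contK_sum.
Qed.

Lemma pf_le f g : contK K f -> contK K g -> (forall t, K t -> f t <= g t) -> L f <= L g.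
Proof.
move=> hf hg fg; rewrite -subr_ge0 -pfB //.
by apply: (pf_ge0 hL); [exact: contKB|move=> t Kt; rewrite subr_ge0; exact: fg].
Qed.

Lemma pf_ext f g : contK K f -> contK K g -> (forall t, K t -> f t = g t) -> L f = L g.
Proof.
move=> hf hg fg; apply/eqP; rewrite eq_le.
by apply/andP; split; apply: pf_le => // t Kt; rewrite fg.
Qed.

Lemma pf_abs_le f g : contK K f -> contK K g -> (forall t, K t -> `|f t| <= g t) ->
  `|L f| <= L g.
Proof.
move=> hf hg fg; rewrite ler_norml -pfN //; apply/andP; split; apply: pf_le => //.
- exact: contKN.
- by move=> t /fg; rewrite ler_norml => /andP[].
- by move=> t /fg; rewrite ler_norml => /andP[].
Qed.

Lemma pf_abs_cst f c : contK K f -> (forall t, K t -> `|f t| <= c) -> `|L f| <= c * L (fun=> 1).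
Proof.
move=> hf fc; rewrite -pfZ; last exact: contK_cst.
by apply: pf_abs_le => // [|t Kt]; [exact: contK_cst|rewrite mulr1 fc].
Qed.

Lemma pf1_ge0 : 0 <= L (fun=> 1).
Proof. by apply: (pf_ge0 hL) => //; exact: contK_cst. Qed.

End Basics.

Definition jcont (X : topologicalType) K (F : X -> T -> R) (x0 : X) := forall t, K t ->
  \forall p \near (x0, t), {for p, continuous (fun p : X * T => F p.1 p.2)}.

(** Tube lemma: near each point t of [K], both F x t' and F x0 t' are within e/2 of F x0 t, and
    compactness makes the neighbourhood of x0 uniform in t. *)
Lemma unif_near (X : topologicalType) K (F : X -> T -> R) (x0 : X) : compact K ->
  jcont K F x0 -> forall e, 0 < e -> \forall x \near x0, forall t, K t -> `|F x t - F x0 t| <= e.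
Proof.
move=> /compact_near_coveringP cK hF e e0.
apply: (cK X (nbhs x0) (fun x t => `|F x t - F x0 t| <= e)) => t Kt.
have /= h := nbhs_singleton (hF t Kt).
have e20 : 0 < e / 2 by rewrite divr_gt0.
have hb : nbhs (x0, t) [set p : X * T | `|F x0 t - F p.1 p.2| < e / 2].
  by move/cvgrPdist_lt : h => /(_ _ e20).
have [[/= U V] [Ux Vt] UV] := hb.
exists (V, U) => //= -[t' x] [/= Vt' Ux'].
have h1 := UV (x, t') (conj Ux' Vt'); have h2 := UV (x0, t') (conj (nbhs_singleton Ux) Vt').
rewrite /= in h1 h2.
rewrite (_ : F x t' - F x0 t' = (F x0 t - F x0 t') - (F x0 t - F x t')); last by ring.
by rewrite (le_trans (ler_normB _ _)) // (splitr e) lerD // ltW.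
Qed.

Lemma jcont_near (X : topologicalType) K (F : X -> T -> R) (x0 : X) : compact K ->
  jcont K F x0 -> \forall x \near x0, jcont K F x.
Proof.
move=> /compact_near_coveringP cK hF.
apply: (cK X (nbhs x0) (fun x t => \forall p \near (x, t),
  {for p, continuous (fun p : X * T => F p.1 p.2)})) => t Kt.
have /nbhs_interior /= [[/= U V] [Ux Vt] UV] := hF t Kt.
by exists (V, U) => //= -[t' x] [/= Vt' Ux']; exact: (UV (x, t')).
Qed.

Lemma jcont_contK (X : topologicalType) K (F : X -> T -> R) (x0 : X) :
  jcont K F x0 -> contK K (F x0).
Proof.
move=> hF t Kt; have [[/= U V] [Ux Vt] UV] := hF t Kt.
apply: filterS Vt => s Vs; have /= := UV (x0, s) (conj (nbhs_singleton Ux) Vs) => h.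
apply: (@continuous_comp _ _ _ (fun s : T => (x0, s)) (fun p => F p.1 p.2)) => //.
by apply: cvg_pair => //=; exact: cvg_cst.
Qed.

Lemma jcont_near_contK (X : topologicalType) K (F : X -> T -> R) (x0 : X) : compact K ->
  jcont K F x0 -> \forall x \near x0, contK K (F x).
Proof. by move=> cK /(jcont_near cK); apply: filterS => x; exact: jcont_contK. Qed.

Lemma contK_continuous (Y : topologicalType) (f : T -> Y) K : continuous f -> contK K f.
Proof. by move=> hf t _; apply: nearW => s; exact: (hf s). Qed.

Lemma jcont_continuous (X : topologicalType) K (F : X -> T -> R) (x0 : X) :
  continuous (fun p : X * T => F p.1 p.2) -> jcont K F x0.
Proof.
move=> hF t _; near=> p; exact: hF.
Unshelve. all: by end_near. Qed.

Lemma pf_continuous1 (X : topologicalType) K L (F : X -> T -> R) (x0 : X) : posfun K L ->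
  jcont K F x0 -> {for x0, continuous (fun x => L (F x))}.
Proof.
move=> hL hF; apply/cvgrPdist_le => e e0.
have c0 := jcont_contK hF.
(* The added 1 allows division by [c] even when the total mass is 0. *)
pose c := L (fun=> 1) + 1.
have c_gt0 : 0 < c by rewrite /c ltr_wpDl // (pf1_ge0 hL).
near=> x.
have cx : contK K (F x).
  by apply: jcont_contK; near: x; exact: jcont_near (pf_compact hL) hF.
rewrite distrC -(pfB hL) //.
apply: le_trans (pf_abs_cst hL (c := e / c) _ _) _; first exact: contKB.
  near: x; apply: (unif_near (pf_compact hL) hF); exact: divr_gt0.
by rewrite -mulrA ler_piMr ?ltW // mulrC ltr_pdivrMr // mul1r /c ltrDl.
Unshelve. all: by end_near. Qed.

Lemma pf_continuous (X : topologicalType) K L (F : X -> T -> R) (x0 : X) : posfun K L ->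
  jcont K F x0 -> \forall x \near x0, {for x, continuous (fun x => L (F x))}.
Proof.
move=> hL /(jcont_near (pf_compact hL)); apply: filterS => x; exact: pf_continuous1.
Qed.

End PosFun.

Arguments contK_cst {R T} K c t _ : rename.

(** * Images, densities, sums and products of positive functionals *)

Section Constructions.
Context {R : realType}.

Lemma contK_push {T U : topologicalType} {Y : topologicalType} (K : set T) (Phi : T -> U) (f : U -> Y) :
  contK K Phi -> contK (Phi @` K) f -> contK K (fun t => f (Phi t)).
Proof.
move=> cPhi cf t Kt.
have h : \forall s \near t, {for Phi s, continuous f}.
  by have := nbhs_singleton (cPhi t Kt) _ (cf (Phi t) (ex_intro2 _ _ t Kt erefl)).
near=> s; apply: (@continuous_comp _ _ _ Phi f); first by near: s; exact: cPhi.
by near: s.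
Unshelve. all: by end_near. Qed.

Lemma pf_push {T U : topologicalType} (K : set T) L (Phi : T -> U) : @posfun R T K L ->
  contK K Phi -> posfun (Phi @` K) (fun f : U -> R => L (fun t => f (Phi t))).
Proof.
move=> hL cPhi; split.
- apply: continuous_compact; last exact: pf_compact hL.
  apply: continuous_in_subspaceT => t; rewrite inE => Kt; exact: nbhs_singleton (cPhi t Kt).
- move=> a f g cf cg.
  exact: (pf_lin hL a (contK_push cPhi cf) (contK_push cPhi cg)).
- move=> f cf f0; apply: (pf_ge0 hL) => [|t Kt]; first exact: contK_push.
  by apply: f0; exists t.
Qed.

Lemma pf_weight {T : topologicalType} (K : set T) L (w : T -> R) : posfun K L ->
  contK K w -> (forall t, K t -> 0 <= w t) -> posfun K (fun f => L (fun t => w t * f t)).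
Proof.
move=> hL cw w0; split; first exact: pf_compact hL.
- move=> a f g cf cg.
  rewrite -(pf_lin hL a (contKM cw cf) (contKM cw cg)); congr L.
  by apply/funext => t; ring.
- move=> f cf f0; apply: (pf_ge0 hL) => [|t Kt]; first exact: contKM.
  by rewrite mulr_ge0 ?w0 ?f0.
Qed.

Lemma pf_pt {T : topologicalType} (x : T) : @posfun R T [set x] (fun f => f x).
Proof. by split=> [|//|f _ h]; [exact: compact_set1|exact: h]. Qed.

Lemma contKS {T Y : topologicalType} (K K' : set T) (f : T -> Y) : K `<=` K' -> contK K' f -> contK K f.
Proof. by move=> KK cf t /KK /cf. Qed.

Lemma pf_add {T : topologicalType} (K1 K2 : set T) L1 L2 : @posfun R T K1 L1 -> posfun K2 L2 ->
  posfun (K1 `|` K2) (fun f => L1 f + L2 f).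
Proof.
move=> h1 h2; split; first by apply: compactU; [exact: pf_compact h1|exact: pf_compact h2].
- move=> a f g cf cg.
  have [cf1 cf2] := (contKS (@subsetUl _ K1 K2) cf, contKS (@subsetUr _ K1 K2) cf).
  have [cg1 cg2] := (contKS (@subsetUl _ K1 K2) cg, contKS (@subsetUr _ K1 K2) cg).
  by rewrite (pf_lin h1 a cf1 cg1) (pf_lin h2 a cf2 cg2); ring.
- move=> f cf f0; apply: addr_ge0.
    by apply: (pf_ge0 h1) => [|t Kt]; [exact: contKS cf|apply: f0; left].
  by apply: (pf_ge0 h2) => [|t Kt]; [exact: contKS cf|apply: f0; right].
Qed.

Lemma contK_prod_jcont {T1 T2 : topologicalType} (K1 : set T1) (K2 : set T2) (f : T1 * T2 -> R) t1 :
  K1 t1 -> contK (K1 `*` K2) f -> jcont K2 (fun t1 t2 => f (t1, t2)) t1.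
Proof.
move=> Kt1 cf t2 Kt2.
have E : f = (fun p => f (p.1, p.2)) by apply/funext => -[].
by rewrite E in cf; exact: (cf (t1, t2) (conj Kt1 Kt2)).
Qed.

Lemma contK_prod_inner {T1 T2 : topologicalType} (K1 : set T1) (K2 : set T2) L2 (f : T1 * T2 -> R) :
  posfun K2 L2 -> contK (K1 `*` K2) f -> contK K1 (fun t1 => L2 (fun t2 => f (t1, t2))).
Proof.
move=> h2 cf t1 Kt1.
exact: (pf_continuous (F := fun t1 t2 => f (t1, t2)) h2 (contK_prod_jcont Kt1 cf)).
Qed.

Lemma contK_prod_slice {T1 T2 : topologicalType} (K1 : set T1) (K2 : set T2) (f : T1 * T2 -> R) t1 :
  K1 t1 -> contK (K1 `*` K2) f -> contK K2 (fun t2 => f (t1, t2)).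
Proof. by move=> Kt1 cf; exact: (jcont_contK (contK_prod_jcont Kt1 cf)). Qed.

(** [L1] may be applied to the inner value because the latter is continuous near [K1] by
    [pf_continuous]; this is why [contK] asks for continuity on a neighbourhood and not only at the
    points of the compact set. *)
Lemma pf_prod {T1 T2 : topologicalType} (K1 : set T1) (K2 : set T2) L1 L2 :
  @posfun R T1 K1 L1 -> posfun K2 L2 ->
  posfun (K1 `*` K2) (fun f : T1 * T2 -> R => L1 (fun t1 => L2 (fun t2 => f (t1, t2)))).
Proof.
move=> h1 h2; split.
- by apply: compact_setX; [exact: pf_compact h1|exact: pf_compact h2].
- move=> a f g cf cg.
  have [cf1 cg1] := (contK_prod_inner h2 cf, contK_prod_inner h2 cg).
  rewrite -(pf_lin h1 a cf1 cg1); apply: (pf_ext h1).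
  + apply: (@contK_prod_inner _ _ K1 K2 L2 (fun t => a * f t + g t)) => //.
    by apply: contKD => //; apply: contKM => //; exact: contK_cst.
  + by apply: contKD => //; apply: contKM => //; exact: contK_cst.
  + by move=> t1 Kt1; rewrite (pf_lin h2 a (contK_prod_slice Kt1 cf) (contK_prod_slice Kt1 cg)).
- move=> f cf f0; apply: (pf_ge0 h1) => [|t1 Kt1]; first exact: (contK_prod_inner h2 cf).
  apply: (pf_ge0 h2) => [|t2 Kt2]; first exact: (contK_prod_slice Kt1 cf).
  by apply: f0.
Qed.

End Constructions.

(** * Differentiation under a positive functional *)

Section DerivBounds.
Context {R : realType}.

Lemma is_derive_bound (f : R -> R) a c :
  (forall e, 0 < e -> \forall h \near 0, `|f (a + h) - f a - c * h| <= e * `|h|) ->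
  is_derive a 1 f c.
Proof.
move=> hf.
have hc : (fun h : R => h^-1 *: ((f \o shift a) (h *: 1) - f a)) @ 0^' --> c.
  apply/cvgrPdist_le => e e0.
  apply/nbhs_ballP; have /nbhs_ballP[d /= d0 hd] := hf e e0.
  exists d => //= h /= hh hn0.
  have := hd h hh; rewrite [h *: 1]mulr1 [h + a]addrC => {}hd.
  rewrite distrC -(@ler_pM2r _ `|h|) ?normr_gt0 // -normrM mulrBl.
  by rewrite /GRing.scale /= mulrAC mulVf // mul1r.
by split; [exact: (cvgP _ hc)|exact: (cvg_lim _ hc)].
Qed.

(** Mean value theorem in a form uniform in a parameter: the linearisation error is controlled by
    the oscillation of the derivative on the interval of radius |h|. *)
Lemma MVT_bound (f df : R -> R) (a h c e : R) :
  (forall s, `|s| <= `|h| -> is_derive (a + s) 1 f (df (a + s))) ->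
  (forall s, `|s| <= `|h| -> `|df (a + s) - c| <= e) ->
  `|f (a + h) - f a - c * h| <= e * `|h|.
Proof.
move=> fd dfc.
have cont s : `|s| <= `|h| -> {for a + s, continuous f}.
  move=> /fd [d _]; apply: differentiable_continuous; exact/derivable1_diffP.
have key (x y : R) : x <= y -> (forall z, x <= z <= y -> `|z - a| <= `|h|) ->
    exists2 z, x <= z <= y & f y - f x = df z * (y - x).
  move=> xy hz.
  have [| |z] := @MVT_segment R f df x y xy.
  - move=> z; rewrite in_itv /= => /andP[xz zy].
    have := fd (z - a); rewrite [a + _]addrC subrK; apply; apply: hz.
    by rewrite (ltW xz) (ltW zy).
  - apply: continuous_in_subspaceT => z; rewrite inE /= in_itv /= => xzy.
    by have := cont (z - a); rewrite [a + _]addrC subrK; apply; exact: hz.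
  - by rewrite in_itv /= => zxy ->; exists z.
case: (leP 0 h) => h0.
  have [|z zxy|z /andP[az zh]] := key a (a + h); first by rewrite lerDl.
    by move: zxy; rewrite (ger0_norm h0) => /andP[az zh]; rewrite ger0_norm; lra.
  rewrite addrAC subrr add0r => ->.
  have -> : df z * h - c * h = (df z - c) * h by ring.
  rewrite normrM ler_wpM2r //.
  have := dfc (z - a); rewrite [a + _]addrC subrK; apply.
  by rewrite (ger0_norm h0) ger0_norm; lra.
have [|z zxy|z /andP[az zh]] := key (a + h) a; first by rewrite gerDl ltW.
  by move: zxy; rewrite (ltr0_norm h0) => /andP[az zh]; rewrite ler0_norm; lra.
move=> E.
have -> : f (a + h) - f a - c * h = (df z - c) * h.
  have -> : f a = f (a + h) + df z * (a - (a + h)) by rewrite -E; ring.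
  by ring.
rewrite normrM ler_wpM2r //.
have := dfc (z - a); rewrite [a + _]addrC subrK; apply.
by rewrite (ltr0_norm h0) ler0_norm; lra.
Qed.

Lemma is_derive_cont (f : R -> R) (a c : R) : is_derive a 1 f c -> {for a, continuous f}.
Proof. by case=> d _; apply: differentiable_continuous; exact/derivable1_diffP. Qed.

End DerivBounds.

Section Leibniz.
Context {R : realType} {T : topologicalType}.

(** By [unif_near] the derivative F' oscillates little, uniformly over [K]; [MVT_bound] turns this
    into a uniform linearisation error, to which positivity of [L] applies. *)
Lemma pf_derive (K : set T) L (F F' : R -> T -> R) (s0 : R) : posfun K L ->
  (\forall s \near s0, contK K (F s)) -> jcont K F' s0 ->
  (\forall s \near s0, forall t, K t -> is_derive s (1 : R) (F^~ t) (F' s t)) ->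
  is_derive s0 (1 : R) (fun s => L (F s)) (L (F' s0)).
Proof.
move=> hL cF cF' dF.
apply: is_derive_bound => e e0.
have c0' := jcont_contK cF'.
have c0 := nbhs_singleton cF.
pose c := L (fun=> 1) + 1.
have c_gt0 : 0 < c by rewrite /c ltr_wpDl // (pf1_ge0 hL).
have ec : 0 < e / c by exact: divr_gt0.
have : \forall s \near s0, contK K (F s) /\ (forall t, K t -> is_derive s (1 : R) (F^~ t) (F' s t))
   /\ (forall t, K t -> `|F' s t - F' s0 t| <= e / c).
  near=> s; split; first by near: s.
  split; first by near: s.
  by near: s; exact: (unif_near (pf_compact hL) cF' ec).
move=> /nbhs_ballP[d /= d0 hd]; apply/nbhs_ballP; exists d => //= h /= hh.
have hs s : `|s| <= `|h| -> ball s0 d (s0 + s).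
  rewrite /ball /= opprD addrA subrr sub0r normrN => hsh.
  by apply: le_lt_trans hsh _; move: hh; rewrite /ball /= sub0r normrN.
have [ch _] := hd _ (hs h (lexx _)).
have -> : L (F (s0 + h)) - L (F s0) - L (F' s0) * h =
    L (fun t => F (s0 + h) t - F s0 t - h * F' s0 t).
  rewrite (pfB hL); [|exact: contKB|apply: contKM => //; exact: contK_cst].
  by rewrite (pfB hL) // (pfZ hL) // mulrC.
apply: le_trans (pf_abs_cst hL (c := e / c * `|h|) _ _) _.
- apply: contKB; first exact: contKB.
  by apply: contKM => //; exact: contK_cst.
- move=> t Kt; rewrite [h * _]mulrC.
  apply: (@MVT_bound _ (F^~ t) (F'^~ t)) => s /hs /hd[_ [h1 h2]]; [exact: h1|exact: h2].
- rewrite mulrAC ler_wpM2r // -mulrA ler_piMr ?ltW // mulrC ltr_pdivrMr // mul1r /c ltrDl //.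
Unshelve. all: by end_near. Qed.

End Leibniz.

Section VectorLeibniz.
Context {R : realType} {n : nat}.
Local Notation V := 'rV[R]_n.

Lemma einnerC (v w : V) : einner v w = einner w v.
Proof. by apply: eq_bigr => i _; rewrite mulrC. Qed.

(** The fixed vector comes first, so that the partial application can carry the structure of a
    linear form. *)
Definition einnerl (g h : V) : R := einner h g.

Lemma einnerl_linear g : linear (einnerl g).
Proof.
move=> a u v; rewrite /einnerl /einner /GRing.scale /= mulr_sumr -big_split /=.
by apply: eq_bigr => i _; rewrite !mxE mulrDl mulrA.
Qed.
HB.instance Definition _ g := GRing.isLinear.Build R V R _ (einnerl g) (einnerl_linear g).

Lemma coord_norm (v : V) i : `|v 0 i| <= `|v|.
Proof.
rewrite [leRHS]/Num.norm /= mx_normrE; apply/bigmax_geP; right => /=.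
by exists (ord0, i).
Qed.

Lemma einner_bound (g h : V) (c : R) : (forall i, `|g 0 i| <= c) ->
  `|einner h g| <= n%:R * c * `|h|.
Proof.
move=> gc; apply: le_trans (ler_norm_sum _ _ _) _.
have : \sum_(i < n) `|h 0 i * g 0 i| <= \sum_(i < n) c * `|h|.
  by apply: ler_sum => i _; rewrite normrM mulrC ler_pM // coord_norm.
rewrite sumr_const card_ord => /le_trans; apply.
by rewrite -(mulr_natl (c * _)) mulrA.
Qed.

Lemma einnerl_continuous g : continuous (einnerl g).
Proof.
move=> x; apply: (nbhs_singleton (A := fun x => {for x, continuous _})).
apply: (@contK_sum R V setT _ _ (fun i (h : V) => h 0 i * g 0 i)) => // i.
by apply: contKM; apply: contK_continuous; [exact: coord_continuous|exact: cst_continuous].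
Qed.

Lemma is_diff_bound (f : V -> R) x g :
  (forall e, 0 < e -> \forall h \near (0 : V), `|f (x + h) - f x - einner h g| <= e * `|h|) ->
  is_diff x f (einnerl g).
Proof.
move=> hf.
have hd : f \o shift x = cst (f x) + einnerl g +o_ (0 : V) id.
  apply/eqaddoP => e e0; near=> h.
  rewrite /= !fctE /cst /= opprD addrA [h + x]addrC.
  by near: h; exact: hf.
have du := diff_unique (@einnerl_continuous g) hd.
split=> //; apply/diff_locallyP; rewrite du; split=> //; exact: einnerl_continuous.
Unshelve. all: by end_near. Qed.

End VectorLeibniz.

(** * Differentiation rules in one variable *)

Section Calc.
Context {R : realType}.
Implicit Types (f g : R -> R) (x a b : R).

Lemma D_eq f x a b : is_derive x 1 f a -> a = b -> is_derive x 1 f b.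
Proof. by move=> + <-. Qed.

Lemma D_cst c x : is_derive x 1 (fun=> c : R) 0.
Proof. exact: is_derive_cst. Qed.

Lemma D_id x : is_derive x 1 (fun t : R => t) 1.
Proof. exact: is_derive_id. Qed.

Lemma D_add f g x a b : is_derive x 1 f a -> is_derive x 1 g b ->
  is_derive x 1 (fun t => f t + g t) (a + b).
Proof. exact: is_deriveD. Qed.

Lemma D_opp f x a : is_derive x 1 f a -> is_derive x 1 (fun t => - f t) (- a).
Proof. exact: is_deriveN. Qed.

Lemma D_sub f g x a b : is_derive x 1 f a -> is_derive x 1 g b ->
  is_derive x 1 (fun t => f t - g t) (a - b).
Proof. exact: is_deriveB. Qed.

Lemma D_mul f g x a b : is_derive x 1 f a -> is_derive x 1 g b ->
  is_derive x 1 (fun t => f t * g t) (a * g x + f x * b).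
Proof.
move=> hf hg; apply: D_eq (is_deriveM hf hg) _.
by rewrite /GRing.scale /=; ring.
Qed.

Lemma D_comp f g x a b : is_derive x 1 f a -> is_derive (f x) 1 g b ->
  is_derive x 1 (fun t => g (f t)) (b * a).
Proof. by move=> hf hg; exact: is_derive1_comp. Qed.

Lemma D_pow f x a n : is_derive x 1 f a ->
  is_derive x 1 (fun t => f t ^+ n) (n%:R * f x ^+ n.-1 * a).
Proof.
move=> hf; have -> : (fun t => f t ^+ n) = f ^+ n by apply/funext => t; rewrite exprfctE.
exact: D_eq (is_deriveX n hf) _.
Qed.

Lemma D_inv f x a : f x != 0 -> is_derive x 1 f a ->
  is_derive x 1 (fun t => (f t)^-1) (- a / f x ^+ 2).
Proof.
move=> fx0 [df Ef]; apply: DeriveDef; first exact: derivableV.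
by rewrite deriveV // Ef /GRing.scale /= mulrC mulNr mulrN.
Qed.

Lemma D_sin f x a : is_derive x 1 f a -> is_derive x 1 (fun t => sin (f t)) (cos (f x) * a).
Proof. by move=> hf; apply: D_comp hf _; exact: is_derive_sin. Qed.

Lemma D_cos f x a : is_derive x 1 f a -> is_derive x 1 (fun t => cos (f t)) (- sin (f x) * a).
Proof. by move=> hf; apply: D_comp hf _; exact: is_derive_cos. Qed.

Lemma D_sqrt f x a : 0 < f x -> is_derive x 1 f a ->
  is_derive x 1 (fun t => Num.sqrt (f t)) (a / (2 * Num.sqrt (f x))).
Proof.
move=> fx0 hf; apply: D_eq (D_comp hf (is_derive1_sqrt fx0)) _.
by rewrite mulrC.
Qed.

Lemma D_trig_pow x (i j : nat) : is_derive x 1 (fun t => sin t ^+ i * cos t ^+ j)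
  (i%:R * sin x ^+ i.-1 * cos x * cos x ^+ j - j%:R * cos x ^+ j.-1 * sin x * sin x ^+ i).
Proof.
apply: D_eq (D_mul (D_pow i (D_sin (D_id x))) (D_pow j (D_cos (D_id x)))) _.
by ring.
Qed.

Lemma D_const f a b : a < b -> (forall x, a < x < b -> is_derive x 1 f 0) ->
  (forall x, a <= x <= b -> {for x, continuous f}) -> f a = f b.
Proof.
move=> ab df cf.
have h1 x : x \in `]a, b[ -> is_derive x 1 f 0 by rewrite in_itv /=; exact: df.
have h2 : {within `[a, b], continuous f}.
  by apply: continuous_in_subspaceT => x; rewrite inE /= in_itv /=; exact: cf.
have [c _] := MVT ab h1 h2.
by move=> /eqP; rewrite mul0r subr_eq0 => /eqP.
Qed.

Lemma D_nondecr f (df : R -> R) a b : a <= b -> (forall x, a < x < b -> is_derive x 1 f (df x)) ->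
  (forall x, a < x < b -> 0 <= df x) ->
  (forall x, a <= x <= b -> {for x, continuous f}) -> f a <= f b.
Proof.
rewrite le_eqVlt => /predU1P[->//|ab] hdf df0 cf.
have h1 x : x \in `]a, b[ -> is_derive x 1 f (df x) by rewrite in_itv /=; exact: hdf.
have h2 : {within `[a, b], continuous f}.
  by apply: continuous_in_subspaceT => x; rewrite inE /= in_itv /=; exact: cf.
have [c] := MVT ab h1 h2.
rewrite in_itv /= => /df0 c0 E.
by rewrite -subr_ge0 E mulr_ge0 // subr_ge0 ltW.
Qed.

End Calc.

(** * Euclidean gradients and their behaviour under a positive functional *)

Section Gradients.
Context {R : realType} {n : nat}.
Local Notation V := 'rV[R]_n.
Implicit Types (f : V -> R) (x v w g : V).

Lemma einnerDl v w g : einner (v + w) g = einner v g + einner w g.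
Proof. exact: (linearD (einnerl g)). Qed.
Lemma einnerZl a v g : einner (a *: v) g = a * einner v g.
Proof. exact: (linearZ_LR (einnerl g)). Qed.
Lemma einnerNl v g : einner (- v) g = - einner v g.
Proof. exact: (linearN (einnerl g)). Qed.
Lemma einnerBl v w g : einner (v - w) g = einner v g - einner w g.
Proof. exact: (linearB (einnerl g)). Qed.
Lemma einner0l g : einner 0 g = 0 :> R.
Proof. exact: (linear0 (einnerl g)). Qed.
Lemma einnerDr v w g : einner g (v + w) = einner g v + einner g w.
Proof. by rewrite !(einnerC g) einnerDl. Qed.
Lemma einnerZr a v g : einner g (a *: v) = a * einner g v.
Proof. by rewrite !(einnerC g) einnerZl. Qed.
Lemma einnerNr v g : einner g (- v) = - einner g v.
Proof. by rewrite !(einnerC g) einnerNl. Qed.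
Lemma einnerBr v w g : einner g (v - w) = einner g v - einner g w.
Proof. by rewrite !(einnerC g) einnerBl. Qed.
Lemma einner0r g : einner g 0 = 0 :> R.
Proof. by rewrite einnerC einner0l. Qed.

Definition einnerE := (einnerDl, einnerDr, einnerBl, einnerBr, einnerNl, einnerNr,
  einnerZl, einnerZr, einner0l, einner0r).

Lemma einner_ebasis i g : einner (ebasis R i) g = g 0 i.
Proof.
rewrite /einner (bigD1 i) //= big1 ?addr0 => [|j ji].
  by rewrite mxE !eqxx mul1r.
by rewrite mxE eqxx (negPf ji) mul0r.
Qed.

Lemma einner_sum_basis v : v = \sum_(i < n) v 0 i *: ebasis R i.
Proof. exact: row_sum_delta. Qed.

Lemma einner_ge0 v : 0 <= einner v v.
Proof. by apply: sumr_ge0 => i _; rewrite -expr2 sqr_ge0. Qed.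

Lemma enormE v : enorm v = Num.sqrt (einner v v).
Proof. by congr Num.sqrt; apply: eq_bigr => i _; rewrite expr2. Qed.

Lemma enorm_sqr v : enorm v ^+ 2 = einner v v.
Proof. by rewrite enormE sqr_sqrtr // einner_ge0. Qed.

Lemma enorm_ge0 v : 0 <= enorm v.
Proof. exact: sqrtr_ge0. Qed.

Lemma enormZ a v : enorm (a *: v) = `|a| * enorm v.
Proof. by rewrite !enormE !einnerE mulrA -expr2 sqrtrM ?sqr_ge0 // sqrtr_sqr. Qed.

Lemma enorm0 : enorm (0 : V) = 0.
Proof. by rewrite enormE einner0l sqrtr0. Qed.

Lemma einner_eq0 v : (einner v v == 0) = (v == 0).
Proof.
apply/eqP/eqP => [h|->]; last by rewrite einner0l.
apply/rowP => i; rewrite mxE; apply/eqP; rewrite -sqrf_eq0 expr2.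
move/eqP: h; rewrite psumr_eq0 => [|j _]; last by rewrite -expr2 sqr_ge0.
by move=> /allP /(_ i); rewrite mem_index_enum => /(_ isT).
Qed.

Lemma cauchy_schwarz v w : `|einner v w| <= enorm v * enorm w.
Proof.
rewrite -ler_sqr ?nnegrE ?mulr_ge0 ?enorm_ge0 // exprMn !enorm_sqr real_normK ?num_real //.
have [->|v0] := eqVneq v 0; first by rewrite !einner0l expr0n mul0r.
have vv : 0 < einner v v by rewrite lt_neqAle einner_ge0 eq_sym einner_eq0 v0.
have := einner_ge0 (einner v v *: w - einner v w *: v).
rewrite !einnerE (einnerC w v) => h.
have {}h : 0 <= einner v v * (einner v v * einner w w - einner v w ^+ 2).
  by move: h; congr (0 <= _); ring.
by rewrite pmulr_rge0 // subr_ge0 in h.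
Qed.

(** States that the differential is the pairing with [g], so that the calculus rules need no sums
    over partial derivatives; [diff_hasgrad] and [hasgrad_grad] translate from and to [grad]. *)
Definition hasgrad f x g := is_diff x f (einnerl g).

Lemma hasgrad_derive f x g v : hasgrad f x g -> 'D_v f x = einner v g.
Proof. by case=> df E; rewrite deriveE // E. Qed.

Lemma hasgrad_partial f x g i : hasgrad f x g -> partial i f x = g 0 i.
Proof. by move=> h; rewrite /partial (hasgrad_derive _ h) einner_ebasis. Qed.

Lemma hasgrad_grad f x g : hasgrad f x g -> grad f x = g.
Proof. by move=> h; apply/rowP => i; rewrite mxE (hasgrad_partial _ h). Qed.

Lemma diff_hasgrad f x : differentiable f x -> hasgrad f x (grad f x).
Proof.
move=> df; split=> //; apply/funext => v.
rewrite /einnerl [v in LHS]einner_sum_basis linear_sum; apply: eq_bigr => i _.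
by rewrite linearZ /= mxE /partial deriveE.
Qed.

Lemma hasgrad_cont f x g : hasgrad f x g -> {for x, continuous f}.
Proof. by case=> df _; exact: differentiable_continuous. Qed.

Lemma hasgrad_eq f x g g' : hasgrad f x g -> g = g' -> hasgrad f x g'.
Proof. by move=> + <-. Qed.

Lemma hasgrad_cst c x : hasgrad (fun=> c) x 0.
Proof.
apply: (@is_diff_eq _ _ _ _ _ _ _ (is_diff_cst c x)).
by apply/funext => h; rewrite /einnerl einner0r.
Qed.

Lemma hasgradD f1 f2 x g1 g2 : hasgrad f1 x g1 -> hasgrad f2 x g2 ->
  hasgrad (fun y => f1 y + f2 y) x (g1 + g2).
Proof.
move=> h1 h2; apply: (@is_diff_eq _ _ _ _ _ _ _ (is_diffD h1 h2)).
by apply/funext => h; rewrite /einnerl einnerDr.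
Qed.

Lemma hasgradN f1 x g1 : hasgrad f1 x g1 -> hasgrad (fun y => - f1 y) x (- g1).
Proof.
move=> h1; apply: (@is_diff_eq _ _ _ _ _ _ _ (is_diffN h1)).
by apply/funext => h; rewrite /einnerl einnerNr.
Qed.

Lemma hasgradB f1 f2 x g1 g2 : hasgrad f1 x g1 -> hasgrad f2 x g2 ->
  hasgrad (fun y => f1 y - f2 y) x (g1 - g2).
Proof. by move=> h1 h2; apply: hasgradD => //; exact: hasgradN. Qed.

Lemma hasgradM f1 f2 x g1 g2 : hasgrad f1 x g1 -> hasgrad f2 x g2 ->
  hasgrad (fun y => f1 y * f2 y) x (f1 x *: g2 + f2 x *: g1).
Proof.
move=> h1 h2; apply: (@is_diff_eq _ _ _ _ _ _ _ (is_diffM h1 h2)).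
by apply/funext => h; rewrite /einnerl !einnerE.
Qed.

Lemma hasgrad_lin w x : hasgrad (fun y => einner y w) x w.
Proof.
apply: is_diff_bound => e e0; near=> h.
have E (a b : R) : a + b - a - b = 0 by ring.
by rewrite einnerDl E normr0 mulr_ge0 // ltW.
Unshelve. all: by end_near. Qed.

Lemma hasgrad_linl w x : hasgrad (fun y => einner w y) x w.
Proof. by under eq_fun do rewrite einnerC; exact: hasgrad_lin. Qed.

Lemma hasgrad_sum (I : Type) (r : seq I) (F : I -> V -> R) (G : I -> V) x :
  (forall i, hasgrad (F i) x (G i)) ->
  hasgrad (fun y => \sum_(i <- r) F i y) x (\sum_(i <- r) G i).
Proof.
move=> h; elim: r => [|i r ih].
  by under eq_fun do rewrite big_nil; rewrite big_nil; exact: hasgrad_cst.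
by under eq_fun do rewrite big_cons; rewrite big_cons; exact: hasgradD.
Qed.

Lemma hasgrad_sq x : hasgrad (fun y => einner y y) x (2 *: x).
Proof.
have := @hasgrad_sum _ (index_enum 'I_n) (fun i y => einner (ebasis R i) y * einner (ebasis R i) y) _ x
  (fun i => hasgradM (@hasgrad_linl (ebasis R i) x) (@hasgrad_linl (ebasis R i) x)).
under eq_fun do under eq_bigr do rewrite !einner_ebasis.
move=> /hasgrad_eq; apply.
rewrite [in RHS](einner_sum_basis x) scaler_sumr; apply: eq_bigr => i _.
by rewrite einner_ebasis -scalerDl scalerA; congr (_ *: _); ring.
Qed.

Lemma hasgrad_comp1 (phi : R -> R) c f x g : is_derive (f x) 1 phi c -> hasgrad f x g ->
  hasgrad (fun y => phi (f y)) x (c *: g).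
Proof.
move=> [dphi Ephi] h.
have hphi : is_diff (f x) phi (fun h => c * h).
  split; first exact/derivable1_diffP.
  apply/funext => k; rewrite diff1E; last exact/derivable1_diffP.
  by rewrite derive1E Ephi /= [_ *: _]mulrC.
apply: (@is_diff_eq _ _ _ _ _ _ _ (is_diff_comp h hphi)).
by apply/funext => k; rewrite /einnerl /= einnerZr.
Qed.

Lemma hasgrad_affine f b a x g : hasgrad f (b + a *: x) g ->
  hasgrad (fun y => f (b + a *: y)) x (a *: g).
Proof.
move=> h.
have h1 : is_diff x (fun y => b + a *: y) (fun k => a *: k).
  apply: (@is_diff_eq _ _ _ _ _ _ _ (is_diffD (is_diff_cst b x) (is_diff_scaler a x))).
  by apply/funext => k; rewrite fctE /= add0r.
apply: (@is_diff_eq _ _ _ _ _ _ _ (is_diff_comp h1 h)).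
by apply/funext => k; rewrite /einnerl /= einnerZr einnerZl.
Qed.

Lemma hasgrad_scale f a x g : hasgrad f (a *: x) g -> hasgrad (fun y => f (a *: y)) x (a *: g).
Proof.
by under eq_fun do rewrite -(add0r (a *: _)); rewrite -{1}(add0r (a *: x)); exact: hasgrad_affine.
Qed.

Lemma hasgrad_curve f (c : R -> V) (t : R) g w : hasgrad f (c t) g -> is_derive t 1 c w ->
  is_derive t 1 (fun s => f (c s)) (einner w g).
Proof.
move=> [df Ef] [dc Ec].
have dc' : differentiable c t by exact/derivable1_diffP.
have dfc : differentiable (f \o c) t by exact: differentiable_comp.
split; first exact/derivable1_diffP.
have E1 : 'd c t 1 = w by rewrite -Ec deriveE.
by rewrite (_ : 'D_1 _ t = 'D_1 (f \o c) t) // deriveE // diff_comp //= E1 Ef.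
Qed.

Lemma is_derive_scalel (a : R -> R) (t a' : R) (w : V) : is_derive t 1 a a' ->
  is_derive t 1 (fun s => a s *: w) (a' *: w).
Proof.
move=> [da Ea].
have da' : differentiable a t by exact/derivable1_diffP.
split; first by apply/derivable1_diffP; exact: differentiableZl.
have E1 : 'd a t 1 = a' by rewrite -Ea deriveE.
rewrite deriveE; last exact: differentiableZl.
have /(congr1 (fun g : R -> V => g 1)) := diffZl w da'.
by move=> /= ->; rewrite E1.
Qed.

Lemma is_derive_line (b w : V) (t : R) : is_derive t 1 (fun s => b + s *: w) w.
Proof.
have h := is_derive_scalel w (is_derive_id t 1).
apply: (@is_derive_eq _ _ _ _ _ _ _ _ (is_deriveD (is_derive_cst b t 1) h)).
by rewrite add0r scale1r.
Qed.

Lemma cont_row (X : topologicalType) (F : 'I_n -> X -> R) (x : X) :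
  (forall i, {for x, continuous (F i)}) -> {for x, continuous (fun y => \row_i F i y : V)}.
Proof.
move=> hF; apply/cvgrPdist_le => e e0.
have : \forall y \near x, forall i, `|F i x - F i y| <= e.
  apply: filter_forall => i; have := hF i; by move/cvgrPdist_le; apply.
apply: filterS => y hy.
rewrite [leLHS]/Num.norm /= mx_normrE; apply: bigmax_le; first exact: ltW.
by move=> [i j] _ /=; rewrite !mxE; exact: hy.
Qed.

Lemma cont_coord (X : topologicalType) (F : X -> V) (x : X) i :
  {for x, continuous F} -> {for x, continuous (fun y => F y 0 i)}.
Proof.
by move=> h; apply: (@continuous_comp _ _ _ F (fun v : V => v 0 i)) => //; exact: coord_continuous.
Qed.

Lemma cont_einner (X : topologicalType) (F G : X -> V) (x : X) :
  {for x, continuous F} -> {for x, continuous G} ->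
  {for x, continuous (fun y => einner (F y) (G y))}.
Proof.
move=> hF hG; rewrite /einner.
rewrite /prop_for /continuous_at.
elim: (index_enum _) => [|i r ih].
  by under eq_fun do rewrite big_nil; rewrite big_nil; exact: cvg_cst.
under eq_fun do rewrite big_cons; rewrite big_cons.
by apply: cvgD ih; apply: cvgM; exact: cont_coord.
Qed.

Definition c1 (U : set V) f (G : V -> V) := forall x, U x -> hasgrad f x (G x) /\ {for x, continuous G}.

Lemma c1_contK U f G (K : set V) : open U -> K `<=` U -> c1 U f G -> contK K f.
Proof.
move=> oU KU h t /KU Ut.
have hU : \forall s \near t, U s by exact: open_nbhs_nbhs.
by near=> s; have /h[/hasgrad_cont] : U s by near: s.
Unshelve. all: by end_near. Qed.

Section PfDiff.
Context {T : topologicalType}.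
Variables (K : set T) (L : (T -> R) -> R) (hL : posfun K L).

(** The argument of [pf_derive], carried out along the segment from x0 to x0 + h. *)
Lemma pf_hasgrad (F : V -> T -> R) (G : V -> T -> V) x0 :
  jcont K F x0 -> (forall i, jcont K (fun x t => G x t 0 i) x0) ->
  (\forall x \near x0, forall t, K t -> hasgrad (F^~ t) x (G x t)) ->
  hasgrad (fun x => L (F x)) x0 (\row_i L (fun t => G x0 t 0 i)).
Proof.
move=> cF cGi dF.
have cGi0 i : contK K (fun t => G x0 t 0 i) := jcont_contK (cGi i).
apply: is_diff_bound => e e0.
pose c := L (fun=> 1) + 1.
have c_gt0 : 0 < c by rewrite /c ltr_wpDl // (pf1_ge0 hL).
(* [einner_bound] loses a factor n; n + 1 absorbs it and stays positive. *)
pose c' := (n%:R + 1) * c.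
have c'_gt0 : 0 < c' by rewrite mulr_gt0 // ltr_wpDl.
have ec : 0 < e / c' by exact: divr_gt0.
have c0 := jcont_contK cF.
have : \forall x \near x0, contK K (F x) /\ (forall t, K t -> hasgrad (F^~ t) x (G x t))
   /\ (forall i t, K t -> `|G x t 0 i - G x0 t 0 i| <= e / c').
  near=> x; split.
    by apply: jcont_contK; near: x; exact: jcont_near (pf_compact hL) cF.
  split; first by near: x.
  near: x; apply: filter_forall => i.
  exact: (unif_near (F := fun x t => G x t 0 i) (pf_compact hL) (cGi i) ec).
move=> /nbhs_ballP[d /= d0 hd]; apply/nbhs_ballP; exists d => //= h /= hh.
have hs (s : R) : `|s| <= 1 -> ball x0 d (x0 + s *: h).
  move=> s1; rewrite -ball_normE /= opprD addrA subrr sub0r normrN normrZ.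
  apply: le_lt_trans (_ : `|h| < d); first by rewrite ler_piMl.
  by move: hh; rewrite -ball_normE /= sub0r normrN.
have h11 : `|1 : R| <= 1 by rewrite normr1.
have [ch _] := hd _ (hs 1 h11).
rewrite scale1r in ch.
have -> : L (F (x0 + h)) - L (F x0) - einner h (\row_i L (fun t => G x0 t 0 i)) =
    L (fun t => F (x0 + h) t - F x0 t - einner h (G x0 t)).
  have cs : contK K (fun t => einner h (G x0 t)).
    apply: contK_sum => i; apply: contKM => //; exact: contK_cst.
  rewrite (pfB hL) //; last exact: contKB.
  rewrite (pfB hL) //; congr (_ - _).
  rewrite /einner (pf_sum hL) => [|i]; last by apply: contKM => //; exact: contK_cst.
  by apply: eq_bigr => i _; rewrite mxE (pfZ hL).
apply: le_trans (pf_abs_cst hL (c := n%:R * (e / c') * `|h|) _ _) _.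
- apply: contKB; first exact: contKB.
  by apply: contK_sum => i; apply: contKM => //; exact: contK_cst.
- move=> t Kt.
  (* The one-variable function is s -> F (x0 + s h) t, with base point 0 and increment 1. *)
  have := @MVT_bound _ (fun s => F (x0 + s *: h) t)
    (fun s => einner h (G (x0 + s *: h) t)) 0 1 (einner h (G x0 t)) (n%:R * (e / c') * `|h|).
  rewrite !add0r scale1r scale0r addr0 mulr1 normr1 mulr1; apply.
  + move=> s s1; rewrite add0r; apply: (@hasgrad_curve (F^~ t) (fun s => x0 + s *: h) s
      (G (x0 + s *: h) t) h); last exact: is_derive_line.
    by have [_ [h1 _]] := hd _ (hs s s1); exact: h1.
  + move=> s s1; rewrite add0r -einnerBr; apply: einner_bound => i.
    by rewrite !mxE; have [_ [_ h2]] := hd _ (hs s s1); exact: h2.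
- rewrite mulrAC ler_wpM2r //.
  have -> : n%:R * (e / c') * L (fun=> 1) = e * (n%:R * L (fun=> 1)) / c' by ring.
  rewrite ler_pdivrMr //; apply: ler_wpM2l; first exact: ltW.
  by apply: ler_pM => //; rewrite ?lerDl ?(pf1_ge0 hL).
Unshelve. all: by end_near. Qed.

Lemma pf_einner (H : T -> V) w : (forall i, contK K (fun t => H t 0 i)) ->
  einner w (\row_i L (fun t => H t 0 i)) = L (fun t => einner w (H t)).
Proof.
move=> cH; rewrite /einner (pf_sum hL) => [|i]; last by apply: contKM => //; exact: contK_cst.
by apply: eq_bigr => i _; rewrite mxE (pfZ hL).
Qed.

End PfDiff.
End Gradients.

(** * The integral over a segment *)

HB.lock Definition integ {R : realType} (a b : R) (f : R -> R) : R :=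
  (\int[lebesgue_measure]_(x in `[a, b]) f x)%R.

Section Integral.
Context {R : realType}.
Implicit Types (f g F : R -> R) (a b : R).

Lemma contK_within a b f : contK `[a, b] f -> {within `[a, b], continuous f}.
Proof.
move=> cf; apply: continuous_in_subspaceT => x; rewrite inE => xab.
exact: nbhs_singleton (cf x xab).
Qed.

Lemma contK_integrable a b f : contK `[a, b] f ->
  lebesgue_measure.-integrable `[a, b] (EFin \o f).
Proof.
move=> cf; apply: continuous_compact_integrable; first exact: segment_compact.
exact: contK_within.
Qed.

Lemma integ_posfun a b : posfun `[a, b] (integ a b).
Proof.
split; first exact: segment_compact.
- move=> k f g cf cg; rewrite integ.unlock RintegralD //.
  + by rewrite RintegralZl //; exact: contK_integrable.
  + by apply: contK_integrable; apply: contKM => //; exact: contK_cst.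
  + exact: contK_integrable.
- by move=> f _ f0; rewrite integ.unlock; apply: Rintegral_ge0.
Qed.

Lemma integ_FTC2 a b f F : a < b -> contK `[a, b] f ->
  (forall x, a <= x <= b -> {for x, continuous F}) ->
  (forall x, a < x < b -> is_derive x 1 F (f x)) -> integ a b f = F b - F a.
Proof.
move=> ab cf cF dF; rewrite integ.unlock /Rintegral (@continuous_FTC2 _ f F) //.
- exact: contK_within.
- split.
  + by move=> x; rewrite in_itv /= => /dF[].
  + by apply: cvg_at_right_filter; apply: cF; rewrite lexx ltW.
  + by apply: cvg_at_left_filter; apply: cF; rewrite lexx ltW.
- by move=> x; rewrite in_itv /= => /dF[_ h]; rewrite derive1E.
Qed.

Lemma integ_FTC1 a f x : a < x -> continuous f -> is_derive x 1 (fun t => integ a t f) (f x).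
Proof.
move=> ax cf; have x1 : x < x + 1 by rewrite ltrDl.
have i1 := contK_integrable (contK_continuous (K := `[a, x + 1]%classic) cf).
have [d e] := continuous_FTC1_closed x1 i1 ax (cf x).
rewrite integ.unlock; apply: DeriveDef; first exact: d.
by rewrite -derive1E; exact: e.
Qed.

(* Interchange of integrals, by differentiating in the upper bound. *)
Lemma integ_swap a b c d (f : R -> R -> R) : a < b ->
  continuous (fun p : R * R => f p.1 p.2) ->
  integ a b (fun x => integ c d (f x)) = integ c d (fun y => integ a b (f^~ y)).
Proof.
move=> ab cf.
have cf2 x : continuous (f x).
  move=> y; apply: (@cont_comp2 _ _ _ _ (fun=> x) id f); last exact: cf.
    exact: cst_continuous.
  by move=> ?.
have cf1 y : continuous (f^~ y).
  move=> x; apply: (@cont_comp2 _ _ _ _ id (fun=> y) f); last exact: cf.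
    by move=> ?.
  exact: cst_continuous.
have cfs : continuous (fun p : R * R => f p.2 p.1).
  move=> p; apply: (@cont_comp2 _ _ _ _ (@snd R R) (@fst R R) f); last exact: cf.
    exact: cvg_snd.
  exact: cvg_fst.
have jc (x : R) : jcont `[c, d] f x by exact: jcont_continuous.
have jcs (u v y : R) : jcont `[u, v] (fun y x => f x y) y by exact: jcont_continuous.
pose P t y := integ (a - 1) t (f^~ y).
have a1 : a - 1 < a by rewrite ltrBlDr ltrDl.
have dP y t : a - 1 < t -> is_derive t 1 (fun t => P t y) (f t y).
  by move=> at1; exact: (integ_FTC1 at1 (@cf1 y)).
have EP y : integ a b (f^~ y) = P b y - P a y.
  apply: (@integ_FTC2 a b (f^~ y) (P^~ y)) => //; first exact: contK_continuous.
  - by move=> x /andP[ax _]; apply: is_derive_cont (dP y x _); exact: lt_le_trans ax.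
  - by move=> x /andP[ax _]; apply: dP; exact: lt_trans ax.
have cP t : continuous (P t).
  by move=> y; apply: (pf_continuous1 (integ_posfun (a - 1) t)); exact: jcs.
have dPhi t : a - 1 < t -> is_derive t 1 (fun t => integ c d (P t)) (integ c d (f t)).
  move=> at1; apply: (pf_derive (integ_posfun c d)) => //.
    by near=> s0; exact: contK_continuous.
  near=> s => y _; apply: dP; near: s; exact: lt_nbhsr.
have E : integ a b (fun x => integ c d (f x)) = integ c d (P b) - integ c d (P a).
  apply: (@integ_FTC2 a b (fun x => integ c d (f x)) (fun t => integ c d (P t)) ab).
  - by apply: contK_continuous => x; exact: (pf_continuous1 (integ_posfun c d) (jc x)).
  - by move=> x /andP[ax _]; apply: is_derive_cont (dPhi x _); exact: lt_le_trans ax.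
  - by move=> x /andP[ax _]; apply: dPhi; exact: lt_trans ax.
rewrite E -(pfB (integ_posfun c d) (contK_continuous (@cP b)) (contK_continuous (@cP a))).
by congr integ; apply/funext => y; rewrite EP.
Unshelve. all: by end_near. Qed.

End Integral.

(** * Spherical averages, and the join of two of them *)

Section Means.
Context {R : realType} {n : nat}.
Local Notation V := 'rV[R]_n.
Implicit Types (K D U : set V) (f : V -> R) (G : V -> V) (v w : V).

(* [mean_div] is the divergence theorem on the unit sphere of an [N]-dimensional space,
   for the tangential part of the constant field [v]. *)
Record mean K D (N : nat) (M : (V -> R) -> R) : Prop := Mean {
  mean_pf : posfun K M;
  mean_sphere : forall x, K x -> einner x x = 1;
  mean_div : forall U f G v, open U -> K `<=` U -> c1 U f G -> D v ->
    M (fun x => einner v (G x) - einner v x * (einner x (G x) + N.-1%:R * f x)) = 0;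
  mean_ctr : forall v, D v -> M (einner v) = 0;
  mean_gt0 : 0 < M (fun=> 1) }.

Lemma contK_einner {T : topologicalType} (K : set T) (F G : T -> V) : contK K F -> contK K G ->
  contK K (fun t => einner (F t) (G t)).
Proof.
by move=> cF cG t Kt; apply: filterS2 (cF t Kt) (cG t Kt) => s; exact: cont_einner.
Qed.

Lemma contK_coord {T : topologicalType} (K : set T) (F : T -> V) i : contK K F ->
  contK K (fun t => F t 0 i).
Proof. by move=> cF t Kt; apply: filterS (cF t Kt) => s; exact: cont_coord. Qed.

Lemma contK_vcst {T : topologicalType} (K : set T) (v : V) : contK K (fun=> v).
Proof. by apply: contK_continuous => t; exact: cst_continuous. Qed.

Arguments contK_vcst {T} K v t _ : rename.

Lemma contK_id (K : set V) : contK K (fun x => x).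
Proof. by apply: contK_continuous => x; exact: cvg_id. Qed.

Arguments contK_id : clear implicits.

Lemma contK_vD {T : topologicalType} (K : set T) (F G : T -> V) : contK K F -> contK K G ->
  contK K (fun t => F t + G t).
Proof. by move=> cF cG t Kt; apply: filterS2 (cF t Kt) (cG t Kt) => s; exact: continuousD. Qed.

Lemma contK_vZ {T : topologicalType} (K : set T) (a : T -> R) (G : T -> V) : contK K a -> contK K G ->
  contK K (fun t => a t *: G t).
Proof. by move=> cF cG t Kt; apply: filterS2 (cF t Kt) (cG t Kt) => s; exact: continuousZ. Qed.

Lemma c1_contKG U f G K : open U -> K `<=` U -> c1 U f G -> contK K G.
Proof.
move=> oU KU h t /KU Ut.
have hU : \forall s \near t, U s by exact: open_nbhs_nbhs.
by near=> s; have /h[] : U s by near: s.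
Unshelve. all: by end_near. Qed.

Lemma integ_gt0 (a b : R) (f : R -> R) : a < b -> continuous f ->
  (forall x, a < x < b -> 0 < f x) -> 0 < integ a b f.
Proof.
move=> ab cf f0.
(* Starting to the left of a makes the primitive differentiable on both sides at every point of
   [a, b], endpoints included. *)
pose F t := integ (a - 1) t f.
have a1 : a - 1 < a by rewrite ltrBlDr ltrDl.
have dF t : a - 1 < t -> is_derive t 1 F (f t) by move=> h; exact: integ_FTC1.
have -> : integ a b f = F b - F a.
  apply: (@integ_FTC2 _ a b f F ab) => [|x /andP[ax _]|x /andP[ax _]].
  - exact: contK_continuous.
  - by apply: is_derive_cont (dF x _); exact: lt_le_trans ax.
  - by apply: dF; exact: lt_trans ax.
rewrite subr_gt0.
have [| |c] := @MVT _ F f a b ab.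
- by move=> x; rewrite in_itv /= => /andP[ax _]; apply: dF; exact: lt_trans ax.
- apply: continuous_in_subspaceT => x; rewrite inE /= in_itv /= => /andP[ax _].
  by apply: is_derive_cont (dF x _); exact: lt_le_trans ax.
by rewrite in_itv /= => /f0 fc E; rewrite -subr_gt0 E mulr_gt0 // subr_gt0.
Qed.

(** The zero-dimensional sphere, from which the others are built. *)
Definition two_point w : (V -> R) -> R := fun f => f w + f (- w).

Lemma two_point_mean w : einner w w = 1 ->
  mean [set x | x = w \/ x = - w] [set w] 1 (two_point w).
Proof.
move=> w1; split.
- exact: (pf_add (pf_pt w) (pf_pt (- w))).
- by move=> x [->|->] //; rewrite !einnerE opprK.
- move=> U f G v oU KU c1f -> /=; rewrite /two_point !einnerE w1; ring.
- by move=> v ->; rewrite /two_point !einnerE subrr.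
- by rewrite /two_point ltr_wpDl.
Qed.

Definition join_point (b : R) (x y : V) : V := sin b *: x + cos b *: y.

(** Polar coordinates on the sphere of dimension p + q - 1, seen as the join of spheres of
    dimensions p - 1 and q - 1: the weight is the surface density in the angle b, up to a constant
    factor. *)
Definition join (p q : nat) (A B : (V -> R) -> R) : (V -> R) -> R := fun f =>
  integ 0 (pi / 2) (fun b => A (fun x => B (fun y =>
    sin b ^+ p.-1 * cos b ^+ q.-1 * f (join_point b x y)))).

(** The computation behind [join_div1]. Here s and c are the sine and cosine of b, P = p - 1, Q = q
    - 1, A0 and C0 are the powers s^P and c^Q, and D stands for s^(p - 2); D is constrained only
    through the factor P, which keeps p = 1 within reach. On the left is the derivative of s^P c^(Q
    + 1) L, on the right the divergence integrand averaged at fixed b. *)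
Lemma join_algebra1 (s c A0 C0 D P Q GV LX LY L : R) : s != 0 -> c ^+ 2 + s ^+ 2 = 1 ->
  P * D * s = P * A0 -> s * GV = s * LX + P * L ->
  (P * D * c * (c * C0) - (Q + 1) * C0 * s * A0) * L + A0 * (c * C0) * (c * LX - s * LY) =
  A0 * C0 * (GV - s * (s * LX + c * LY + (P + Q + 1) * L)).
Proof.
move=> s0 cs hD hG; apply: (mulfI s0); apply/eqP; rewrite -subr_eq0; apply/eqP.
transitivity ((P * D * s - P * A0) * (c * c * C0 * L) - A0 * C0 * (s * GV - (s * LX + P * L)) +
  (c ^+ 2 + s ^+ 2 - 1) * (A0 * C0 * (P * L + s * LX))); first by ring.
by rewrite cs hD hG !subrr !(mul0r, mulr0) subr0 addr0.
Qed.

Lemma join_algebra2 (s c A0 C0 D P Q GV LX LY L : R) : c != 0 -> c ^+ 2 + s ^+ 2 = 1 ->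
  Q * D * c = Q * C0 -> c * GV = c * LY + Q * L ->
  - (((P + 1) * A0 * c * C0 - Q * D * s * (s * A0)) * L + (s * A0) * C0 * (c * LX - s * LY)) =
  A0 * C0 * (GV - c * (s * LX + c * LY + (P + Q + 1) * L)).
Proof.
move=> c0 cs hD hG; apply: (mulfI c0); apply/eqP; rewrite -subr_eq0; apply/eqP.
transitivity ((Q * D * c - Q * C0) * (s * s * A0 * L) - A0 * C0 * (c * GV - (c * LY + Q * L)) +
  (c ^+ 2 + s ^+ 2 - 1) * (A0 * C0 * (Q * L + c * LY))); first by ring.
by rewrite cs hD hG !subrr !(mul0r, mulr0) subr0 addr0.
Qed.

Section Join.
Variables (K1 K2 D1 D2 : set V) (p q : nat) (A B : (V -> R) -> R).
Hypotheses (p0 : (0 < p)%N) (q0 : (0 < q)%N).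
Hypotheses (hA : mean K1 D1 p A) (hB : mean K2 D2 q B).
Hypotheses (K12 : forall x y, K1 x -> K2 y -> einner x y = 0).
Hypotheses (D1K2 : forall v y, D1 v -> K2 y -> einner v y = 0).
Hypotheses (D2K1 : forall v x, D2 v -> K1 x -> einner v x = 0).

Let I01 : set R := `[0, pi / 2]%classic.
Let L12 (h : V * V -> R) : R := A (fun x => B (fun y => h (x, y))).
Let Phi (t : R * (V * V)) : V := join_point t.1 t.2.1 t.2.2.
Let wt (t : R * (V * V)) : R := sin t.1 ^+ p.-1 * cos t.1 ^+ q.-1.
Let K := Phi @` (I01 `*` (K1 `*` K2)).

Lemma pihalf_gt0 : 0 < pi / 2 :> R.
Proof. by rewrite divr_gt0 // pi_gt0. Qed.

Lemma continuous_trig_pow (i j : nat) : continuous (fun b : R => sin b ^+ i * cos b ^+ j).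
Proof.
move=> b; apply: (@continuousM _ _ (fun b => sin b ^+ i) (fun b => cos b ^+ j)).
  apply: (@continuous_comp _ _ _ sin (fun x : R => x ^+ i)); last exact: exprn_continuous.
  exact: continuous_sin.
apply: (@continuous_comp _ _ _ cos (fun x : R => x ^+ j)); last exact: exprn_continuous.
exact: continuous_cos.
Qed.

Lemma cont_join_point (X : topologicalType) (b : X -> R) (x y : X -> V) t :
  {for t, continuous b} -> {for t, continuous x} -> {for t, continuous y} ->
  {for t, continuous (fun s => join_point (b s) (x s) (y s))}.
Proof.
move=> cb cx cy; apply: continuousD; apply: continuousZ => //.
  by apply: (@continuous_comp _ _ _ b sin) => //; exact: continuous_sin.
by apply: (@continuous_comp _ _ _ b cos) => //; exact: continuous_cos.
Qed.

Let cPhi : continuous Phi.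
Proof.
move=> t; apply: cont_join_point.
- exact: cvg_fst.
- apply: (@continuous_comp _ _ _ (@snd R (V * V)) (@fst V V)); [exact: cvg_snd|exact: cvg_fst].
- apply: (@continuous_comp _ _ _ (@snd R (V * V)) (@snd V V)); [exact: cvg_snd|exact: cvg_snd].
Qed.

Let pf12 : posfun (K1 `*` K2) L12 := pf_prod (mean_pf hA) (mean_pf hB).

Lemma sin_cos_ge0 b : I01 b -> 0 <= sin b /\ 0 <= cos b.
Proof.
rewrite /I01 /= in_itv /= => /andP[b0 b1]; have ph := pihalf_gt0; split.
  by apply: sin_ge0_pi; rewrite b0 (le_trans b1) // ler_pdivrMr // ler_peMr ?pi_ge0 // ler1n.
by apply: cos_ge0_pihalf; rewrite b1 andbT (le_trans _ b0) // oppr_le0 ltW.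
Qed.

Lemma join_posfun : posfun K (join p q A B).
Proof.
have cw : contK (I01 `*` (K1 `*` K2)) wt.
  apply: contK_continuous => t.
  by apply: (@continuous_comp _ _ _ (@fst R (V * V)) (fun b => sin b ^+ p.-1 * cos b ^+ q.-1));
    [exact: cvg_fst|exact: continuous_trig_pow].
have w0 t : (I01 `*` (K1 `*` K2)) t -> 0 <= wt t.
  by case=> /sin_cos_ge0[s0 c0] _; rewrite mulr_ge0 ?exprn_ge0.
exact: (pf_push (pf_weight (pf_prod (integ_posfun 0 (pi / 2)) pf12) cw w0) (contK_continuous cPhi)).
Qed.


Let QK : set (R * (V * V)) := I01 `*` (K1 `*` K2).

Lemma is_derive_join_point (b : R) (x y : V) :
  is_derive b 1 (fun s => join_point s x y) (cos b *: x - sin b *: y).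
Proof.
rewrite -scaleNr.
exact: (is_deriveD (is_derive_scalel x (is_derive_sin b)) (is_derive_scalel y (is_derive_cos b))).
Qed.

Lemma join_pointE v b x y : einner v (join_point b x y) = sin b * einner v x + cos b * einner v y.
Proof. by rewrite !einnerE. Qed.

Let trig_gt0 (b : R) : 0 < b < pi / 2 -> 0 < sin b /\ 0 < cos b.
Proof.
move=> /andP[b0 b1]; have ph := pihalf_gt0; split.
  by apply: sin_gt0_pihalf; rewrite b0.
by apply: cos_gt0_pihalf; rewrite b1 (lt_trans _ b0) // oppr_lt0.
Qed.

Section Div.
Variables (U : set V) (f : V -> R) (G : V -> V).
Hypotheses (oU : open U) (KU : K `<=` U) (c1f : c1 U f G).

Let fP t := f (Phi t).
Let GP t := G (Phi t).

Let cfP : contK QK fP. Proof. exact: (contK_push (contK_continuous cPhi) (c1_contK oU KU c1f)). Qed.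
Let cGP : contK QK GP. Proof. exact: (contK_push (contK_continuous cPhi) (c1_contKG oU KU c1f)). Qed.

Let cX : contK QK (fun t => t.2.1).
Proof.
apply: contK_continuous => t.
apply: (@continuous_comp _ _ _ (@snd R (V * V)) (@fst V V)); [exact: cvg_snd|exact: cvg_fst].
Qed.

Let cY : contK QK (fun t => t.2.2).
Proof.
apply: contK_continuous => t.
apply: (@continuous_comp _ _ _ (@snd R (V * V)) (@snd V V)); [exact: cvg_snd|exact: cvg_snd].
Qed.

Let ctr (h : R -> R) : continuous h -> contK QK (fun t => h t.1).
Proof.
move=> ch; apply: contK_continuous => t.
by apply: (@continuous_comp _ _ _ (@fst R (V * V)) h); [exact: cvg_fst|exact: ch].
Qed.

Let slice (h : R * (V * V) -> R) b : I01 b -> contK QK h -> contK (K1 `*` K2) (fun t => h (b, t)).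
Proof. exact: contK_prod_slice. Qed.

Let oo (b : R) : 0 < b < pi / 2 -> I01 b.
Proof. by rewrite /I01 /= in_itv /= => /andP[b0 b1]; rewrite !ltW. Qed.

Let dL (Z : V * V -> V) v (b : R) : contK QK (fun t => Z t.2) -> 0 < b < pi / 2 ->
  is_derive b 1 (fun b => L12 (fun t => einner v (Z t) * fP (b, t)))
    (L12 (fun t => einner v (Z t) * einner (cos b *: t.1 - sin b *: t.2) (GP (b, t)))).
Proof.
move=> cZ b01.
have cv : contK QK (fun t => einner v (Z t.2)) := contK_einner (contK_vcst _ v) cZ.
have ch1 : contK QK (fun t => einner v (Z t.2) * fP t) by exact: contKM.
have ch2 : contK QK (fun t => einner v (Z t.2) * einner (cos t.1 *: t.2.1 - sin t.1 *: t.2.2) (GP t)).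
  have c1 := contK_vZ (ctr (@continuous_cos R)) cX.
  have c2 := contK_vZ (contKN (ctr (@continuous_sin R))) cY.
  apply: (contKM cv); apply: contK_einner cGP.
  by under eq_fun do rewrite -scaleNr; exact: (contK_vD c1 c2).
apply: (pf_derive (F := fun b t => einner v (Z t) * fP (b, t))
  (F' := fun b t => einner v (Z t) * einner (cos b *: t.1 - sin b *: t.2) (GP (b, t))) pf12).
- exact: (jcont_near_contK (pf_compact pf12) (contK_prod_jcont (oo b01) ch1)).
- exact: (contK_prod_jcont (oo b01) ch2).
- have /andP[b0 b1] := b01.
  have [n0 n1] := (lt_nbhsr b0, lt_nbhsl b1).
  near=> s => -[x y] [Kx Ky] /=.
  have s01 : I01 s by apply: oo; apply/andP; split; near: s.
  have Ks : U (Phi (s, (x, y))) by apply: KU; exists (s, (x, y)).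
  have [hg _] := c1f Ks.
  apply: D_eq (D_mul (D_cst (einner v (Z (x, y))) s) (hasgrad_curve hg (is_derive_join_point s x y))) _.
  by rewrite mul0r add0r.
Unshelve. all: by end_near. Qed.

Let LD (h1 h2 : V * V -> R) : contK (K1 `*` K2) h1 -> contK (K1 `*` K2) h2 ->
  L12 (fun t => h1 t + h2 t) = L12 h1 + L12 h2.
Proof. exact: (pfD pf12). Qed.
Let LZ (a : R) (h : V * V -> R) : contK (K1 `*` K2) h -> L12 (fun t => a * h t) = a * L12 h.
Proof. exact: (pfZ pf12). Qed.

(* The [B]-average of [f], as a function on a neighbourhood of [K1]. *)
Let divA v (b : R) : D1 v -> 0 < b < pi / 2 ->
  sin b * L12 (fun t => einner v (GP (b, t))) =
  sin b * L12 (fun t => einner v t.1 * einner t.1 (GP (b, t)))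
  + p.-1%:R * L12 (fun t => einner v t.1 * fP (b, t)).
Proof.
move=> Dv b01.
pose F (x y : V) := f (join_point b x y).
pose GF (x y : V) := sin b *: G (join_point b x y).
(* Compactness of [K2] makes this set open, and [g] is C1 on it by [pf_hasgrad]. *)
pose U' : set V := [set x : V | \forall x' \near x, forall y, K2 y -> U (join_point b x' y)].
have cjp : continuous (fun p : V * V => join_point b p.1 p.2).
  by move=> z; apply: cont_join_point; [exact: cst_continuous|exact: cvg_fst|exact: cvg_snd].
have U'U (x : V) : (forall y, K2 y -> U (join_point b x y)) -> U' x.
  move=> h; have /compact_near_coveringP cK2 := pf_compact (mean_pf hB).
  apply: (cK2 V (nbhs x) (fun x' y => U (join_point b x' y))) => y Ky.
  have Uy := h y Ky.
  have := @cjp (x, y) U (open_nbhs_nbhs (conj oU Uy)).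
  by move=> [[/= P Q] [Px Qy] PQ]; exists (Q, P) => //= -[y' x'] [/= Qy' Px']; exact: (PQ (x', y')).
have oU' : open U'.
  by rewrite openE => x /= hx; apply: nbhs_interior hx.
have KU' : K1 `<=` U'.
  move=> x Kx; apply: U'U => y Ky; apply: KU; exists (b, (x, y)) => //.
  by split=> //; exact: oo.
have Ux x : U' x -> forall y, K2 y -> U (join_point b x y) by move=> /nbhs_singleton.
have jF x : U' x -> jcont K2 F x.
  move=> U'x y Ky; have Uxy := Ux _ U'x _ Ky.
  have h : \forall q \near (x, y), U (join_point b q.1 q.2).
    exact: (@cjp (x, y) U (open_nbhs_nbhs (conj oU Uxy))).
  near=> z; apply: (@continuous_comp _ _ _ (fun q : V * V => join_point b q.1 q.2) f); first exact: cjp.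
  have /c1f[/hasgrad_cont //] : U (join_point b z.1 z.2) by near: z.
have jG x i : U' x -> jcont K2 (fun x y => GF x y 0 i) x.
  move=> U'x y Ky; have Uxy := Ux _ U'x _ Ky.
  have h : \forall q \near (x, y), U (join_point b q.1 q.2).
    exact: (@cjp (x, y) U (open_nbhs_nbhs (conj oU Uxy))).
  near=> z; apply: (@cont_coord _ _ _ (fun q : V * V => GF q.1 q.2)).
  apply: (@continuousZ _ _ _ (fun=> sin b) (fun q : V * V => G (join_point b q.1 q.2))).
    exact: cst_continuous.
  apply: (@continuous_comp _ _ _ (fun q : V * V => join_point b q.1 q.2) G); first exact: cjp.
  have /c1f[_ //] : U (join_point b z.1 z.2) by near: z.
pose g x := B (F x).
pose Gg x : V := \row_i B (fun y => GF x y 0 i).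
have c1g : c1 U' g Gg.
  move=> x U'x; split.
    apply: (pf_hasgrad (mean_pf hB)); first exact: jF.
      by move=> i; exact: jG.
    near=> x' => y Ky.
    have hx' : U' x' by near: x'; exact: open_nbhs_nbhs.
    have [hg _] := c1f (Ux _ hx' _ Ky).
    have -> : F^~ y = (fun x => f (cos b *: y + sin b *: x)).
      by apply/funext => z; rewrite /F /join_point addrC.
    by apply: hasgrad_affine; rewrite addrC.
  apply: cont_row => i; apply: (pf_continuous1 (F := fun x y => GF x y 0 i) (mean_pf hB)); exact: jG.
have E := mean_div hA oU' KU' c1g Dv.
have b01' := oo b01.
have cGv := slice (h := fun t => einner v (GP t)) b01' (contK_einner (contK_vcst QK v) cGP).
have cvxG := slice (h := fun t => einner v t.2.1 * einner t.2.1 (GP t)) b01'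
  (contKM (contK_einner (contK_vcst QK v) cX) (contK_einner cX cGP)).
have cvxf := slice (h := fun t => einner v t.2.1 * fP t) b01'
  (contKM (contK_einner (contK_vcst QK v) cX) cfP).
rewrite /= in cGv cvxG cvxf.
apply/eqP; rewrite -subr_eq0; apply/eqP; rewrite -[RHS]E.
have cz (c : R) (h : V * V -> R) : contK (K1 `*` K2) h -> contK (K1 `*` K2) (fun t => c * h t).
  by move=> ch; exact: (contKM (contK_cst _ c) ch).
rewrite -!LZ // -(LD (cz _ _ cvxG) (cz _ _ cvxf)).
have c1' := cz (sin b) _ cGv.
have c2' := contKD (cz (sin b) _ cvxG) (cz p.-1%:R _ cvxf).
rewrite -(pfB pf12 c1' c2').
apply: (pf_ext (mean_pf hA) (contK_prod_inner (mean_pf hB) (contKB c1' c2'))).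
- have cg : contK K1 g by exact: (c1_contK oU' KU' c1g).
  have cGg : contK K1 Gg by exact: (c1_contKG oU' KU' c1g).
  have cx := contK_id K1; have cv := contK_vcst K1 v.
  exact: (contKB (contK_einner cv cGg) (contKM (contK_einner cv cx)
    (contKD (contK_einner cx cGg) (contKM (contK_cst K1 p.-1%:R) cg)))).
- move=> x Kx.
  have cGi i : contK K2 (fun y => GF x y 0 i) by apply: jcont_contK (jG x i _); exact: KU'.
  have cF : contK K2 (F x) by apply: jcont_contK (jF x _); exact: KU'.
  rewrite !(pf_einner (mean_pf hB)) //.
  have cw w : contK K2 (fun y => einner w (GF x y)).
    by apply: contK_sum => i; apply: contKM => //; exact: contK_cst.
  have cz2 (c : R) (h : V -> R) : contK K2 h -> contK K2 (fun y => c * h y).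
    by move=> ch; exact: (contKM (contK_cst _ c) ch).
  have c3 := cz2 p.-1%:R _ cF.
  rewrite -(pfZ (mean_pf hB) _ cF) -(pfD (mean_pf hB) (cw x) c3).
  rewrite -(pfZ (mean_pf hB) _ (contKD (cw x) c3)).
  rewrite -(pfB (mean_pf hB) (cw v) (cz2 _ _ (contKD (cw x) c3))).
  congr B; apply/funext => y; rewrite /= /GP /fP /Phi /= /GF /F !einnerZr; ring.
Unshelve. all: by end_near. Qed.

(** The divergence identity of [B] holds on each slice of fixed x in [K1], so [A] is applied to a
    function that vanishes on [K1]. *)
Let divB v (b : R) : D2 v -> 0 < b < pi / 2 ->
  cos b * L12 (fun t => einner v (GP (b, t))) =
  cos b * L12 (fun t => einner v t.2 * einner t.2 (GP (b, t)))
  + q.-1%:R * L12 (fun t => einner v t.2 * fP (b, t)).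
Proof.
move=> Dv b01.
have b01' := oo b01.
have cGv := slice (h := fun t => einner v (GP t)) b01' (contK_einner (contK_vcst QK v) cGP).
have cvxG := slice (h := fun t => einner v t.2.2 * einner t.2.2 (GP t)) b01'
  (contKM (contK_einner (contK_vcst QK v) cY) (contK_einner cY cGP)).
have cvxf := slice (h := fun t => einner v t.2.2 * fP t) b01'
  (contKM (contK_einner (contK_vcst QK v) cY) cfP).
rewrite /= in cGv cvxG cvxf.
apply/eqP; rewrite -subr_eq0; apply/eqP.
have cz (c : R) (h : V * V -> R) : contK (K1 `*` K2) h -> contK (K1 `*` K2) (fun t => c * h t).
  by move=> ch; exact: (contKM (contK_cst _ c) ch).
rewrite -!LZ // -(LD (cz _ _ cvxG) (cz _ _ cvxf)).
rewrite -(pfB pf12 (cz _ _ cGv) (contKD (cz _ _ cvxG) (cz _ _ cvxf))).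
have cL := contK_prod_inner (mean_pf hB) (contKB (cz (cos b) _ cGv) (contKD (cz (cos b) _ cvxG) (cz q.-1%:R _ cvxf))).
have := pf_ext (mean_pf hA) cL (contK_cst K1 0); rewrite (pf0 (mean_pf hA)) => ext0.
apply: ext0 => x Kx.
have cjp : continuous (fun y => join_point b x y).
  by move=> y; apply: (@cont_join_point _ (fun=> b) (fun=> x) id); [exact: cst_continuous..|exact: cvg_id].
pose U' := join_point b x @^-1` U.
have oU' : open U' by apply: open_comp => // y _; exact: cjp.
have KU' : K2 `<=` U' by move=> y Ky; apply: KU; exists (b, (x, y)).
have c1g : c1 U' (fun y => f (join_point b x y)) (fun y => cos b *: G (join_point b x y)).
  move=> y /= Uy; have [hg cG] := c1f Uy; split; first exact: hasgrad_affine.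
  apply: (@continuousZ _ _ _ (fun=> cos b) (fun y => G (join_point b x y))); first exact: cst_continuous.
  exact: (@continuous_comp _ _ _ (join_point b x) G y (@cjp y) cG).
have := mean_div hB oU' KU' c1g Dv; rewrite -[X in X = _ -> _]/(B _) => <-.
congr B; apply/funext => y; rewrite /= /GP /fP /Phi /= !einnerZr; ring.
Qed.

Let cpow i j : contK I01 (fun b : R => sin b ^+ i * cos b ^+ j).
Proof. exact: (contK_continuous (@continuous_trig_pow i j)). Qed.

(** The divergence integrand on the join, with its weight, averaged over both spheres at angle b. *)
Let Ifun v (b : R) := L12 (fun t => wt (b, t) * (einner v (GP (b, t)) -
  einner v (Phi (b, t)) * (einner (Phi (b, t)) (GP (b, t)) + (p + q).-1%:R * fP (b, t)))).

Let cPhiK : contK QK Phi. Proof. exact: contK_continuous. Qed.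

Let cI v : contK I01 (Ifun v).
Proof.
have cw : contK QK wt by apply: (ctr (h := fun b => sin b ^+ p.-1 * cos b ^+ q.-1)); exact: continuous_trig_pow.
have c1 := contK_einner (contK_vcst QK v) cGP.
have c2 := contK_einner (contK_vcst QK v) cPhiK.
have c3 := contKD (contK_einner cPhiK cGP) (contKM (contK_cst QK (p + q).-1%:R) cfP).
exact: (contK_prod_inner pf12 (contKM cw (contKB c1 (contKM c2 c3)))).
Qed.

Let cZ (c : R) (h : V * V -> R) : contK (K1 `*` K2) h -> contK (K1 `*` K2) (fun t => c * h t).
Proof. by move=> ch; exact: (contKM (contK_cst _ c) ch). Qed.

Let pq1 : (p + q).-1%:R = p.-1%:R + q.-1%:R + 1 :> R.
Proof. by case: p q p0 q0 => [|a] [|b] // _ _; rewrite addSn addnS /= -natr1 natrD. Qed.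

Let pow_sin (b : R) (i : nat) : i%:R * sin b ^+ i.-1 * sin b = i%:R * sin b ^+ i.
Proof. by case: i => [|i]; rewrite ?mul0r // -mulrA -exprSr. Qed.

Let pow_cos (b : R) (i : nat) : i%:R * cos b ^+ i.-1 * cos b = i%:R * cos b ^+ i.
Proof. by case: i => [|i]; rewrite ?mul0r // -mulrA -exprSr. Qed.

Let cutL (Z : V * V -> V) v : contK QK (fun t => Z t.2) ->
  contK I01 (fun b => L12 (fun t => einner v (Z t) * fP (b, t))).
Proof.
move=> cZ'; exact: (contK_prod_inner pf12 (contKM (contK_einner (contK_vcst QK v) cZ') cfP)).
Qed.

(** For v in the span of the first sphere, the integrand in b is exact: its primitive is sin^(p-1)
    cos^q times the average of <v, x> f. The derivative in b is matched with the divergence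
    integrand through [divA] and [join_algebra1]. *)
Lemma join_div1 v : D1 v -> integ 0 (pi / 2) (Ifun v) = 0.
Proof.
move=> Dv.
pose L b := L12 (fun t => einner v t.1 * fP (b, t)).
pose F (b : R) := (sin b ^+ p.-1 * cos b ^+ q) * L b.
have cF : contK I01 F := contKM (cpow p.-1 q) (cutL v cX).
have E : integ 0 (pi / 2) (Ifun v) = F (pi / 2) - F 0.
  apply: (@integ_FTC2 _ 0 (pi / 2) (Ifun v) F pihalf_gt0 (@cI v)) => b b01.
    by apply: (nbhs_singleton (cF b _)); rewrite /I01 /= in_itv.
  have [s0 c0] := trig_gt0 b01; have b01' := oo b01.
  have dLb := dL v cX b01.
  apply: (D_eq (D_mul (D_trig_pow b p.-1 q) dLb)).
  have cGv := slice (h := fun t => einner v (GP t)) b01' (contK_einner (contK_vcst QK v) cGP).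
  have cXG := slice (h := fun t => einner v t.2.1 * einner t.2.1 (GP t)) b01'
    (contKM (contK_einner (contK_vcst QK v) cX) (contK_einner cX cGP)).
  have cYG := slice (h := fun t => einner v t.2.1 * einner t.2.2 (GP t)) b01'
    (contKM (contK_einner (contK_vcst QK v) cX) (contK_einner cY cGP)).
  have cXf := slice (h := fun t => einner v t.2.1 * fP t) b01'
    (contKM (contK_einner (contK_vcst QK v) cX) cfP).
  rewrite /= in cGv cXG cYG cXf.
  set LX := L12 (fun t => einner v t.1 * einner t.1 (GP (b, t))).
  set LY := L12 (fun t => einner v t.1 * einner t.2 (GP (b, t))).
  have -> : L12 (fun t => einner v t.1 * einner (cos b *: t.1 - sin b *: t.2) (GP (b, t))) =
      cos b * LX - sin b * LY.
    rewrite -(LZ (cos b) cXG) -(LZ (sin b) cYG) -(pfB pf12 (cZ (cos b) cXG) (cZ (sin b) cYG)).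
    by congr L12; apply/funext => t; rewrite einnerBl !einnerZl; ring.
  have -> : Ifun v b = (sin b ^+ p.-1 * cos b ^+ q.-1) * (L12 (fun t => einner v (GP (b, t))) -
      sin b * (sin b * LX + cos b * LY + (p + q).-1%:R * L b)).
    have c0' := contKD (cZ (sin b) cXG) (cZ (cos b) cYG).
    have c1 := contKD c0' (cZ (p + q).-1%:R cXf).
    rewrite -(LZ (sin b) cXG) -(LZ (cos b) cYG) -(LZ _ cXf).
    rewrite -(LD (cZ (sin b) cXG) (cZ (cos b) cYG)) -(LD c0' (cZ _ cXf)).
    rewrite -(LZ (sin b) c1) -(pfB pf12 cGv (cZ (sin b) c1)).
    rewrite -(LZ _ (contKB cGv (cZ (sin b) c1))).
    have cw := contK_cst (K1 `*` K2) (sin b ^+ p.-1 * cos b ^+ q.-1).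
    have c2 := slice b01' (contK_einner (contK_vcst QK v) cPhiK).
    have c3 := slice b01' (contKD (contK_einner cPhiK cGP) (contKM (contK_cst QK (p + q).-1%:R) cfP)).
    apply: (pf_ext pf12 (contKM cw (contKB cGv (contKM c2 c3))) (cZ _ (contKB cGv (cZ (sin b) c1)))).
    move=> [x y] [/= Kx Ky]; rewrite /Phi /= !join_pointE (D1K2 Dv Ky) /fP /GP /Phi /=.
    by rewrite {2}/join_point einnerDl !einnerZl; ring.
  have Eq : cos b ^+ q = cos b * cos b ^+ q.-1 by rewrite -exprS prednK.
  have Eq1 : q%:R = q.-1%:R + 1 :> R by rewrite natr1 prednK.
  rewrite Eq Eq1 pq1; apply: join_algebra1 => //.
  - exact: lt0r_neq0.
  - exact: cos2Dsin2.
  - exact: divA.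
(* Boundary terms: at pi/2 the factor cos^q vanishes. At 0 the factor sin^(p-1) vanishes unless p =
   1; in that case f no longer depends on x, and the average of <v, x> is 0 by [mean_ctr]. *)
rewrite E /F cos_pihalf expr0n (gtn_eqF q0) mulr0 mul0r sub0r; apply/eqP; rewrite oppr_eq0.
rewrite sin0 expr0n; have [p1|_] := eqVneq p.-1 0%N; last by rewrite !mul0r.
have b00 : I01 0 by rewrite /I01 /= in_itv /= lexx ltW // pihalf_gt0.
have cf0 := slice b00 cfP.
suff -> : L 0 = 0 by rewrite mulr0.
have cv : contK K1 (einner v) := contK_einner (contK_vcst K1 v) (contK_id K1).
have c0v := slice (h := fun t => einner v t.2.1 * fP t) b00 (contKM (contK_einner (contK_vcst QK v) cX) cfP).
have E0 : L 0 = A (fun x => B (fun y => f y) * einner v x).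
  apply: (pf_ext (mean_pf hA) (contK_prod_inner (mean_pf hB) c0v) (contKM (contK_cst K1 _) cv)).
  move=> x Kx /=; have E1 : (fun y => fP (0, (x, y))) = f.
    by apply/funext => y; rewrite /fP /Phi /join_point /= sin0 cos0 scale0r scale1r add0r.
  have := contK_prod_slice Kx cf0; rewrite E1 => cfy.
  rewrite [RHS]mulrC -(pfZ (mean_pf hB) _ cfy); congr B; apply/funext => y.
  by have := congr1 (fun g => g y) E1 => /= <-.
by rewrite E0 (pfZ (mean_pf hA) _ cv) (mean_ctr hA Dv) mulr0.
Qed.

(** Mirror image of [join_div1]: the primitive changes sign, and the delicate boundary term is the
    one at pi/2 when q = 1. *)
Lemma join_div2 v : D2 v -> integ 0 (pi / 2) (Ifun v) = 0.
Proof.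
move=> Dv.
pose L b := L12 (fun t => einner v t.2 * fP (b, t)).
pose F (b : R) := - ((sin b ^+ p * cos b ^+ q.-1) * L b).
have cF : contK I01 F := contKN (contKM (cpow p q.-1) (cutL v cY)).
have E : integ 0 (pi / 2) (Ifun v) = F (pi / 2) - F 0.
  apply: (@integ_FTC2 _ 0 (pi / 2) (Ifun v) F pihalf_gt0 (@cI v)) => b b01.
    by apply: (nbhs_singleton (cF b _)); rewrite /I01 /= in_itv.
  have [s0 c0] := trig_gt0 b01; have b01' := oo b01.
  have dLb := dL v cY b01.
  apply: (D_eq (D_opp (D_mul (D_trig_pow b p q.-1) dLb))).
  have cGv := slice (h := fun t => einner v (GP t)) b01' (contK_einner (contK_vcst QK v) cGP).
  have cXG := slice (h := fun t => einner v t.2.2 * einner t.2.1 (GP t)) b01'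
    (contKM (contK_einner (contK_vcst QK v) cY) (contK_einner cX cGP)).
  have cYG := slice (h := fun t => einner v t.2.2 * einner t.2.2 (GP t)) b01'
    (contKM (contK_einner (contK_vcst QK v) cY) (contK_einner cY cGP)).
  have cXf := slice (h := fun t => einner v t.2.2 * fP t) b01'
    (contKM (contK_einner (contK_vcst QK v) cY) cfP).
  rewrite /= in cGv cXG cYG cXf.
  set LX := L12 (fun t => einner v t.2 * einner t.1 (GP (b, t))).
  set LY := L12 (fun t => einner v t.2 * einner t.2 (GP (b, t))).
  have -> : L12 (fun t => einner v t.2 * einner (cos b *: t.1 - sin b *: t.2) (GP (b, t))) =
      cos b * LX - sin b * LY.
    rewrite -(LZ (cos b) cXG) -(LZ (sin b) cYG) -(pfB pf12 (cZ (cos b) cXG) (cZ (sin b) cYG)).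
    by congr L12; apply/funext => t; rewrite einnerBl !einnerZl; ring.
  have -> : Ifun v b = (sin b ^+ p.-1 * cos b ^+ q.-1) * (L12 (fun t => einner v (GP (b, t))) -
      cos b * (sin b * LX + cos b * LY + (p + q).-1%:R * L b)).
    have c0' := contKD (cZ (sin b) cXG) (cZ (cos b) cYG).
    have c1 := contKD c0' (cZ (p + q).-1%:R cXf).
    rewrite -(LZ (sin b) cXG) -(LZ (cos b) cYG) -(LZ _ cXf).
    rewrite -(LD (cZ (sin b) cXG) (cZ (cos b) cYG)) -(LD c0' (cZ _ cXf)).
    rewrite -(LZ (cos b) c1) -(pfB pf12 cGv (cZ (cos b) c1)).
    rewrite -(LZ _ (contKB cGv (cZ (cos b) c1))).
    have cw := contK_cst (K1 `*` K2) (sin b ^+ p.-1 * cos b ^+ q.-1).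
    have c2 := slice b01' (contK_einner (contK_vcst QK v) cPhiK).
    have c3 := slice b01' (contKD (contK_einner cPhiK cGP) (contKM (contK_cst QK (p + q).-1%:R) cfP)).
    apply: (pf_ext pf12 (contKM cw (contKB cGv (contKM c2 c3))) (cZ _ (contKB cGv (cZ (cos b) c1)))).
    move=> [x y] [/= Kx Ky]; rewrite /Phi /= !join_pointE (D2K1 Dv Kx) /fP /GP /Phi /=.
    by rewrite {2}/join_point einnerDl !einnerZl; ring.
  have Eq : sin b ^+ p = sin b * sin b ^+ p.-1 by rewrite -exprS prednK.
  have Eq1 : p%:R = p.-1%:R + 1 :> R by rewrite natr1 prednK.
  rewrite Eq Eq1 pq1; apply: join_algebra2 => //.
  - exact: lt0r_neq0.
  - exact: cos2Dsin2.
  - exact: divB.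
rewrite E /F sin0 expr0n (gtn_eqF p0) !mul0r oppr0 subr0; apply/eqP; rewrite oppr_eq0.
rewrite cos_pihalf expr0n; have [p1|_] := eqVneq q.-1 0%N; last by rewrite mulr0 mul0r.
have b00 : I01 (pi / 2) by rewrite /I01 /= in_itv /= lexx ltW // pihalf_gt0.
have c0v := slice (h := fun t => einner v t.2.2 * fP t) b00 (contKM (contK_einner (contK_vcst QK v) cY) cfP).
suff -> : L (pi / 2) = 0 by rewrite mulr0.
have := pf_ext (mean_pf hA) (contK_prod_inner (mean_pf hB) c0v) (contK_cst K1 0).
rewrite (pf0 (mean_pf hA)) => ext0; apply: ext0 => x Kx /=.
have cv : contK K2 (einner v) := contK_einner (contK_vcst K2 v) (contK_id K2).
rewrite (_ : (fun y => _) = (fun y => f x * einner v y)).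
  by rewrite (pfZ (mean_pf hB) _ cv) (mean_ctr hB Dv) mulr0.
apply/funext => y; rewrite mulrC /fP /Phi /join_point /= sin_pihalf cos_pihalf.
by rewrite scale0r scale1r addr0.
Qed.

End Div.

Let L12_ctr v b : D1 v \/ D2 v -> I01 b -> L12 (fun t => wt (b, t) * einner v (Phi (b, t))) = 0.
Proof.
move=> Dv b01.
have c1 : contK K1 (einner v) := contK_einner (contK_vcst K1 v) (contK_id K1).
have c2 : contK K2 (einner v) := contK_einner (contK_vcst K2 v) (contK_id K2).
set w0 := sin b ^+ p.-1 * cos b ^+ q.-1.
have cjp : continuous (fun t : V * V => join_point b t.1 t.2).
  by move=> z; apply: cont_join_point; [exact: cst_continuous|exact: cvg_fst|exact: cvg_snd].
have cw : contK (K1 `*` K2) (fun t => w0 * einner v (join_point b t.1 t.2)) :=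
  contKM (contK_cst _ w0) (contK_einner (contK_vcst _ v) (contK_continuous cjp)).
have cu : contK (K1 `*` K2) (fun t => w0 * (sin b * einner v t.1 + cos b * einner v t.2)).
  apply: (contKM (contK_cst _ w0)).
  have cf : contK (K1 `*` K2) (fun t : V * V => t.1) by apply: contK_continuous => z; exact: cvg_fst.
  have cs : contK (K1 `*` K2) (fun t : V * V => t.2) by apply: contK_continuous => z; exact: cvg_snd.
  exact: (contKD (contKM (contK_cst _ (sin b)) (contK_einner (contK_vcst _ v) cf))
    (contKM (contK_cst _ (cos b)) (contK_einner (contK_vcst _ v) cs))).
have -> : L12 (fun t => wt (b, t) * einner v (Phi (b, t))) =
    L12 (fun t => w0 * (sin b * einner v t.1 + cos b * einner v t.2)).
  by congr L12; apply/funext => t; rewrite /Phi join_pointE.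
have := pf_ext (mean_pf hA) (contK_prod_inner (mean_pf hB) cu).
case: Dv => Dv.
  move=> /(_ (fun x => w0 * sin b * B (fun=> 1) * einner v x)).
  move=> /(_ (contKM (contK_cst K1 _) c1)) E.
  apply: etrans (E _) _; last by rewrite (pfZ (mean_pf hA) _ c1) (mean_ctr hA Dv) mulr0.
  move=> x Kx /=.
  rewrite mulrAC -(pfZ (mean_pf hB) _ (contK_cst K2 1)).
  apply: (pf_ext (mean_pf hB) (contK_prod_slice Kx cu) (contKM (contK_cst K2 _) (contK_cst K2 1))) => y Ky.
  by rewrite /= (D1K2 Dv Ky); ring.
move=> /(_ (fun=> 0) (contK_cst K1 0)) E.
apply: etrans (E _) (pf0 (mean_pf hA)) => x Kx /=.
rewrite -[RHS](mulr0 (w0 * cos b)) -(mean_ctr hB Dv) -(pfZ (mean_pf hB) _ c2).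
apply: (pf_ext (mean_pf hB) (contK_prod_slice Kx cu) (contKM (contK_cst K2 _) c2)) => y Ky.
by rewrite /= (D2K1 Dv Kx); ring.
Qed.

Lemma join_mean : mean K (D1 `|` D2) (p + q) (join p q A B).
Proof.
have pj := join_posfun.
have c1 (h : V -> R) : contK K h -> contK QK (fun t => wt t * h (Phi t)).
  move=> ch; apply: contKM; last exact: (contK_push (contK_continuous cPhi) ch).
  apply: contK_continuous => t.
  by apply: (@continuous_comp _ _ _ (@fst R (V * V)) (fun b => sin b ^+ p.-1 * cos b ^+ q.-1));
    [exact: cvg_fst|exact: continuous_trig_pow].
split=> //.
- move=> _ [[b [x y]] [/= Ib [Kx Ky]] <-]; rewrite /Phi /= /join_point !einnerE.
  rewrite (mean_sphere hA Kx) (mean_sphere hB Ky) (K12 Kx Ky) (einnerC y) (K12 Kx Ky).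
  by rewrite !mulr0 !mulr1 addr0 add0r -!expr2 addrC cos2Dsin2.
- move=> U f G v oU KU c1f [Dv|Dv]; first exact: (join_div1 oU KU c1f Dv).
  exact: (join_div2 oU KU c1f Dv).
- move=> v Dv.
  have cv : contK K (einner v) := contK_einner (contK_vcst K v) (contK_id K).
  have := pf_ext (integ_posfun 0 (pi / 2)) (contK_prod_inner pf12 (c1 _ cv)) (contK_cst I01 0).
  by rewrite (pf0 (integ_posfun 0 (pi / 2))) => ext0; apply: ext0 => b Ib; exact: L12_ctr.
- have -> : join p q A B (fun=> 1) =
      integ 0 (pi / 2) (fun b => sin b ^+ p.-1 * cos b ^+ q.-1 * (A (fun=> 1) * B (fun=> 1))).
    congr integ; apply/funext => b.
    set w0 := sin b ^+ p.-1 * cos b ^+ q.-1.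
    transitivity (A (fun=> (w0 * B (fun=> 1)) * 1)).
      congr A; apply/funext => x; rewrite [RHS]mulr1.
      exact: (pfZ (mean_pf hB) _ (contK_cst K2 1)).
    by rewrite (pfZ (mean_pf hA) _ (contK_cst K1 1)); ring.
  apply: (integ_gt0 pihalf_gt0) => [|b b01].
    move=> b; apply: (@continuousM _ _ (fun b => sin b ^+ p.-1 * cos b ^+ q.-1) (fun=> A (fun=> 1) * B (fun=> 1))).
      exact: continuous_trig_pow.
    exact: cst_continuous.
  have [s0 c0] := trig_gt0 b01.
  by rewrite !mulr_gt0 ?exprn_gt0 ?(mean_gt0 hA) ?(mean_gt0 hB).
Qed.

End Join.
End Means.

Arguments contK_vcst {R n T} K v t _ : rename.
Arguments contK_id {R n} K t _ : rename.

(** * Averages on the unit sphere of the span of an orthonormal family *)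

Section Frames.
Context {R : realType} {n : nat}.
Local Notation V := 'rV[R]_n.
Implicit Types (K D U : set V) (f : V -> R) (G : V -> V) (v w : V).

(** Induction on the family: each new vector is added by joining its zero-dimensional sphere to the
    sphere already built. The last clause supplies the orthogonality that the next join requires. *)
Lemma frame_mean (s : seq V) : s != [::] -> uniq s ->
  (forall v w, v \in s -> w \in s -> einner v w = (v == w)%:R) ->
  exists K D M, [/\ mean K D (size s) M, forall v, v \in s -> D v, forall v, D v -> v \in s &
    forall u, (forall v, v \in s -> einner u v = 0) -> forall x, K x -> einner u x = 0].
Proof.
elim: s => [//|w [|w' s] ih] _.
  move=> _ h.
  have w1 : einner w w = 1 by rewrite h ?mem_head // eqxx.
  exists [set x | x = w \/ x = - w], [set w], (two_point w); split.
  - exact: two_point_mean.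
  - by move=> v; rewrite inE => /eqP.
  - by move=> v /= ->; rewrite mem_head.
  - by move=> u hu x [->|->]; rewrite ?einnerNr hu ?mem_head // oppr0.
move=> /= /andP[ws us] h.
have [|K [D [M [hM sD Ds sK]]]] := ih isT us.
  by move=> v v' hv hv'; apply: h; rewrite inE ?hv ?hv' orbT.
have w1 : einner w w = 1 by rewrite h ?mem_head // eqxx.
have wD v : D v -> einner v w = 0.
  move=> /Ds vs; rewrite h ?mem_head //; last by rewrite inE vs orbT.
  by case: eqP => // vw; rewrite -vw vs in ws.
have wK x : K x -> einner w x = 0.
  apply: sK => v vs; rewrite h ?mem_head //; last by rewrite inE vs orbT.
  by case: eqP => // vw; rewrite vw vs in ws.
have := @join_mean R n _ K _ D 1 (size (w' :: s)) _ M isT isT (two_point_mean w1) hM.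
set K' := [set _ | _ in _] => hj.
exists K', ([set w] `|` D), (join 1 (size (w' :: s)) (two_point w) M); split.
- apply: hj.
  + by move=> x y [->|->] Ky; rewrite ?einnerNl wK // oppr0.
  + by move=> v y -> /wK.
  + by move=> v x Dv [->|->]; rewrite ?einnerNr wD // oppr0.
- move=> v; rewrite inE => /predU1P[->|vs]; first by left.
  by right; exact: sD.
- by move=> v [->|/Ds vs]; rewrite inE ?eqxx // vs orbT.
- move=> u hu _ [[b [x y]] [/= _ [hx Ky]] <-].
  rewrite join_pointE (sK u _ y Ky); last by move=> v vs; apply: hu; rewrite inE vs orbT.
  by case: hx => ->; rewrite ?einnerNr hu ?mem_head // ?oppr0 !mulr0 addr0.
Qed.

(** Both identities of [mean] are linear in v, so a spanning frame contained in [D] suffices for all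
    v. *)
Lemma mean_span K D N M (I : finType) (w : I -> V) : mean K D N M -> (forall i, D (w i)) ->
  (forall v, v = \sum_i einner v (w i) *: w i) -> mean K setT N M.
Proof.
move=> hM Dw hw; have pM := mean_pf hM.
have lin v (g : V -> V -> R) : (forall i, contK K (g (w i))) ->
    (forall x, g v x = \sum_i einner v (w i) * g (w i) x) -> (forall i, M (g (w i)) = 0) -> M (g v) = 0.
  move=> cg gE g0; have cz i : contK K (fun x => einner v (w i) * g (w i) x).
    exact: (contKM (contK_cst K _) (cg i)).
  rewrite (_ : g v = fun x => \sum_i einner v (w i) * g (w i) x); last exact/funext.
  by rewrite (pf_sum pM) // big1 // => i _; rewrite (pfZ pM _ (cg i)) g0 mulr0.
have einE v u : einner v u = \sum_i einner v (w i) * einner (w i) u.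
  rewrite [v in LHS]hw [LHS](linear_sum (einnerl u)); apply: eq_bigr => i _.
  by rewrite [LHS]einnerZl.
split; [exact: pM|exact: mean_sphere hM| | |exact: mean_gt0 hM].
- move=> U f G v oU KU c1f _.
  have cG := c1_contKG oU KU c1f; have cf := c1_contK oU KU c1f.
  apply: (lin v (fun v x => einner v (G x) - einner v x * (einner x (G x) + N.-1%:R * f x))) => [i|x|i].
  + have cw := contK_vcst K (w i); have cx := contK_id K.
    exact: (contKB (contK_einner cw cG) (contKM (contK_einner cw cx)
      (contKD (contK_einner cx cG) (contKM (contK_cst K N.-1%:R) cf)))).
  + rewrite (einE v (G x)) (einE v x) mulr_suml -sumrB; apply: eq_bigr => i _; ring.
  + exact: (mean_div hM oU KU c1f).
- move=> v _; have ci i : contK K (einner (w i)) := contK_einner (contK_vcst K (w i)) (contK_id K).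
  exact: (lin v (@einner R n) ci (einE v) (fun i => mean_ctr hM (Dw i))).
Qed.

End Frames.

(** * The circle in a parametrisation of elliptic type *)

Section Circle.
Context {R : realType} {n : nat}.
Local Notation V := 'rV[R]_n.
Variables (w0 w1 : V) (mu a0 : R).
Hypotheses (w00 : einner w0 w0 = 1) (w11 : einner w1 w1 = 1) (w01 : einner w0 w1 = 0).
Hypothesis mu0 : 0 < mu.

(** The point [circ t] has polar angle phi with tan phi = mu tan t, hence dphi = (mu / Del^2) dt.
    With mu matched to the kernel, mu cos al z1 + sin al z2 at this point is a multiple of cos (t -
    al). *)
Definition Del (t : R) := Num.sqrt (cos t ^+ 2 + mu ^+ 2 * sin t ^+ 2).
Definition ellc t := cos t / Del t.
Definition ells t := mu * sin t / Del t.
Definition circ t : V := ellc t *: w0 + ells t *: w1.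
(** Arc length divided by mu, over a half-turn together with its antipodes. The starting point [a0]
    is free, so that the half-turn can later be centred for the reflection. *)
Definition circ_mean (f : V -> R) :=
  integ a0 (a0 + pi) (fun t => (Del t) ^- 2 * (f (circ t) + f (- circ t))).

Lemma Del2_gt0 t : 0 < cos t ^+ 2 + mu ^+ 2 * sin t ^+ 2.
Proof.
have [c0|c0] := eqVneq (cos t) 0.
  have := cos2Dsin2 t; rewrite c0 expr0n /= !add0r => ->.
  by rewrite mulr1 exprn_gt0.
by rewrite ltr_pwDl // ?exprn_even_gt0 // mulr_ge0 ?sqr_ge0.
Qed.

Lemma Del_gt0 t : 0 < Del t. Proof. by rewrite sqrtr_gt0 Del2_gt0. Qed.
Lemma DelE t : Del t ^+ 2 = cos t ^+ 2 + mu ^+ 2 * sin t ^+ 2.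
Proof. by rewrite sqr_sqrtr // ltW // Del2_gt0. Qed.

Lemma ell_sqr t : ellc t ^+ 2 + ells t ^+ 2 = 1.
Proof.
rewrite /ellc /ells !exprMn -mulrDl exprVn -DelE divff // sqrf_eq0 gt_eqF ?Del_gt0 //.
Qed.

Lemma D_Del (t : R) : is_derive t (1 : R) Del ((mu ^+ 2 - 1) * (sin t * cos t) / Del t).
Proof.
have h := (D_sqrt (f := fun t => cos t ^+ 2 + mu ^+ 2 * sin t ^+ 2) (Del2_gt0 t) (D_add (D_pow 2 (D_cos (D_id t)))
  (D_mul (D_cst (mu ^+ 2) t) (D_pow 2 (D_sin (D_id t)))))).
apply: (D_eq h).
rewrite -/(Del t) /=; field; exact: (lt0r_neq0 (Del_gt0 t)).
Qed.

Lemma D_ellc (t : R) : is_derive t (1 : R) ellc (- (mu / Del t ^+ 2 * ells t)).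
Proof.
have d0 := lt0r_neq0 (Del_gt0 t).
have h := (D_mul (D_cos (D_id t)) (D_inv (f := Del) d0 (D_Del t))).
apply: (D_eq h).
rewrite /ells; apply/eqP; rewrite -subr_eq0; apply/eqP.
transitivity (sin t / Del t ^+ 3 * (cos t ^+ 2 + mu ^+ 2 * sin t ^+ 2 - Del t ^+ 2
  + mu ^+ 2 * (1 - (cos t ^+ 2 + sin t ^+ 2)))); first by field.
by rewrite DelE cos2Dsin2 !subrr mulr0 addr0 mulr0.
Qed.

Lemma D_ells (t : R) : is_derive t (1 : R) ells (mu / Del t ^+ 2 * ellc t).
Proof.
have d0 := lt0r_neq0 (Del_gt0 t).
have h := (D_mul (D_mul (D_cst mu t) (D_sin (D_id t))) (D_inv (f := Del) d0 (D_Del t))).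
apply: (D_eq h).
rewrite /ellc; apply/eqP; rewrite -subr_eq0; apply/eqP.
transitivity (mu * cos t / Del t ^+ 3 * ((Del t ^+ 2 - (cos t ^+ 2 + mu ^+ 2 * sin t ^+ 2))
  + (cos t ^+ 2 + sin t ^+ 2 - 1))); first by field.
by rewrite DelE cos2Dsin2 !subrr addr0 mulr0.
Qed.

Lemma DelDpi t : Del (t + pi) = Del t.
Proof. by rewrite /Del cosDpi sinDpi !sqrrN. Qed.
Lemma ellcDpi t : ellc (t + pi) = - ellc t.
Proof. by rewrite /ellc DelDpi cosDpi mulNr. Qed.
Lemma ellsDpi t : ells (t + pi) = - ells t.
Proof. by rewrite /ells DelDpi sinDpi mulrN mulNr. Qed.

Lemma is_derive_circ (t : R) :
  is_derive t (1 : R) circ ((mu / Del t ^+ 2) *: (ellc t *: w1 - ells t *: w0)).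
Proof.
apply: is_derive_eq (is_deriveD (is_derive_scalel w0 (D_ellc t)) (is_derive_scalel w1 (D_ells t))) _.
by rewrite scalerBr !scalerA scaleNr addrC.
Qed.

Lemma circ_sphere t : einner (circ t) (circ t) = 1.
Proof.
rewrite /circ !einnerE w00 w11 w01 (einnerC w1) w01.
by rewrite -[RHS](ell_sqr t); ring.
Qed.

Lemma continuous_Del : continuous Del.
Proof. by move=> t; exact: is_derive_cont (D_Del t). Qed.

Lemma continuous_circ : continuous circ.
Proof.
move=> t; have [dc _] := is_derive_circ t.
by apply: differentiable_continuous; exact/derivable1_diffP.
Qed.

Lemma continuous_Delm2 : continuous (fun t => Del t ^- 2).
Proof.
move=> t; have d0 := lt0r_neq0 (Del_gt0 t).
have d2 : Del t ^+ 2 != 0 by rewrite sqrf_eq0.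
exact: is_derive_cont (D_inv (f := fun t => Del t ^+ 2) d2 (D_pow 2 (D_Del t))).
Qed.

Let I0 : set R := `[a0, a0 + pi]%classic.
Let S1 : set R := [set 1] `|` [set -1].
Let Q1 : set (R * R) := I0 `*` S1.
Let Kc : set V := (fun t : R * R => t.2 *: circ t.1) @` Q1.

(** The divergence integrand is the derivative of [F], whose values at both ends agree: after a
    half-turn the tangential component of v and the difference f (circ t) - f (- circ t) both change
    sign. *)
Lemma circ_mean_mean : mean Kc [set v | exists x y, v = x *: w0 + y *: w1] 2 circ_mean.
Proof.
have a0pi : a0 < a0 + pi by rewrite ltrDl pi_gt0.
have cP : continuous (fun t : R * R => t.2 *: circ t.1).
  move=> t; apply: continuousZ; first exact: cvg_snd.
  by apply: (@continuous_comp _ _ _ (@fst R R) circ); [exact: cvg_fst|exact: continuous_circ].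
have ppt := pf_add (@pf_pt R R 1) (@pf_pt R R (-1)).
have pc : posfun Kc circ_mean.
  have cw : contK Q1 (fun t : R * R => (Del t.1) ^- 2 : R).
    apply: contK_continuous => t.
    by apply: (@continuous_comp _ _ _ (@fst R R) (fun t => Del t ^- 2)); [exact: cvg_fst|exact: continuous_Delm2].
  have wge t : Q1 t -> 0 <= (Del t.1) ^- 2.
    by move=> _; rewrite invr_ge0 exprn_ge0 // ltW // Del_gt0.
  have := pf_push (pf_weight (pf_prod (integ_posfun a0 (a0 + pi)) ppt) cw wge) (contK_continuous cP).
  congr posfun; apply/funext => f; congr integ; apply/funext => t /=.
  by rewrite scale1r scaleN1r mulrDr.
have KcE t : I0 t -> Kc (circ t) /\ Kc (- circ t).
  move=> It; split; [exists (t, 1)|exists (t, -1)] => //=.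
  - by split=> //; left.
  - by rewrite scale1r.
  - by split=> //; right.
  - by rewrite scaleN1r.
split=> //.
- move=> _ [[t e] [/= _ he] <-]; rewrite /= einnerZl einnerZr circ_sphere mulr1.
  by case: he => ->; rewrite ?mulr1 // mulrNN mulr1.
- move=> U f G _ oU KU c1f [x [y ->]].
  set v := x *: w0 + y *: w1.
  (* The component of v along the unit tangent at [circ t]. *)
  pose vp t := y * ellc t - x * ells t.
  pose F t := mu^-1 * (vp t * (f (circ t) - f (- circ t))).
  pose h z := einner v (G z) - einner v z * (einner z (G z) + 2.-1%:R * f z).
  have ch : contK Kc h.
    have cG := c1_contKG oU KU c1f; have cf := c1_contK oU KU c1f.
    have cv := contK_vcst Kc v; have cx := contK_id Kc.
    exact: (contKB (contK_einner cv cG) (contKM (contK_einner cv cx)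
      (contKD (contK_einner cx cG) (contKM (contK_cst Kc 2.-1%:R) cf)))).
  have dF t : I0 t -> is_derive t 1 F (Del t ^- 2 * (h (circ t) + h (- circ t))).
    move=> /KcE[Kp Km].
    have [hp _] := c1f _ (KU _ Kp); have [hm _] := c1f _ (KU _ Km).
    have dp := hasgrad_curve hp (is_derive_circ t).
    have dm := hasgrad_curve hm (is_deriveN (is_derive_circ t)).
    have dv := D_sub (D_mul (D_cst y t) (D_ellc t)) (D_mul (D_cst x t) (D_ells t)).
    have hF := (D_mul (D_cst mu^-1 t) (D_mul dv (D_sub dp dm))).
    apply: (D_eq hF).
    rewrite /h /v; move: (G (circ t)) (G (- circ t)) (f (circ t)) (f (- circ t)) => gp gm fp fm.
    rewrite /circ !einnerE w00 w11 w01 (einnerC w1 w0) w01 /=.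
    have := ell_sqr t; have := lt0r_neq0 (Del_gt0 t).
    set c := ellc t; set s := ells t; set d := Del t => d0 cs1.
    move: (einner w0 gp) (einner w1 gp) (einner w0 gm) (einner w1 gm) => g0 g1 k0 k1.
    apply/eqP; rewrite -subr_eq0; apply/eqP.
    transitivity (d ^- 2 * (x * (g0 + k0) + y * (g1 + k1)) * (c ^+ 2 + s ^+ 2 - 1)).
      by field; rewrite d0 lt0r_neq0.
    by rewrite cs1 subrr mulr0.
  have cm : continuous (fun t => - circ t) by move=> t; apply: continuousN; exact: continuous_circ.
  have cpush (g : R -> V) : continuous g -> (forall t, I0 t -> Kc (g t)) -> contK I0 (fun t => h (g t)).
    move=> cg KI; apply: (contK_push (contK_continuous cg)).
    by apply: contKS ch => _ [t It <-]; exact: KI.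
  have E : integ a0 (a0 + pi) (fun t => Del t ^- 2 * (h (circ t) + h (- circ t))) = F (a0 + pi) - F a0.
    have ci : contK I0 (fun t => Del t ^- 2 * (h (circ t) + h (- circ t))) :=
      contKM (contK_continuous continuous_Delm2) (contKD
        (cpush _ continuous_circ (fun t It => (KcE t It).1)) (cpush _ cm (fun t It => (KcE t It).2))).
    apply: (@integ_FTC2 _ a0 (a0 + pi) _ F a0pi ci).
      by move=> t It; exact: is_derive_cont (dF t It).
    by move=> t It; apply: dF; rewrite /I0 /=; move: It; rewrite !in_itv /= => /andP[/ltW-> /ltW->].
  rewrite /circ_mean E /F /vp.
  have cD : circ (a0 + pi) = - circ a0 by rewrite /circ ellcDpi ellsDpi !scaleNr opprD.
  by rewrite cD opprK ellcDpi ellsDpi; ring.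
- move=> v _; rewrite /circ_mean -[RHS](pf0 (integ_posfun a0 (a0 + pi))); congr integ.
  by apply/funext => t; rewrite einnerNr subrr mulr0.
- apply: integ_gt0 => // [|t _].
    move=> t; apply: (@continuousM _ _ (fun t => Del t ^- 2) (fun=> 1 + 1)); first exact: continuous_Delm2.
    exact: cst_continuous.
  by rewrite mulr_gt0 // invr_gt0 exprn_gt0 // Del_gt0.
Qed.

End Circle.

(** * Products and compositions of C1 functions *)

Section Chain.
Context {R : realType} {n : nat}.
Local Notation V := 'rV[R]_n.
Implicit Types (U : set V) (f : V -> R) (G : V -> V) (x v w g : V).

Lemma is_diff_scale_fun (a : V -> R) x g w : hasgrad a x g ->
  is_diff x (fun y => a y *: w) (fun k => einner k g *: w).
Proof.
move=> [da Ea]; split; first exact: differentiableZl.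
have /(congr1 (fun h : V -> V => h)) := diffZl w da.
by move=> ->; apply/funext => k; rewrite Ea.
Qed.

Lemma is_diff_big (I : Type) (r : seq I) (F : I -> V -> V) (dF : I -> V -> V) x :
  (forall i, is_diff x (F i) (dF i)) ->
  is_diff x (fun y => \sum_(i <- r) F i y) (fun k => \sum_(i <- r) dF i k).
Proof.
move=> h; elim: r => [|i r ih].
  have E (H : I -> V -> V) : (fun y => \sum_(j <- [::]) H j y) = cst 0.
    by apply/funext => y; rewrite big_nil.
  by rewrite !E; exact: is_diff_cst.
have E (H : I -> V -> V) : (fun y => \sum_(j <- i :: r) H j y) = H i + (fun y => \sum_(j <- r) H j y).
  by apply/funext => y; rewrite big_cons.
rewrite !E; exact: is_diffD.
Qed.

Lemma hasgrad_chain f (T : V -> V) (g : 'I_n -> V) x (G : V) : (forall i, hasgrad (fun y => T y 0 i) x (g i)) ->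
  hasgrad f (T x) G -> hasgrad (fun y => f (T y)) x (\sum_i G 0 i *: g i).
Proof.
move=> hT hf.
have dT : is_diff x T (fun k => \sum_i einner k (g i) *: ebasis R i).
  have := is_diff_big (index_enum 'I_n) (fun i => is_diff_scale_fun (ebasis R i) (hT i)).
  by under eq_fun do rewrite -einner_sum_basis.
apply: (@is_diff_eq _ _ _ _ _ _ _ (is_diff_comp dT hf)).
apply/funext => k; rewrite /= linear_sum /einnerl.
rewrite einnerC [RHS](linear_sum (einnerl k)); apply: eq_bigr => i _.
by rewrite /= /einnerl !einnerZl einner_ebasis mulrC (einnerC k).
Qed.

Lemma c1_mul U f G h H : c1 U f G -> c1 U h H ->
  c1 U (fun x => f x * h x) (fun x => f x *: H x + h x *: G x).
Proof.
move=> cf ch x Ux; have [hf cG] := cf x Ux; have [hh cH] := ch x Ux; split; first exact: hasgradM.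
have c1' := @continuousZ _ _ _ f H x (hasgrad_cont hf) cH.
have c2 := @continuousZ _ _ _ h G x (hasgrad_cont hh) cG.
exact: continuousD c1' c2.
Qed.

Lemma c1_lin U v : c1 U (einner v) (fun=> v).
Proof. by move=> x _; split; [exact: hasgrad_linl|exact: cst_continuous]. Qed.

Lemma c1_cst U (k : R) : c1 U (fun=> k) (fun=> 0).
Proof. by move=> x _; split; [exact: hasgrad_cst|exact: cst_continuous]. Qed.

Lemma c1_comp1 U f G (phi dphi : R -> R) : c1 U f G ->
  (forall x, U x -> is_derive (f x) 1 phi (dphi (f x)) /\ {for f x, continuous dphi}) ->
  c1 U (fun x => phi (f x)) (fun x => dphi (f x) *: G x).
Proof.
move=> cf hphi x Ux; have [hf cG] := cf x Ux; have [hp cp] := hphi x Ux.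
split; first exact: hasgrad_comp1.
have c1' : {for x, continuous (fun x => dphi (f x))}.
  by apply: (@continuous_comp _ _ _ f dphi) => //; exact: hasgrad_cont hf.
exact: (@continuousZ _ _ _ (fun x => dphi (f x)) G x c1' cG).
Qed.

Lemma c1S U U' f G : U' `<=` U -> c1 U f G -> c1 U' f G.
Proof. by move=> UU cf x /UU; exact: cf. Qed.

End Chain.

(** * Transport of an average by a conformal automorphism of the sphere *)

Section Mobius.
Context {R : realType} {n : nat}.
Local Notation V := 'rV[R]_n.
Variables (K D : set V) (N : nat) (M : (V -> R) -> R) (w0 : V) (c w : R).
Hypotheses (hM : mean K D N M) (N1 : (1 < N)%N) (w00 : einner w0 w0 = 1) (Dw0 : D w0).
Hypotheses (w_gt0 : 0 < w) (cw : w ^+ 2 + c ^+ 2 = 1).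

Definition mob_den (x : V) := 1 + c * einner w0 x.
(** On the sphere this is the conformal automorphism fixing w0 and -w0: the component a along w0
    becomes (a + c) / (1 + c a), and the part orthogonal to w0 is multiplied by w / (1 + c a). *)
Definition mob_pt (x : V) : V :=
  ((einner w0 x + c - w * einner w0 x) / mob_den x) *: w0 + (w / mob_den x) *: x.
(** The conformal factor is w / (1 + c a), so the weight is the Jacobian up to the constant w^(N-1),
    and the result is again proportional to surface measure. *)
Definition mob (f : V -> R) := M (fun x => (mob_den x)^-1 ^+ N.-1 * f (mob_pt x)).

Let w_neq0 := lt0r_neq0 w_gt0.

Lemma mob_c_lt1 : `|c| < 1.
Proof.
rewrite -(@ltr_pXn2r _ 2) ?nnegrE ?normr_ge0 ?ler01 // real_normK ?num_real // expr1n -cw.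
by rewrite ltrDr exprn_gt0.
Qed.

Let U0 : set V := [set x | 0 < mob_den x].

Lemma c1_mob_den (U : set V) : c1 U mob_den (fun=> c *: w0).
Proof.
move=> x Ux; have [h _] := @c1_lin R n U w0 x Ux; split; last exact: cst_continuous.
by apply: hasgrad_eq (hasgradD (hasgrad_cst 1 x) (hasgradM (hasgrad_cst c x) h)) _; rewrite scaler0 addr0 add0r.
Qed.

Lemma mob_K : K `<=` U0.
Proof.
move=> x Kx; rewrite /U0 /mob_den /=.
have e1 (v : V) : einner v v = 1 -> enorm v = 1 by rewrite enormE => ->; rewrite sqrtr1.
have : `|c * einner w0 x| < 1.
  rewrite normrM; apply: le_lt_trans mob_c_lt1; rewrite ler_piMr //.
  by have := cauchy_schwarz w0 x; rewrite (e1 _ w00) (e1 _ (mean_sphere hM Kx)) mulr1.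
by rewrite ltr_norml => /andP[h _]; rewrite -ltrBlDl sub0r.
Qed.

Lemma mob_U0_open : open U0.
Proof.
apply: (@open_comp _ _ mob_den [set t | 0 < t]); last exact: open_gt.
move=> x _; have [h _] := @c1_mob_den setT x I; exact: hasgrad_cont h.
Qed.


Lemma c1_mob_inv (m : nat) : c1 U0 (fun x => (mob_den x)^-1 ^+ m)
  (fun x => (- (m%:R * c * (mob_den x)^-1 ^+ m.+1)) *: w0).
Proof.
have h : forall x, U0 x -> is_derive (mob_den x) 1 (fun t : R => (t ^-1) ^+ m) (- (m%:R * (mob_den x)^-1 ^+ m.+1))
   /\ {for mob_den x, continuous (fun t : R => - (m%:R * (t ^-1) ^+ m.+1))}.
  move=> x Ux; have d0 := lt0r_neq0 Ux; have hd := D_inv (f := fun t : R => t) d0 (D_id _).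
  split.
    have h := D_pow m hd; apply: (D_eq h).
    by case: (m) => [|k]; rewrite ?mul0r ?oppr0 // -exprVn /= !(exprS _ k.+1) !(exprS _ k); move: (_ ^-1) => i; ring.
  have hc := is_derive_cont (D_opp (D_mul (D_cst m%:R (mob_den x)) (D_pow m.+1 hd))); exact: hc.
move=> x Ux; have [h1 h2] := c1_comp1 (@c1_mob_den U0) h Ux; split.
  by apply: hasgrad_eq h1 _; rewrite scalerA; congr (_ *: _); ring.
have E : (fun x => - (m%:R * c * (mob_den x)^-1 ^+ m.+1) *: w0) =
    (fun x => - (m%:R * (mob_den x)^-1 ^+ m.+1) *: (c *: w0)).
  by apply/funext => y; rewrite scalerA; congr (_ *: _); ring.
by rewrite E.
Qed.

Lemma hasgrad_mob_A x : U0 x -> hasgrad (fun y => (einner w0 y + c - w * einner w0 y) / mob_den y) x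
  (((w ^+ 2 - w) * (mob_den x)^-1 ^+ 2) *: w0).
Proof.
move=> Ux; have d0 : mob_den x != 0 := lt0r_neq0 Ux.
pose a := einner w0 x.
have h := D_mul (D_sub (D_add (D_id a) (D_cst c a)) (D_mul (D_cst w a) (D_id a)))
  (D_inv (f := fun t => 1 + c * t) d0 (D_add (D_cst 1 a) (D_mul (D_cst c a) (D_id a)))).
apply: hasgrad_eq (hasgrad_comp1 h (hasgrad_linl w0 x)) _; congr (_ *: _).
move: d0; rewrite /mob_den -/a => d0.
apply/eqP; rewrite -subr_eq0; apply/eqP.
transitivity ((1 - (w ^+ 2 + c ^+ 2)) / (1 + c * a) ^+ 2); first by field.
by rewrite cw subrr mul0r.
Qed.

Lemma hasgrad_mob_B x : U0 x -> hasgrad (fun y => w / mob_den y) x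
  ((- (w * c) * (mob_den x)^-1 ^+ 2) *: w0).
Proof.
move=> Ux; have d0 : mob_den x != 0 := lt0r_neq0 Ux.
pose a := einner w0 x.
have h := D_mul (D_cst w a)
  (D_inv (f := fun t => 1 + c * t) d0 (D_add (D_cst 1 a) (D_mul (D_cst c a) (D_id a)))).
apply: hasgrad_eq (hasgrad_comp1 h (hasgrad_linl w0 x)) _; congr (_ *: _).
by move: d0; rewrite /mob_den -/a => d0; field.
Qed.

Lemma mob_pt_cont x : U0 x -> {for x, continuous mob_pt}.
Proof.
move=> Ux.
have h1 := @continuousZ _ _ _ _ (fun=> w0) x (hasgrad_cont (hasgrad_mob_A Ux)) (@cst_continuous _ _ w0 x).
have h2 := @continuousZ _ _ _ _ (fun y : V => y) x (hasgrad_cont (hasgrad_mob_B Ux)) (@cvg_id _ (nbhs x)).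
exact: continuousD h1 h2.
Qed.

Definition mob_grad (G : V -> V) (x : V) : V :=
  (((w ^+ 2 - w) * (mob_den x)^-1 ^+ 2) * einner w0 (G (mob_pt x)) +
   (- (w * c) * (mob_den x)^-1 ^+ 2) * einner x (G (mob_pt x))) *: w0 + (w / mob_den x) *: G (mob_pt x).

Lemma c1_mob (U : set V) (f : V -> R) (G : V -> V) : c1 U f G ->
  c1 (U0 `&` mob_pt @^-1` U) (fun x => f (mob_pt x)) (mob_grad G).
Proof.
move=> cf x [Ux UTx]; have [hf cG] := cf _ UTx.
have cT := mob_pt_cont Ux.
have cGT : {for x, continuous (fun x => G (mob_pt x))} by apply: (@continuous_comp _ _ _ mob_pt G).
have hA := hasgrad_mob_A Ux; have hB := hasgrad_mob_B Ux.
split; last first.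
  have cdi : {for x, continuous (fun x => (mob_den x)^-1 ^+ 2)} := hasgrad_cont (c1_mob_inv 2 Ux).1.
  have ck (k : R) := @continuousM _ _ (fun=> k) _ x (@cst_continuous _ _ k x) cdi.
  have k1 := continuousM (ck (w ^+ 2 - w)) (cont_einner (@cst_continuous _ _ w0 x) cGT).
  have k2 := continuousM (ck (- (w * c))) (cont_einner (@cvg_id _ (nbhs x)) cGT).
  have h1 := @continuousZ _ _ _ _ (fun=> w0) x (continuousD k1 k2) (@cst_continuous _ _ w0 x).
  have h2 := @continuousZ _ _ _ _ _ x (hasgrad_cont hB) cGT.
  exact: continuousD h1 h2.
pose g i := w0 0 i *: (((w ^+ 2 - w) * (mob_den x)^-1 ^+ 2) *: w0) +
  ((w / mob_den x) *: ebasis R i + x 0 i *: ((- (w * c) * (mob_den x)^-1 ^+ 2) *: w0)).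
have hT i : hasgrad (fun y => mob_pt y 0 i) x (g i).
  have h1 := hasgradM hA (hasgrad_cst (w0 0 i) x).
  have h2 := hasgradM hB (hasgrad_linl (ebasis R i) x).
  have h := hasgradD h1 h2.
  have E : (fun y => mob_pt y 0 i) = (fun y => (einner w0 y + c - w * einner w0 y) / mob_den y * w0 0 i +
      w / mob_den y * einner (ebasis R i) y).
    by apply/funext => y; rewrite /mob_pt !mxE einner_ebasis.
  rewrite E; apply: hasgrad_eq h _.
  by rewrite scaler0 add0r einner_ebasis.
apply: hasgrad_eq (hasgrad_chain hT hf) _.
rewrite /mob_grad; move: (G (mob_pt x)) => Gx; rewrite /g.
under eq_bigr do rewrite !scalerDr !scalerA.
rewrite !big_split /= -!scaler_suml.
have E (v : V) k : \sum_i Gx 0 i * v 0 i * k = k * einner v Gx.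
  by rewrite -mulr_suml mulrC; congr (_ * _); apply: eq_bigr => i _; rewrite mulrC.
have -> : \sum_i (Gx 0 i * (w / mob_den x)) *: ebasis R i = (w / mob_den x) *: Gx.
  rewrite [in RHS](einner_sum_basis Gx) scaler_sumr; apply: eq_bigr => i _.
  by rewrite scalerA mulrC.
rewrite (addrC (_ *: Gx)) addrA -scalerDl; congr (_ *: _ + _); congr (_ + _).
- by rewrite -E; exact: mulr_suml.
- by rewrite -E; exact: mulr_suml.
Qed.

Definition divf (f : V -> R) (G : V -> V) (v x : V) : R :=
  einner v (G x) - einner v x * (einner x (G x) + N.-1%:R * f x).

Lemma contK_divf (K' U : set V) f G v : open U -> K' `<=` U -> c1 U f G -> contK K' (divf f G v).
Proof.
move=> oU KU c1f.
have cG := c1_contKG oU KU c1f; have cf := c1_contK oU KU c1f.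
have cv := contK_vcst K' v; have cx := contK_id K'.
exact: (contKB (contK_einner cv cG) (contKM (contK_einner cv cx)
  (contKD (contK_einner cx cG) (contKM (contK_cst K' N.-1%:R) cf)))).
Qed.

Lemma mob_sphere x : K x -> einner (mob_pt x) (mob_pt x) = 1.
Proof.
move=> Kx; have d0 : mob_den x != 0 := lt0r_neq0 (mob_K Kx).
have xx := mean_sphere hM Kx.
rewrite /mob_pt !einnerE w00 xx (einnerC x w0).
move: d0; rewrite /mob_den; move: (einner w0 x) => a d0.
apply/eqP; rewrite -subr_eq0; apply/eqP.
transitivity ((1 - a ^+ 2) * (w ^+ 2 + c ^+ 2 - 1) / (1 + c * a) ^+ 2); first by field.
by rewrite cw subrr mulr0 mul0r.
Qed.

Section MobDiv.
Variables (U : set V) (f : V -> R) (G : V -> V).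
Hypotheses (oU : open U) (TU : mob_pt @` K `<=` U) (c1f : c1 U f G).

Let Up := U0 `&` mob_pt @^-1` U.
Let oUp : open Up.
Proof.
rewrite openE => x [Ux UTx]; apply: filterI; first exact: open_nbhs_nbhs (conj mob_U0_open Ux).
by apply: (mob_pt_cont Ux); exact: open_nbhs_nbhs (conj oU UTx).
Qed.

Let KUp : K `<=` Up.
Proof. by move=> x Kx; split; [exact: mob_K|apply: TU; exists x]. Qed.

Let J x := (mob_den x)^-1 ^+ N.-1.
Let H x := J x * f (mob_pt x).
Let HG x := J x *: mob_grad G x + f (mob_pt x) *: ((- (N.-1%:R * c * (mob_den x)^-1 ^+ N.-1.+1)) *: w0).

Let c1H : c1 Up H HG.
Proof. by apply: c1_mul (c1_mob c1f); apply: c1S (c1_mob_inv _) => x []. Qed.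

Let cJ : contK K J := c1_contK mob_U0_open mob_K (c1_mob_inv N.-1).

Let cT : contK K mob_pt.
Proof.
move=> x /mob_K Ux; have h : \forall s \near x, U0 s := open_nbhs_nbhs (conj mob_U0_open Ux).
near=> s; apply: mob_pt_cont; near: s; exact: h.
Unshelve. all: by end_near. Qed.

Let cE v : contK K (fun x => J x * divf f G v (mob_pt x)).
Proof. exact: (contKM cJ (contK_push cT (contK_divf v oU TU c1f))). Qed.

(** Modulo w^2 + c^2 = 1, the divergence integrand of f in direction w0 at the image point, times
    the Jacobian, is the divergence integrand of [H] in the same direction at x. *)
Lemma mob_div0 : mob (divf f G w0) = 0.
Proof.
rewrite -(mean_div hM oUp KUp c1H Dw0).
apply: (pf_ext (mean_pf hM) (cE w0) (contK_divf w0 oUp KUp c1H)) => x Kx.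
have d0 : mob_den x != 0 := lt0r_neq0 (mob_K Kx).
rewrite /divf /HG /H /mob_grad; move: (G (mob_pt x)) (f (mob_pt x)) => g F.
rewrite /mob_pt !einnerE w00 (einnerC x w0) /J (exprSr _ N.-1).
move: (_ ^+ N.-1) N.-1%:R (einner w0 g) (einner x g) d0 => j m g0 gx.
rewrite /mob_den; move: (einner w0 x) => a d0.
apply/eqP; rewrite -subr_eq0; apply/eqP.
transitivity (- j * g0 * (1 - a ^+ 2) * (w ^+ 2 + c ^+ 2 - 1) / (1 + c * a) ^+ 2); first by field.
by rewrite cw subrr mulr0 mul0r.
Qed.

(** For v orthogonal to w0 the field pulls back to a combination of two directions: v with weight (1
    + c a) / w, and w0 with weight -(c / w) <v, x>. The divergence identity is used once for
    each. *)
Lemma mob_div1 v : D v -> einner v w0 = 0 -> mob (divf f G v) = 0.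
Proof.
move=> Dv vw0.
have c1d := c1_mul (c1_mul (@c1_cst R n Up w^-1) (@c1_mob_den Up)) c1H.
have c1b := c1_mul (@c1_lin R n Up v) c1H.
have R1 := mean_div hM oUp KUp c1d Dv; have k1 := contK_divf v oUp KUp c1d.
have R2 := mean_div hM oUp KUp c1b Dw0; have k2 := contK_divf w0 oUp KUp c1b.
have k3 := contKM (contK_cst K (c / w)) k2.
have <- : 0 - (c / w) * 0 = 0 :> R by rewrite mulr0 subr0.
rewrite -{1}R1 -{1}R2 -(pfZ (mean_pf hM) (c / w) k2) -(pfB (mean_pf hM) k1 k3).
apply: (pf_ext (mean_pf hM) (cE v) (contKB k1 k3)) => x Kx.
have d0 : mob_den x != 0 := lt0r_neq0 (mob_K Kx).
rewrite /divf /HG /H /mob_grad; move: (G (mob_pt x)) (f (mob_pt x)) => g F.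
rewrite /mob_pt !einnerE w00 (einnerC x w0) (einnerC w0 v) (einnerC x v) vw0 /J (exprSr _ N.-1).
move: (_ ^+ N.-1) N.-1%:R (einner w0 g) (einner x g) (einner v g) (einner v x) d0 => j m g0 gx gv b.
rewrite /mob_den; move: (einner w0 x) => a d0.
apply/eqP; rewrite -subr_eq0; apply/eqP.
transitivity (j * b * (w ^+ 2 + c ^+ 2 - 1) * ((a * g0 - gx) / (1 + c * a) ^+ 2 - m * F / (w * (1 + c * a)))).
  by field; rewrite d0 w_neq0.
by rewrite cw subrr mulr0 mul0r.
Qed.

End MobDiv.

Lemma contK_mob (f : V -> R) : contK (mob_pt @` K) f ->
  contK K (fun x => (mob_den x)^-1 ^+ N.-1 * f (mob_pt x)).
Proof.
move=> cf; have cJ : contK K (fun x => (mob_den x)^-1 ^+ N.-1) := c1_contK mob_U0_open mob_K (c1_mob_inv N.-1).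
apply: (contKM cJ (contK_push _ cf)) => x /mob_K Ux.
have h : \forall s \near x, U0 s := open_nbhs_nbhs (conj mob_U0_open Ux).
near=> s; apply: mob_pt_cont; near: s; exact: h.
Unshelve. all: by end_near. Qed.

Lemma mob_mean : mean (mob_pt @` K) [set v | v = w0 \/ (D v /\ einner v w0 = 0)] N mob.
Proof.
have cJ : contK K (fun x => (mob_den x)^-1 ^+ N.-1) := c1_contK mob_U0_open mob_K (c1_mob_inv N.-1).
have dv (U : set V) f G v : open U -> mob_pt @` K `<=` U -> c1 U f G -> v = w0 \/ (D v /\ einner v w0 = 0) ->
    mob (divf f G v) = 0.
  by move=> oU KU c1f [->|[Dv vw]]; [exact: (mob_div0 oU KU c1f)|exact: (mob_div1 oU KU c1f Dv vw)].
have J0 x : K x -> 0 < (mob_den x)^-1 ^+ N.-1.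
  by move=> /mob_K Ux; rewrite exprn_gt0 // invr_gt0.
have cT : contK K mob_pt.
  move=> x /mob_K Ux; have h : \forall s \near x, U0 s := open_nbhs_nbhs (conj mob_U0_open Ux).
  near=> s; apply: mob_pt_cont; near: s; exact: h.
have pm : posfun (mob_pt @` K) mob.
  exact: (pf_push (pf_weight (mean_pf hM) cJ (fun x Kx => ltW (J0 x Kx))) cT).
split=> //.
- by move=> _ [x Kx <-]; exact: mob_sphere.
- move=> v Dv.
  (* For f = 1 the divergence identity reads (N - 1) times the average of <v, x> equals 0, and N >
     1. *)
  have := dv setT (fun=> 1) (fun=> 0) v openT (@subsetT _ _) (@c1_cst R n setT 1) Dv.
  have cv := contK_einner (contK_vcst (mob_pt @` K) v) (contK_id _).
  have -> : divf (fun=> 1) (fun=> 0) v = (fun x => - N.-1%:R * einner v x).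
    by apply/funext => x; rewrite /divf !einner0r; ring.
  rewrite (pfZ pm _ cv) => /eqP; rewrite mulf_eq0 oppr_eq0 pnatr_eq0 -subn1 subn_eq0 leqNgt N1 /=.
  by move/eqP.
(* On the sphere the denominator is at most 2, which bounds the density from below. *)
- have h : forall x, K x -> 2^-1 ^+ N.-1 <= (mob_den x)^-1 ^+ N.-1 * 1.
    move=> x Kx; rewrite mulr1; have Ux := mob_K Kx.
    rewrite lerXn2r ?nnegrE ?invr_ge0 ?ler0n ?(ltW Ux) // lef_pV2 ?posrE ?ltr0n //.
    have e1 (v : V) : einner v v = 1 -> enorm v = 1 by rewrite enormE => ->; rewrite sqrtr1.
    have h1 : `|c * einner w0 x| <= 1.
      rewrite normrM mulr_ile1 ?(ltW mob_c_lt1) //.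
      by have := cauchy_schwarz w0 x; rewrite (e1 _ w00) (e1 _ (mean_sphere hM Kx)) mulr1.
    by rewrite /mob_den -[2]/(1 + 1) lerD2l (le_trans (ler_norm _)).
  have h2 := pf_le (mean_pf hM) (contK_cst K (2^-1 ^+ N.-1)) (contKM cJ (contK_cst K 1)) h.
  apply: lt_le_trans h2.
  have -> : (fun=> 2^-1 ^+ N.-1) = (fun x : V => 2^-1 ^+ N.-1 * 1) :> (V -> R) by apply/funext => x; rewrite mulr1.
  rewrite (pfZ (mean_pf hM) _ (contK_cst K 1)) mulr_gt0 ?(mean_gt0 hM) // exprn_gt0 // invr_gt0 ltr0n //.
Unshelve. all: by end_near. Qed.

End Mobius.

Lemma cont_near_eq (R : realType) (X : topologicalType) (f f' : X -> R) (x : X) : (\forall y \near x, f y = f' y) -> {for x, continuous f} -> {for x, continuous f'}.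
Proof.
move=> ff cf; apply/cvgrPdist_lt => e e0; near=> y.
rewrite -(nbhs_singleton ff); have <- : f y = f' y by near: y.
by near: y; move/cvgrPdist_lt : cf; apply.
Unshelve. all: by end_near. Qed.

(** * Harmonic functions with explicit gradient and Hessian *)

Section Harm.
Context {R : realType} {n : nat}.
Local Notation V := 'rV[R]_n.
Implicit Types (U : set V) (f u v : V -> R) (G : V -> V) (x y w g : V) (r s a : R).

Lemma hasgrad_bound f x g : hasgrad f x g ->
  forall e, 0 < e -> \forall h \near (0 : V), `|f (x + h) - f x - einner h g| <= e * `|h|.
Proof.
move=> [df Ef] e e0.
have /diff_locallyP[_ h] := df.
move: h; rewrite Ef => /eqaddoP => /(_ e e0) h; near=> k.
have : `|(f \o shift x - (cst (f x) + einnerl g)) k| <= e * `|k| by near: k; exact: h.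
by rewrite /= !fctE /cst /= opprD addrA [k + x]addrC.
Unshelve. all: by end_near. Qed.

Lemma hasgrad_near f f' x g : (\forall y \near x, f y = f' y) -> hasgrad f x g -> hasgrad f' x g.
Proof.
move=> ff hf; apply: is_diff_bound => e e0.
have h1 := hasgrad_bound hf e0.
have h2 : \forall h \near (0 : V), f (x + h) = f' (x + h).
  have c : {for (0 : V), continuous (fun h => x + h)}.
    by apply: continuousD; [exact: cst_continuous|exact: cvg_id].
  by have := c [set y | f y = f' y]; rewrite addr0; apply.
near=> h; rewrite -(nbhs_singleton ff).
have <- : f (x + h) = f' (x + h) by near: h.
by near: h; exact: h1.
Unshelve. all: by end_near.
Qed.

(** The parameter is the square of the radius, which avoids square roots throughout. *)
Definition oball r : set V := [set x | einner x x < r].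

Lemma oball_open r : open (oball r).
Proof.
apply: (@open_comp _ _ (fun x => einner x x) [set t | t < r]); last exact: open_lt.
by move=> x _; apply: cont_einner; exact: cvg_id.
Qed.

Lemma unit_ballE x : unit_ball x = oball 1 x.
Proof.
rewrite /unit_ball /oball /= enormE; apply/propext; split=> h.
  by rewrite -(@sqrtr1 R) ltr_sqrt // in h.
by rewrite -(@sqrtr1 R) ltr_sqrt.
Qed.

(* [G] and [W i] are the gradients of [u] and of the [i]-th coordinate of [G]. *)
Definition harmd U u G (W : 'I_n -> V -> V) :=
  [/\ c1 U u G, forall i, c1 U (fun x => G x 0 i) (W i) & forall x, U x -> \sum_i W i x 0 i = 0].

Lemma harmonic_harmd u : harmonic_on_ball u -> harmd (oball 1) u (grad u) (fun i => grad (partial i u)).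
Proof.
move=> hu.
have h1 i : c1 (oball 1) (fun x => grad u x 0 i) (grad (partial i u)).
  move=> x; rewrite -unit_ballE => /hu[_ d2 c2 _].
  rewrite (_ : (fun x => _) = partial i u); last by apply/funext => y; rewrite mxE.
  split; first exact/diff_hasgrad/d2.
  by apply: (@cont_row R n _ (fun j => partial j (partial i u))) => j; exact: c2.
split; [|exact: h1|].
- move=> x Ux; split; first by apply: diff_hasgrad; move: Ux; rewrite -unit_ballE => /hu[].
  have -> : grad u = (fun x => \row_i grad u x 0 i) by apply/funext => y; apply/rowP => i; rewrite !mxE.
  by apply: cont_row => i; have [/hasgrad_cont] := h1 i _ Ux.
- move=> x; rewrite -unit_ballE => /hu[_ _ _]; move=> E; rewrite -[RHS]E /=.
  by apply: eq_bigr => i _; rewrite mxE.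
Qed.

Lemma harmd_harmonic u G W : harmd (oball 1) u G W -> harmonic_on_ball u.
Proof.
move=> [h1 h2 h3] x; rewrite unit_ballE => Ux.
have nU : \forall y \near x, oball 1 y := open_nbhs_nbhs (conj (@oball_open 1) Ux).
have pE y i : oball 1 y -> partial i u y = G y 0 i by move=> /h1[h _]; exact: hasgrad_partial.
have hp y i : oball 1 y -> hasgrad (partial i u) y (W i y).
  move=> Uy; have [h _] := h2 i y Uy; apply: hasgrad_near h.
  by apply: filterS (open_nbhs_nbhs (conj (@oball_open 1) Uy)) => z /pE.
have ppE y i j : oball 1 y -> partial j (partial i u) y = W i y 0 j.
  by move=> Uy; exact: hasgrad_partial (hp y i Uy).
split.
- by have [[]] := h1 x Ux.
- by move=> i; have [] := hp x i Ux.
- move=> i j; have [_ cW] := h2 i x Ux.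
  apply: cont_near_eq (cont_coord (i := j) cW); near=> z; rewrite ppE //; near: z; exact: nU.
- by rewrite -[RHS](h3 x Ux); apply: eq_bigr => i _; exact: ppE.
Unshelve. all: by end_near. Qed.

Lemma harmd_scale U u G W a : harmd U u G W ->
  harmd [set x | U (a *: x)] (fun x => u (a *: x)) (fun x => a *: G (a *: x)) (fun i x => a ^+ 2 *: W i (a *: x)).
Proof.
move=> [h1 h2 h3].
have ca x : {for x, continuous (fun y : V => a *: y)} by exact: (@scaler_continuous _ _ a).
have cc (H : V -> V) k x : {for a *: x, continuous H} -> {for x, continuous (fun x => k *: H (a *: x))}.
  move=> cH; have h : {for x, continuous (fun y => H (a *: y))}.
    by apply: (@continuous_comp _ _ _ (fun y : V => a *: y) H) => //; exact: ca.
  exact: (@continuousZ _ _ _ (fun=> k) _ x (@cst_continuous _ _ k x) h).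
split.
- move=> x /h1[hu cG]; split; [exact: hasgrad_scale|exact: cc].
- move=> i x /(h2 i)[hu cG]; split; last exact: cc.
  have hs := hasgradM (hasgrad_cst a x) (hasgrad_scale hu).
  have -> : (fun x => (a *: G (a *: x)) 0 i) = (fun x => a * G (a *: x) 0 i) by apply/funext => y; rewrite mxE.
  by apply: hasgrad_eq hs _; rewrite scaler0 addr0 scalerA expr2.
- move=> x /h3 h; under eq_bigr do rewrite mxE.
  by rewrite -mulr_sumr h mulr0.
Qed.

Lemma harmdS U U' u G W : U' `<=` U -> harmd U u G W -> harmd U' u G W.
Proof.
move=> UU [h1 h2 h3]; split; [exact: c1S h1|by move=> i; exact: c1S (h2 i)|by move=> x /UU; exact: h3].
Qed.

Lemma harmd_cst U c : harmd U (fun=> c) (fun=> 0) (fun=> fun=> 0).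
Proof.
split=> [|i|x _].
- exact: c1_cst.
- have -> : (fun x : V => (0 : V) 0 i) = (fun=> 0) by apply/funext => x; rewrite mxE.
  exact: c1_cst.
- by rewrite big1 // => i _; rewrite mxE.
Qed.

End Harm.

(** * Continuity of parametrised integrands near a slice *)

Definition sliceK {X T : Type} (x : X) (K : set T) : set (X * T) := [set x] `*` K.

Section ContKTools.
Context {R : realType}.

Lemma jcontE {T X : topologicalType} (K : set T) (F : X -> T -> R) (x0 : X) :
  contK (sliceK x0 K) (fun p : X * T => F p.1 p.2) -> jcont K F x0.
Proof. by move=> h t Kt; exact: (h (x0, t)). Qed.

Lemma contK_fst {T X : topologicalType} (K : set (X * T)) : contK K fst.
Proof. by apply: contK_continuous => p; exact: cvg_fst. Qed.
Lemma contK_snd {T X : topologicalType} (K : set (X * T)) : contK K snd.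
Proof. by apply: contK_continuous => p; exact: cvg_snd. Qed.

Arguments contK_fst {T X} K t _ : rename.
Arguments contK_snd {T X} K t _ : rename.

Lemma contK_open {X Y : topologicalType} (U K : set X) (h : X -> Y) : open U -> K `<=` U ->
  (forall x, U x -> {for x, continuous h}) -> contK K h.
Proof.
move=> oU KU ch x /KU Ux; have hU : \forall s \near x, U s := open_nbhs_nbhs (conj oU Ux).
by near=> s; apply: ch; near: s.
Unshelve. all: by end_near. Qed.

Lemma contK_pow {T : topologicalType} (K : set T) (f : T -> R) m : contK K f -> contK K (fun t => f t ^+ m).
Proof. by move=> cf; exact: (contK_comp (@exprn_continuous R m) cf). Qed.

Lemma contK_fstfun {T : topologicalType} (K : set T) (e : R -> R) (s : R) :
  (\forall t \near s, {for t, continuous e}) -> contK (sliceK s K) (fun p : R * T => e p.1).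
Proof. by move=> he; apply: (contK_push (contK_fst _)) => _ [[t x] [/= -> Kx] <-]. Qed.

Lemma contK_sndfun (K : set R) (e : R -> R) (s : R) :
  continuous e -> contK (sliceK s K) (fun p : R * R => e p.2).
Proof. by move=> he; apply: (contK_push (contK_snd _)); exact: contK_continuous. Qed.

Lemma contK_sqrtV {T : topologicalType} (K : set T) (f : T -> R) : contK K f ->
  (forall t, K t -> 0 < f t) -> contK K (fun t => (Num.sqrt (f t))^-1).
Proof.
move=> cf f0; apply: (contK_push (f := fun t : R => (Num.sqrt t)^-1) cf).
apply: (contK_open (@open_gt R 0)) => [_ [t Kt <-]|t t0]; first exact: f0.
have s0 : Num.sqrt t != 0 by rewrite lt0r_neq0 // sqrtr_gt0.
exact: is_derive_cont (D_inv (f := fun t : R => Num.sqrt t) s0 (D_sqrt (f := fun t : R => t) t0 (D_id t))).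
Qed.

End ContKTools.

Arguments contK_fst {T X} K t _ : rename.
Arguments contK_snd {T X} K t _ : rename.

(** * Green's identity for an abstract spherical average *)

Section Green.
Context {R : realType} {n : nat}.
Local Notation V := 'rV[R]_n.
Implicit Types (U : set V) (f u v : V -> R) (G : V -> V) (x y w g : V) (r s a : R).

Lemma D_sum (I : Type) (q : seq I) (f : I -> R -> R) (a : I -> R) (x : R) :
  (forall i, is_derive x (1 : R) (f i) (a i)) ->
  is_derive x (1 : R) (fun t => \sum_(i <- q) f i t) (\sum_(i <- q) a i).
Proof.
move=> h; elim: q => [|i q ih].
  under eq_fun do rewrite big_nil; rewrite big_nil; exact: D_cst.
under eq_fun do rewrite big_cons; rewrite big_cons; exact: D_add.
Qed.

Lemma c1_sub U f G h H : c1 U f G -> c1 U h H -> c1 U (fun x => f x - h x) (fun x => G x - H x).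
Proof.
move=> cf ch x Ux; have [hf cG] := cf x Ux; have [hh cH] := ch x Ux; split; first exact: hasgradB.
exact: continuousB cG cH.
Qed.

Lemma c1_scale U f G a : c1 U f G -> c1 [set x | U (a *: x)] (fun x => f (a *: x)) (fun x => a *: G (a *: x)).
Proof.
move=> h x /h[hf cG]; split; first exact: hasgrad_scale.
have h1 : {for x, continuous (fun y => G (a *: y))}.
  by apply: (@continuous_comp _ _ _ (fun y : V => a *: y) G); [exact: (@scaler_continuous _ _ a)|exact: cG].
exact: (@continuousZ _ _ _ (fun=> a) _ x (@cst_continuous _ _ a x) h1).
Qed.

Variables (K : set V) (M : (V -> R) -> R).
Hypotheses (n1 : (1 < n)%N) (hM : mean K setT n M).
Let pM := mean_pf hM.

Lemma contK_scaled {Y : topologicalType} U (h : V -> Y) (s0 : R) : open U -> (forall x, U x -> {for x, continuous h}) ->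
  (forall x, K x -> U (s0 *: x)) -> contK (sliceK s0 K) (fun p : R * V => h (p.1 *: p.2)).
Proof.
move=> oU ch KU.
have cs : contK (sliceK s0 K) (fun p : R * V => p.1 *: p.2) := contK_vZ (contK_fst _) (contK_snd _).
apply: (contK_push cs); apply: (contK_open oU _ ch) => _ [[s x] [/= -> Kx] <-]; exact: KU.
Qed.

Lemma oball_scale r s x : s ^+ 2 < r -> K x -> oball r (s *: x).
Proof. by move=> sr Kx; rewrite /oball /= !einnerE (mean_sphere hM Kx) mulr1 -expr2. Qed.

Section Flux.
Variables (r : R) (G : V -> V) (W : 'I_n -> V -> V).
Hypotheses (r1 : 1 < r) (cG : forall i, c1 (oball r) (fun x => G x 0 i) (W i)).
Hypothesis divG : forall x, oball r x -> \sum_i W i x 0 i = 0.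

Let cGc x : oball r x -> {for x, continuous G}.
Proof.
move=> Ux; have -> : G = (fun x => \row_i G x 0 i) by apply/funext => y; apply/rowP => i; rewrite !mxE.
by apply: cont_row => i; have [/hasgrad_cont] := cG i Ux.
Qed.

(** The flux of a divergence-free field through the sphere of radius s is constant in s and vanishes
    at s = 0. The divergence theorem on the sphere replaces integration over the solid ball. *)
Lemma mean_flux : M (fun x => einner x (G x)) = 0.
Proof.
pose F s x := einner x (G (s *: x)).
pose F' s x := \sum_i x 0 i * einner x (W i (s *: x)).
have oU := @oball_open R n r.
have near_s s : s ^+ 2 < r -> \forall t \near s, t ^+ 2 < r.
  move=> sr; have c : {for s, continuous (fun t : R => t ^+ 2)} by exact: exprn_continuous.
  apply: (c [set t | t < r]); exact: (open_nbhs_nbhs (conj (@open_lt R r) sr)).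
have cp s : s ^+ 2 < r -> contK (sliceK s K) (fun p : R * V => F p.1 p.2).
  move=> sr; exact: (contK_einner (contK_snd _) (contK_scaled oU cGc (fun x Kx => oball_scale sr Kx))).
have cp' s : s ^+ 2 < r -> contK (sliceK s K) (fun p : R * V => F' p.1 p.2).
  move=> sr; apply: contK_sum => i.
  have cW x : oball r x -> {for x, continuous (W i)} by move=> /(cG i)[].
  exact: (contKM (contK_coord i (contK_snd _)) (contK_einner (contK_snd _)
    (contK_scaled oU cW (fun x Kx => oball_scale sr Kx)))).
have cF s : s ^+ 2 < r -> contK K (F s) by move=> sr; apply: jcont_contK; apply: jcontE; exact: cp.
have cF' s : s ^+ 2 < r -> contK K (F' s) by move=> sr; apply: jcont_contK; apply: jcontE; exact: cp'.
have dF s x : s ^+ 2 < r -> K x -> is_derive s (1 : R) (F^~ x) (F' s x).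
  move=> sr Kx; apply: D_sum => i.
  have [h _] := cG i (oball_scale sr Kx).
  have ds : is_derive s (1 : R) (fun t => t *: x) x.
    have := is_derive_line 0 x s; by under eq_fun do rewrite add0r.
  have hc := hasgrad_curve h ds.
  by apply: D_eq (D_mul (D_cst (x 0 i) s) hc) _; rewrite mul0r add0r.
have dg s : s ^+ 2 < r -> is_derive s (1 : R) (fun s => M (F s)) (M (F' s)).
  move=> sr; apply: (pf_derive pM _ (jcontE (cp' s sr))).
    by apply: filterS (near_s s sr) => t; exact: cF.
  by apply: filterS (near_s s sr) => t tr x; exact: dF.
(* Sum over i of the divergence identity with v the i-th basis vector and the function G_i (s .);
   the terms forming the divergence of G drop out. *)
have div s : s ^+ 2 < r -> n.-1%:R * M (F s) + s * M (F' s) = 0.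
  move=> sr.
  pose E i x := einner (ebasis R i) (s *: W i (s *: x)) -
     einner (ebasis R i) x * (einner x (s *: W i (s *: x)) + n.-1%:R * G (s *: x) 0 i).
  have KU : K `<=` [set x | oball r (s *: x)] by move=> x Kx; exact: oball_scale.
  have oUs : open [set x : V | oball r (s *: x)].
    apply: (@open_comp _ _ (fun x : V => s *: x)) oU => x _; exact: (@scaler_continuous _ _ s).
  have cE i : contK K (E i) := contK_divf n (ebasis R i) oUs KU (c1_scale (a := s) (cG i)).
  have E0 i : M (E i) = 0 := mean_div hM oUs KU (c1_scale (a := s) (cG i)) I.
  have c1' := contKM (contK_cst K n.-1%:R) (cF s sr); have c2' := contKM (contK_cst K s) (cF' s sr).
  rewrite -(pfZ pM _ (cF s sr)) -(pfZ pM _ (cF' s sr)) -(pfD pM c1' c2').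
  apply/eqP; rewrite -oppr_eq0; apply/eqP.
  transitivity (\sum_i M (E i)); last by rewrite big1.
  rewrite -(pf_sum pM _ cE) -(pfN pM (contKD c1' c2')).
  apply: (pf_ext pM (contKN (contKD c1' c2')) (contK_sum _ cE)) => x Kx.
  have dv := divG (oball_scale sr Kx); rewrite /E /F /F'.
  have -> : einner x (G (s *: x)) = \sum_i x 0 i * G (s *: x) 0 i by [].
  under [RHS]eq_bigr do rewrite !einner_ebasis mxE mulrDr opprD.
  rewrite big_split /= -mulr_sumr dv mulr0 add0r.
  rewrite opprD addrC big_split /=; congr (_ + _).
    rewrite sumrN mulr_sumr; congr (- _); apply: eq_bigr => i _.
    by rewrite einnerZr; ring.
  by rewrite sumrN mulr_sumr; congr (- _); apply: eq_bigr => i _; ring.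
(* The flux through the sphere of radius s; it vanishes at s = 0 because n > 1. *)
pose phi s := s ^+ n.-1 * M (F s).
have s2 s : 0 <= s <= 1 -> s ^+ 2 < r.
  by move=> /andP[s0 s1]; apply: le_lt_trans r1; rewrite exprn_ile1.
have dphi s : 0 <= s <= 1 -> is_derive s (1 : R) phi (n.-1%:R * s ^+ n.-2 * M (F s) + s ^+ n.-1 * M (F' s)).
  move=> hs; apply: D_eq (D_mul (D_pow n.-1 (D_id s)) (dg s (s2 s hs))) _.
  by rewrite mulr1.
have := @D_const _ phi 0 1 ltr01.
have n10 : n.-1 = n.-2.+1 by case: (n) n1 => [|[]].
have h0 : phi 0 = 0 by rewrite /phi n10 expr0n mul0r.
have h1 : phi 1 = M (fun x => einner x (G x)).
  by rewrite /phi expr1n mul1r; congr M; apply/funext => x; rewrite /F scale1r.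
rewrite h0 h1 => h; symmetry; apply: h => s; last by move=> hs; exact: is_derive_cont (dphi s hs).
move=> /andP[s0 s1]; have hs : 0 <= s <= 1 by rewrite !ltW.
apply: D_eq (dphi s hs) _.
transitivity (s ^+ n.-2 * (n.-1%:R * M (F s) + s * M (F' s))); last by rewrite div ?mulr0 // s2.
have -> : s ^+ n.-1 = s * s ^+ n.-2 by rewrite n10 exprS.
by ring.
Qed.

End Flux.

(** Apply [mean_flux] to the field u grad v - v grad u, divergence-free for harmonic u and v. *)
Lemma green r u Gu Wu v Gv Wv : 1 < r -> harmd (oball r) u Gu Wu -> harmd (oball r) v Gv Wv ->
  M (fun x => u x * einner x (Gv x) - v x * einner x (Gu x)) = 0.
Proof.
move=> r1 [u1 u2 u3] [v1 v2 v3].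
pose G x := u x *: Gv x - v x *: Gu x.
pose W i x := (u x *: Wv i x + Gv x 0 i *: Gu x) - (v x *: Wu i x + Gu x 0 i *: Gv x).
have := @mean_flux r G W r1.
have -> : (fun x => einner x (G x)) = (fun x => u x * einner x (Gv x) - v x * einner x (Gu x)).
  by apply/funext => x; rewrite /G einnerBr !einnerZr.
apply.
- move=> i; have h := c1_sub (c1_mul u1 (v2 i)) (c1_mul v1 (u2 i)).
  by have -> : (fun x => G x 0 i) = (fun x => u x * Gv x 0 i - v x * Gu x 0 i) by apply/funext => x; rewrite !mxE.
- move=> x Ux; transitivity (u x * \sum_i Wv i x 0 i - v x * \sum_i Wu i x 0 i).
    rewrite !mulr_sumr -sumrB; apply: eq_bigr => i _; rewrite !mxE; ring.
  by rewrite u3 // v3 // !mulr0 subrr.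
Qed.

End Green.

(** * The Poisson kernel and its derivatives *)

Section PoissonKernel.
Context {R : realType} {n : nat}.
Local Notation V := 'rV[R]_n.
Implicit Types (x y w g l : V) (m : nat) (Q : set (V * V)).

(** [pdist] is the squared distance and [psi] the inverse distance, so [pois] is the Poisson kernel
    for averages of total mass 1; [poisG] and the rows [poisW] are its gradient and Hessian in x. *)
Definition pdist x y : R := einner (x - y) (x - y).
Definition psi x y : R := (Num.sqrt (pdist x y))^-1.
Definition pois x y : R := (1 - einner x x) * psi x y ^+ n.
Definition poisG x y : V :=
  (- (2 * psi x y ^+ n)) *: x - (n%:R * (1 - einner x x) * psi x y ^+ n.+2) *: (x - y).
Definition poisW (i : 'I_n) x y : V :=
  (- (2 * psi x y ^+ n) - n%:R * (1 - einner x x) * psi x y ^+ n.+2) *: ebasis R i +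
  (2 * n%:R * psi x y ^+ n.+2 * x 0 i) *: (x - y) +
  (2 * n%:R * psi x y ^+ n.+2 * (x - y) 0 i) *: x +
  (n%:R * n.+2%:R * (1 - einner x x) * psi x y ^+ n.+4 * (x - y) 0 i) *: (x - y).

Lemma pdistE x y : pdist x y = einner x x - 2 * einner x y + einner y y.
Proof. by rewrite /pdist !einnerE (einnerC y x); ring. Qed.

Lemma psi_gt0 x y : 0 < pdist x y -> 0 < psi x y.
Proof. by move=> h; rewrite invr_gt0 sqrtr_gt0. Qed.

Lemma psi_sqr x y : 0 < pdist x y -> psi x y ^+ 2 * pdist x y = 1.
Proof.
by move=> h; rewrite exprVn sqr_sqrtr ?ltW // mulVf // lt0r_neq0.
Qed.

Lemma hasgrad_pdist x y : hasgrad (pdist^~ y) x (2 *: (x - y)).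
Proof.
have h := hasgrad_affine (b := - y) (a := 1) (hasgrad_sq (- y + 1 *: x)).
have E : (fun z : V => einner (- y + 1 *: z) (- y + 1 *: z)) = pdist^~ y.
  by apply/funext => z; rewrite /pdist scale1r addrC.
by rewrite E in h; apply: hasgrad_eq h _; rewrite !scale1r addrC.
Qed.

Lemma hasgrad_psiX m x y : 0 < pdist x y ->
  hasgrad (fun z => psi z y ^+ m) x ((- (m%:R * psi x y ^+ m.+2)) *: (x - y)).
Proof.
move=> h0; have s0 : Num.sqrt (pdist x y) != 0 by rewrite lt0r_neq0 // sqrtr_gt0.
have d := D_pow m (D_inv (f := fun t : R => Num.sqrt t) s0 (D_sqrt (f := fun t : R => t) h0 (D_id _))).
have h := hasgrad_comp1 (f := pdist^~ y) d (hasgrad_pdist x y).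
apply: (hasgrad_eq h).
rewrite scalerA; congr (_ *: _); rewrite /psi.
case: m {d h} => [|k]; rewrite ?mul0r ?oppr0 ?mul0r // (exprS _ k.+2) (exprS _ k.+1) (exprS _ k) /=.
by move: (Num.sqrt _) s0 => t t0; move: (_ ^+ k) => j; field.
Qed.

Lemma pdist_cont : continuous (fun p : V * V => pdist p.1 p.2).
Proof.
have c : continuous (fun p : V * V => p.1 - p.2).
  by move=> p; apply: (@continuousB _ _ _ (fun p : V * V => p.1) (fun p : V * V => p.2)); [exact: cvg_fst|exact: cvg_snd].
by move=> p; exact: (cont_einner (c p) (c p)).
Qed.

Section Cont.
Variable Q : set (V * V).
Hypothesis Q0 : forall p, Q p -> 0 < pdist p.1 p.2.

Lemma contK_psi : contK Q (fun p => psi p.1 p.2).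
Proof.
exact: (contK_sqrtV (contK_continuous pdist_cont) Q0).
Qed.

Let c1x : contK Q (fun p => p.1) := contK_fst Q.
Let c2x : contK Q (fun p => p.2) := contK_snd Q.
Let cxx : contK Q (fun p => 1 - einner p.1 p.1) := contKB (contK_cst Q 1) (contK_einner c1x c1x).
Let cxy : contK Q (fun p => p.1 - p.2).
Proof. by move=> p Qp; apply: filterS2 (c1x Qp) (c2x Qp) => s; exact: continuousB. Qed.
Let cs m : contK Q (fun p => psi p.1 p.2 ^+ m) := contK_pow m contK_psi.
Let ck (k : R) := contK_cst Q k.

Lemma contK_pois : contK Q (fun p => pois p.1 p.2).
Proof. exact: (contKM cxx (cs n)). Qed.

Lemma contK_poisG : contK Q (fun p => poisG p.1 p.2).
Proof.
have h1 := contK_vZ (contKN (contKM (ck 2) (cs n))) c1x.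
have h2 := contK_vZ (contKN (contKM (contKM (ck n%:R) cxx) (cs n.+2))) cxy.
have E : (fun p : V * V => poisG p.1 p.2) = (fun p => (- (2 * psi p.1 p.2 ^+ n)) *: p.1 +
    (- (n%:R * (1 - einner p.1 p.1) * psi p.1 p.2 ^+ n.+2)) *: (p.1 - p.2)).
  by apply/funext => p; rewrite /poisG (scaleNr (_ * _ * _)).
by rewrite E; exact: (contK_vD h1 h2).
Qed.

Lemma contK_poisW i : contK Q (fun p => poisW i p.1 p.2).
Proof.
have h1 := contK_vZ (contKB (contKN (contKM (ck 2) (cs n))) (contKM (contKM (ck n%:R) cxx) (cs n.+2))) (contK_vcst Q (ebasis R i)).
have h2 := contK_vZ (contKM (contKM (ck (2 * n%:R)) (cs n.+2)) (contK_coord i c1x)) cxy.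
have h3 := contK_vZ (contKM (contKM (ck (2 * n%:R)) (cs n.+2)) (contK_coord i cxy)) c1x.
have h4 := contK_vZ (contKM (contKM (contKM (ck (n%:R * n.+2%:R)) cxx) (cs n.+4)) (contK_coord i cxy)) cxy.
exact: (contK_vD (contK_vD (contK_vD h1 h2) h3) h4).
Qed.

End Cont.

Lemma cont_at_slice {Y : topologicalType} (F : V -> V -> Y) x y :
  contK [set (x, y)] (fun p => F p.1 p.2) -> {for x, continuous (F^~ y)}.
Proof.
move=> h; have h1 := nbhs_singleton (h (x, y) erefl).
apply: (@continuous_comp _ _ _ (fun z : V => (z, y)) (fun p : V * V => F p.1 p.2)) => //.
by apply: cont_pair; [exact: cvg_id|exact: cst_continuous].
Qed.

Lemma pois_harmd y : einner y y = 1 ->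
  harmd [set x | 0 < pdist x y] (pois^~ y) (poisG^~ y) (fun i => (poisW i)^~ y).
Proof.
move=> yy.
have Q0 x : 0 < pdist x y -> forall p, [set (x, y)] p -> 0 < pdist p.1 p.2 by move=> h p ->.
have h1 x : hasgrad (fun x => 1 - einner x x) x (- (2 *: x)).
  by apply: hasgrad_eq (hasgradB (hasgrad_cst 1 x) (hasgrad_sq x)) _; rewrite sub0r.
split.
- move=> x h0; split; last exact: cont_at_slice (contK_poisG (Q0 x h0)).
  apply: hasgrad_eq (hasgradM (h1 x) (hasgrad_psiX n h0)) _.
  rewrite /poisG scalerN !scalerA addrC scaleNr; congr (_ + _).
    by rewrite mulrC.
  by rewrite -[RHS]scaleNr; congr (_ *: _); ring.
- move=> i x h0; split; last exact: (cont_at_slice (F := poisW i) (contK_poisW (Q0 x h0) i)).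
  have hx := hasgrad_linl (ebasis R i) x.
  have hxy : hasgrad (fun z => einner (ebasis R i) z - y 0 i) x (ebasis R i).
    by apply: hasgrad_eq (hasgradB hx (hasgrad_cst (y 0 i) x)) _; rewrite subr0.
  have k1 := hasgradM (hasgrad_cst (-2) x) (hasgradM (hasgrad_psiX n h0) hx).
  have k2 := hasgradM (hasgrad_cst (- n%:R) x) (hasgradM (hasgradM (h1 x) (hasgrad_psiX n.+2 h0)) hxy).
  have -> : (fun z => poisG z y 0 i) = (fun z => -2 * (psi z y ^+ n * einner (ebasis R i) z) +
      - n%:R * ((1 - einner z z) * psi z y ^+ n.+2 * (einner (ebasis R i) z - y 0 i))).
    by apply/funext => z; rewrite /poisG !mxE !einner_ebasis; ring.
  apply: hasgrad_eq (hasgradD k1 k2) _.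
  rewrite !einner_ebasis; apply/rowP => j; rewrite /poisW !mxE; ring.
- move=> x h0; rewrite /poisW.
  have D1 := psi_sqr h0; rewrite pdistE yy in D1.
  have S (v w : V) k : \sum_i k * v 0 i * w 0 i = k * einner v w.
    by rewrite mulr_sumr; apply: eq_bigr => i _; rewrite mulrA.
  set s := psi x y in D1 *; set X := 1 - einner x x.
  transitivity (n%:R * (- (2 * s ^+ n) - n%:R * X * s ^+ n.+2) +
    2 * n%:R * s ^+ n.+2 * einner x (x - y) + 2 * n%:R * s ^+ n.+2 * einner (x - y) x +
    n%:R * n.+2%:R * X * s ^+ n.+4 * einner (x - y) (x - y)).
    rewrite -!S.
    have -> : n%:R * (- (2 * s ^+ n) - n%:R * X * s ^+ n.+2) =
        \sum_(i < n) (- (2 * s ^+ n) - n%:R * X * s ^+ n.+2).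
      by rewrite sumr_const card_ord mulr_natl.
    rewrite -!big_split /=; apply: eq_bigr => i _.
    by rewrite !mxE !eqxx /=; ring.
  rewrite !einnerE yy (einnerC y x) /X -(natr1 n.+1) -(natr1 n).
  rewrite (exprS _ n.+3) (exprS _ n.+2) (exprS _ n.+1) (exprS _ n).
  move: D1; move: (s ^+ n) n%:R (einner x x) (einner x y) => j N a b D1.
  (* The Laplacian is a multiple of psi^2 |x - y|^2 - 1, which is zero. *)
  transitivity (j * N * (s ^+ 2 * (a - 2 * b + 1) - 1) * (2 + (N + 2) * (1 - a) * s ^+ 2)).
    by ring.
  by rewrite D1 subrr mulr0 mul0r.
Qed.

End PoissonKernel.

(** * The Poisson formula *)

Section Poisson.
Context {R : realType} {n : nat}.
Local Notation V := 'rV[R]_n.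
Implicit Types (x y w g l xi : V) (r s a b rho : R).

Lemma norm_le_enorm x : `|x| <= enorm x.
Proof.
rewrite [leLHS]/Num.norm /= mx_normrE; apply: bigmax_le; first exact: enorm_ge0.
move=> [i j] _ /=; rewrite (ord1 i) -(@ler_pXn2r _ 2) ?nnegrE ?enorm_ge0 // enorm_sqr real_normK ?num_real //.
rewrite /einner (bigD1 j) //= -expr2 lerDl sumr_ge0 // => k _.
by rewrite -expr2 sqr_ge0.
Qed.

Lemma enorm1 x : einner x x = 1 -> enorm x = 1.
Proof. by rewrite enormE => ->; rewrite sqrtr1. Qed.

Lemma pdist_gt0 x y : oball 1 x -> einner y y = 1 -> 0 < pdist x y.
Proof.
rewrite -unit_ballE /unit_ball /= => x1 yy; rewrite pdistE yy -enorm_sqr.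
have := cauchy_schwarz x y; rewrite (enorm1 yy) mulr1 => /(le_trans (ler_norm _)) h.
apply: lt_le_trans (_ : (1 - enorm x) ^+ 2 <= _); first by rewrite exprn_gt0 // subr_gt0.
by rewrite sqrrB expr1n mul1r -mulr_natl; lra.
Qed.

Lemma pois_symm rho x y : einner x x = 1 -> einner y y = 1 -> pois (rho *: x) y = pois (rho *: y) x.
Proof.
by move=> xx yy; rewrite /pois /psi !pdistE !einnerE xx yy (einnerC x y).
Qed.

Lemma pois_ge0 x y : oball 1 x -> einner y y = 1 -> 0 <= pois x y.
Proof.
move=> x1 yy; rewrite mulr_ge0 ?exprn_ge0 ?(ltW (psi_gt0 (pdist_gt0 x1 yy))) //.
by rewrite subr_ge0 ltW.
Qed.

Variables (K : set V) (M : (V -> R) -> R).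
Hypotheses (n1 : (1 < n)%N) (hM : mean K setT n M) (M1 : M (fun=> 1) = 1).
Let pM := mean_pf hM.
Let KS x : K x -> einner x x = 1 := mean_sphere hM (x := x).

(** The two dilated functions are harmonic on a common ball of radius greater than 1, where [green]
    applies. *)
Lemma green_scaled a b A B u Gu Wu v Gv Wv : a ^+ 2 < A -> b ^+ 2 < B ->
  harmd (oball A) u Gu Wu -> harmd (oball B) v Gv Wv ->
  M (fun y => u (a *: y) * (b * einner y (Gv (b *: y))) - v (b *: y) * (a * einner y (Gu (a *: y)))) = 0.
Proof.
move=> aA bB hu hv.
pose m := Num.min (A - a ^+ 2) (B - b ^+ 2).
have m0 : 0 < m by rewrite lt_min !subr_gt0 aA.
pose c := 1 + a ^+ 2 + b ^+ 2.
have c0 : 0 < c by rewrite /c -addrA ltr_pwDl // addr_ge0 ?sqr_ge0.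
(* [m] is the smaller margin and [c] exceeds a^2 and b^2, so a^2 r and b^2 r stay within A and B. *)
pose r := 1 + m / c.
have r1 : 1 < r by rewrite ltrDl divr_gt0.
have hsub (e E : R) : e ^+ 2 < c -> m <= E - e ^+ 2 -> (oball r : set V) `<=` [set x : V | oball E (e *: x)].
  move=> ec mE x; rewrite /oball /= !einnerE mulrA -expr2 => xr.
  apply: le_lt_trans (_ : _ <= e ^+ 2 * r) _; first by rewrite ler_wpM2l ?sqr_ge0 // ltW.
  rewrite /r mulrDr mulr1 -ltrBrDl; apply: lt_le_trans mE.
  by rewrite mulrCA gtr_pMr // ltr_pdivrMr // mul1r.
have ac : a ^+ 2 < c by rewrite /c; have := sqr_ge0 b; lra.
have bc : b ^+ 2 < c by rewrite /c; have := sqr_ge0 a; lra.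
have mA : m <= A - a ^+ 2 by rewrite ge_min lexx.
have mB : m <= B - b ^+ 2 by rewrite ge_min lexx orbT.
have ha := harmdS (hsub a A ac mA) (harmd_scale a hu).
have hb := harmdS (hsub b B bc mB) (harmd_scale b hv).
rewrite -[RHS](green n1 hM r1 ha hb).
by congr M; apply/funext => y; rewrite !einnerZr.
Qed.

(** Both radii move with s; this covers the derivatives needed in [mean_pois_radial] and in
    [psif_const]. *)
Lemma D_radial (Up Uu : set V) p Gp u Gu (a b a' b' : R -> R) (s0 : R) :
  open Up -> open Uu -> c1 Up p Gp -> c1 Uu u Gu ->
  (\forall s \near s0, is_derive s (1 : R) a (a' s)) -> (\forall s \near s0, is_derive s (1 : R) b (b' s)) ->
  (\forall s \near s0, {for s, continuous a'}) -> (\forall s \near s0, {for s, continuous b'}) ->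
  (\forall s \near s0, forall y, K y -> Up (a s *: y)) -> (\forall s \near s0, forall y, K y -> Uu (b s *: y)) ->
  is_derive s0 (1 : R) (fun s => M (fun y => p (a s *: y) * u (b s *: y)))
    (M (fun y => a' s0 * einner y (Gp (a s0 *: y)) * u (b s0 *: y) +
       p (a s0 *: y) * (b' s0 * einner y (Gu (b s0 *: y))))).
Proof.
move=> oUp oUu cp cu da db ca' cb' Ka Kb.
have sl (e : R -> R) s : (\forall s \near s, {for s, continuous e}) -> contK (sliceK s K) (fun q : R * V => e q.1).
  move=> he; apply: (contK_push (contK_fst _)) => _ [[t x] [/= -> Kx] <-]; exact: he.
have cvar (e e' : R -> R) s : (\forall s \near s, is_derive s (1 : R) e (e' s)) -> \forall s \near s, {for s, continuous e}.
  by apply: filterS => t; exact: is_derive_cont.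
have sc (Y : topologicalType) (U : set V) (h : V -> Y) (e e' : R -> R) s : open U -> (forall x, U x -> {for x, continuous h}) ->
    (\forall s \near s, is_derive s (1 : R) e (e' s)) ->
    (forall y, K y -> U (e s *: y)) -> contK (sliceK s K) (fun q : R * V => h (e q.1 *: q.2)).
  move=> oU ch de KU.
  have c := contK_vZ (sl _ _ (cvar _ _ _ de)) (contK_snd (sliceK s K)).
  by apply: (contK_push c); apply: (contK_open oU _ ch) => _ [[t x] [/= -> Kx] <-]; exact: KU.
have cp1 x : Up x -> {for x, continuous p} by move=> /cp[/hasgrad_cont].
have cp2 x : Up x -> {for x, continuous Gp} by move=> /cp[].
have cu1 x : Uu x -> {for x, continuous u} by move=> /cu[/hasgrad_cont].
have cu2 x : Uu x -> {for x, continuous Gu} by move=> /cu[].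
apply: (pf_derive (F := fun s y => p (a s *: y) * u (b s *: y)) (F' := fun s y => a' s * einner y (Gp (a s *: y)) * u (b s *: y) +
       p (a s *: y) * (b' s * einner y (Gu (b s *: y)))) pM).
- have Da := near_join da; have Db := near_join db.
  near=> s; apply: (@jcont_contK R _ _ K (fun s y => p (a s *: y) * u (b s *: y)) s); apply: jcontE.
  have das : \forall s \near s, is_derive s (1 : R) a (a' s) by near: s.
  have dbs : \forall s \near s, is_derive s (1 : R) b (b' s) by near: s.
  have Kas : forall y, K y -> Up (a s *: y) by near: s.
  have Kbs : forall y, K y -> Uu (b s *: y) by near: s.
  exact: (contKM (sc _ _ _ _ _ _ oUp cp1 das Kas) (sc _ _ _ _ _ _ oUu cu1 dbs Kbs)).
- apply: jcontE; have Ka0 := nbhs_singleton Ka; have Kb0 := nbhs_singleton Kb.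
  have cy := contK_snd (sliceK s0 K).
  exact: (contKD (contKM (contKM (sl _ _ ca') (contK_einner cy (sc _ _ _ _ _ _ oUp cp2 da Ka0))) (sc _ _ _ _ _ _ oUu cu1 db Kb0))
    (contKM (sc _ _ _ _ _ _ oUp cp1 da Ka0) (contKM (sl _ _ cb') (contK_einner cy (sc _ _ _ _ _ _ oUu cu2 db Kb0))))).
- near=> s.
  have das : is_derive s (1 : R) a (a' s) by near: s.
  have dbs : is_derive s (1 : R) b (b' s) by near: s.
  have Kas0 : forall y, K y -> Up (a s *: y) by near: s.
  have Kbs0 : forall y, K y -> Uu (b s *: y) by near: s.
  move=> y Ky; have Kas := Kas0 y Ky; have Kbs := Kbs0 y Ky.
  have hp := hasgrad_curve (cp _ Kas).1 (is_derive_scalel y das).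
  have hu := hasgrad_curve (cu _ Kbs).1 (is_derive_scalel y dbs).
  have h := D_mul hp hu; apply: (D_eq h); rewrite !einnerZl; ring.
Unshelve. all: by end_near. Qed.

End Poisson.

Section PoissonFormula.
Context {R : realType} {n : nat}.
Local Notation V := 'rV[R]_n.
Implicit Types (x y w g l xi : V) (r s a b rho : R).
Variables (K : set V) (M : (V -> R) -> R).
Hypotheses (n1 : (1 < n)%N) (hM : mean K setT n M) (M1 : M (fun=> 1) = 1).
Let pM := mean_pf hM.
Let KS x : K x -> einner x x = 1 := mean_sphere hM (x := x).

Lemma polar x : exists rho xi, [/\ 0 <= rho, rho ^+ 2 = einner x x, einner xi xi = 1 & x = rho *: xi].
Proof.
have [->|x0] := eqVneq x 0.
  exists 0, (ebasis R (Ordinal (ltnW n1))); split => //.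
  - by rewrite expr0n einner0l.
  - by rewrite einner_ebasis mxE !eqxx.
  - by rewrite scale0r.
have e0 : enorm x != 0 by rewrite -sqrf_eq0 enorm_sqr einner_eq0.
exists (enorm x), ((enorm x)^-1 *: x); split.
- exact: enorm_ge0.
- exact: enorm_sqr.
- by rewrite !einnerE -enorm_sqr; field.
- by rewrite scalerA divff // scale1r.
Qed.

Lemma contK_at {Y : topologicalType} (U : set V) (h : V -> Y) (t : R) : open U ->
  (forall x, U x -> {for x, continuous h}) -> (forall y, K y -> U (t *: y)) -> contK K (fun y => h (t *: y)).
Proof.
move=> oU ch KU.
have c : contK K (fun y => t *: y) := contK_vZ (contK_cst K t) (contK_id K).
by apply: (contK_push c); apply: (contK_open oU _ ch) => _ [y Ky <-]; exact: KU.
Qed.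

Lemma pois_oball xi : einner xi xi = 1 ->
  harmd (oball 1) (pois^~ xi) (poisG^~ xi) (fun i => (poisW i)^~ xi).
Proof. by move=> xx; apply: harmdS (pois_harmd xx) => x /pdist_gt0; apply. Qed.

Lemma near_sqr_lt (a : R -> R) s A : {for s, continuous a} -> a s ^+ 2 < A ->
  \forall t \near s, forall y, K y -> oball A (a t *: y).
Proof.
move=> ca aA.
have c : {for s, continuous (fun t => a t ^+ 2)}.
  by apply: (@continuous_comp _ _ _ a (fun t : R => t ^+ 2)); [exact: ca|exact: exprn_continuous].
have h : \forall t \near s, a t ^+ 2 < A.
  by apply: (c [set t | t < A]); exact: (open_nbhs_nbhs (conj (@open_lt R A) aA)).
near=> t => y Ky; apply: (oball_scale hM) => //; near: t; exact: h.
Unshelve. all: by end_near. Qed.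

Section Unit.
Variable xi : V.
Hypothesis xixi : einner xi xi = 1.

Let cp := let: And3 h _ _ := pois_oball xixi in h.
Let cp1 x (Ux : oball 1 x) : {for x, continuous (pois^~ xi)} := hasgrad_cont (cp Ux).1.
Let cp2 x (Ux : oball 1 x) : {for x, continuous (poisG^~ xi)} := (cp Ux).2.
Let oU1 := @oball_open R n 1.

(** The pole xi is fixed and the average runs over the harmonic variable. Green's identity against
    the constant 1 makes the average constant in the radius, and at radius 0 the kernel is 1. *)
Lemma mean_pois_radial rho : 0 <= rho < 1 -> M (fun y => pois (rho *: y) xi) = 1.
Proof.
move=> /andP[r0 r1].
pose phi t := M (fun y => pois (t *: y) xi * 1).
pose dphi t := M (fun y => 1 * einner y (poisG (t *: y) xi) * 1 + pois (t *: y) xi * (0 * einner y 0)).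
have Kt (t : R) : 0 <= t < 1 -> t ^+ 2 < 1 by move=> /andP[t0 t1]; rewrite expr_lt1.
have d (t : R) : 0 <= t < 1 -> is_derive t (1 : R) phi (dphi t).
  move=> ht.
  apply: (D_radial hM oU1 (@openT _) cp (@c1_cst R n setT 1) (a := fun t => t) (a' := fun=> 1) (b := fun=> 0) (b' := fun=> 0)).
  - by near=> s; exact: D_id.
  - by near=> s; exact: D_cst.
  - by near=> s; exact: cst_continuous.
  - by near=> s; exact: cst_continuous.
  - by apply: (near_sqr_lt (a := fun t => t)); [exact: cvg_id|exact: Kt].
  - by near=> s.
have d0 (t : R) : 0 < t < 1 -> is_derive t (1 : R) phi 0.
  move=> /andP[t0 t1]; have ht : 0 <= t < 1 by rewrite ltW.
  apply: D_eq (d t ht) _; rewrite /dphi.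
  have c : contK K (fun y => 1 * (t * einner y (poisG (t *: y) xi)) - pois (t *: y) xi * (0 * einner y 0)).
    have KU y (Ky : K y) := oball_scale hM (Kt t ht) Ky.
    have k1 := contK_at oU1 cp1 KU; have k2 := contK_at oU1 cp2 KU.
    exact: (contKB (contKM (contK_cst K 1) (contKM (contK_cst K t) (contK_einner (contK_id K) k2)))
      (contKM k1 (contKM (contK_cst K 0) (contK_einner (contK_id K) (contK_vcst K 0))))).
  have := green_scaled n1 hM (a := 0) (A := 1) (b := t) (B := 1) _ _ (harmd_cst _ 1) (pois_oball xixi).
  rewrite expr0n ltr01 (Kt t ht) => /(_ isT isT) g0.
  rewrite -[RHS](mulr0 t^-1) -[X in _ = _ * X]g0 -(pfZ pM t^-1 c); congr M; apply/funext => y.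
  by field; rewrite lt0r_neq0.
have E : phi 0 = phi rho.
  move: r0; rewrite le_eqVlt => /predU1P[<-//|r0]; apply: D_const => // [t /andP[t0 t1]|t /andP[t0 t1]].
    by apply: d0; rewrite t0 (lt_trans t1).
  by apply: is_derive_cont (d t _); rewrite t0 (le_lt_trans t1).
transitivity (phi rho); first by congr M; apply/funext => y; rewrite mulr1.
rewrite -E /phi -[RHS]M1; congr M; apply/funext => y.
by rewrite /pois /psi !scale0r pdistE !einnerE xixi !mulr0 !subr0 !add0r sqrtr1 invr1 expr1n !mulr1.
Unshelve. all: by end_near. Qed.

Section Rep.
Variables (r : R) (u : V -> R) (Gu : V -> V) (Wu : 'I_n -> V -> V) (B rho : R).
Hypotheses (r1 : 1 < r) (hu : harmd (oball r) u Gu Wu) (uB : forall x, oball r x -> `|u x| <= B).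
Hypotheses (rho0 : 0 < rho) (rho1 : rho < 1).

Let cu := let: And3 h _ _ := hu in h.
Let cu1 x (Ux : oball r x) : {for x, continuous u} := hasgrad_cont (cu Ux).1.
Let cu2 x (Ux : oball r x) : {for x, continuous Gu} := (cu Ux).2.
Let oUr := @oball_open R n r.
(** Interpolates between the Poisson integral, at s = 1, and the value u (rho xi), approached as s
    decreases to rho. *)
Let psif s := M (fun y => pois (rho / s *: y) xi * u (s *: y)).

Let sq1 s : rho < s <= 1 -> [/\ 0 < s, rho / s < 1, (rho / s) ^+ 2 < 1 & s ^+ 2 < r].
Proof.
move=> /andP[rs s1]; have s0 : 0 < s := lt_trans rho0 rs.
have h : rho / s < 1 by rewrite ltr_pdivrMr // mul1r.
split=> //; first by rewrite expr_lt1 // divr_ge0 // ltW.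
by apply: le_lt_trans r1; rewrite expr_le1 // ltW.
Qed.

(** The derivative in s is s^-1 times the Green expression of the kernel dilated by rho / s and u
    dilated by s. *)
Lemma psif_const s : rho < s <= 1 -> psif s = psif 1.
Proof.
move=> hs.
pose dpsi t := M (fun y => - rho / t ^+ 2 * einner y (poisG (rho / t *: y) xi) * u (t *: y) +
  pois (rho / t *: y) xi * (1 * einner y (Gu (t *: y)))).
have d (t : R) : rho < t <= 1 -> is_derive t (1 : R) psif (dpsi t).
  move=> ht; have [t0 rt rt2 t2] := sq1 ht.
  have nt : \forall z \near t, 0 < z := open_nbhs_nbhs (conj (@open_gt R 0) t0).
  have da (z : R) : 0 < z -> is_derive z (1 : R) (fun t => rho / t) (- rho / z ^+ 2).
    move=> z0; have h := D_mul (D_cst rho z) (D_inv (f := fun t => t) (lt0r_neq0 z0) (D_id z)).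
    apply: (D_eq h); ring.
  apply: (D_radial hM oU1 oUr cp cu (a := fun t => rho / t) (a' := fun t => - rho / t ^+ 2)
    (b := fun t => t) (b' := fun=> 1)).
  - by near=> z; apply: da; near: z.
  - by near=> z; exact: D_id.
  - near=> z; have z0 : z ^+ 2 != 0 by rewrite sqrf_eq0 lt0r_neq0 //; near: z.
    exact: is_derive_cont (D_mul (D_cst (- rho) z) (D_inv (f := fun t => t ^+ 2) z0 (D_pow 2 (D_id z)))).
  - by near=> z; exact: cst_continuous.
  - by apply: (near_sqr_lt (a := fun t => rho / t)) => //; exact: is_derive_cont (da t t0).
  - by apply: (near_sqr_lt (a := fun t => t)) => //; exact: cvg_id.
have d0 (t : R) : rho < t <= 1 -> is_derive t (1 : R) psif 0.
  move=> ht; have [t0 rt rt2 t2] := sq1 ht.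
  apply: D_eq (d t ht) _; rewrite /dpsi.
  have Ka y (Ky : K y) := oball_scale hM rt2 Ky; have Kb y (Ky : K y) := oball_scale hM t2 Ky.
  have c : contK K (fun y => pois (rho / t *: y) xi * (t * einner y (Gu (t *: y))) -
      u (t *: y) * (rho / t * einner y (poisG (rho / t *: y) xi))).
    have k1 := contK_at oU1 cp1 Ka; have k2 := contK_at oU1 cp2 Ka.
    have k3 := contK_at oUr cu1 Kb; have k4 := contK_at oUr cu2 Kb.
    exact: (contKB (contKM k1 (contKM (contK_cst K t) (contK_einner (contK_id K) k4)))
      (contKM k3 (contKM (contK_cst K (rho / t)) (contK_einner (contK_id K) k2)))).
  have g0 := green_scaled n1 hM rt2 t2 (pois_oball xixi) hu.
  rewrite -[RHS](mulr0 t^-1) -[X in _ = _ * X]g0 -(pfZ pM t^-1 c); congr M; apply/funext => y.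
  by field; rewrite lt0r_neq0.
move: hs => /andP[rs]; rewrite le_eqVlt => /predU1P[->//|s1].
apply: D_const => // t /andP[t0 t1].
  by apply: d0; rewrite (lt_trans rs t0) ltW.
by apply: is_derive_cont (d0 t _); rewrite (lt_le_trans rs t0).
Unshelve. all: by end_near. Qed.

(** As s decreases to rho, the kernel at rho / s y concentrates at xi and has total mass 1, so
    [psif s] tends to u (rho xi); but [psif] is constant. Concentration is checked by splitting at
    distance [d] from xi, so xi need not lie in [K]. *)
Lemma poisson_rep : u (rho *: xi) = M (fun y => pois (rho *: y) xi * u y).
Proof.
have -> : M (fun y => pois (rho *: y) xi * u y) = psif 1.
  by congr M; apply/funext => y; rewrite divr1 scale1r.
have Urx : oball r (rho *: xi).
  rewrite /oball /= !einnerE xixi mulr1 -expr2; apply: lt_trans r1.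
  by rewrite expr_lt1 // ltW.
have B0 : 0 <= B by apply: le_trans (uB Urx).
apply/eqP; rewrite -subr_eq0 -normr_le0; apply/ler_addgt0Pr => e e0; rewrite add0r.
have /cvgrPdist_lt /(_ (e / 2)) := cu1 Urx.
rewrite divr_gt0 // => /(_ isT) /nbhs_ballP[dl /= dl0 hdl].
pose d := dl / 2; have dd0 : 0 < d by rewrite divr_gt0.
(* Away from xi the values of u differ by at most 2 B, and the kernel is at most (1 - t^2) (2 /
   d)^n. *)
pose C := 2 * B * (2 / d) ^+ n.
have C0 : 0 <= C by rewrite !mulr_ge0 ?exprn_ge0 ?divr_ge0 // ltW.
pose t s := rho / s.
have ct : {for rho, continuous t}.
  have h := D_mul (D_cst rho rho) (D_inv (f := fun t => t) (lt0r_neq0 rho0) (D_id rho)).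
  exact: is_derive_cont h.
have t1 : t rho = 1 by rewrite /t divff // lt0r_neq0.
have ct2 : {for rho, continuous (fun s => C * (1 - t s ^+ 2))}.
  have k1 : {for rho, continuous (fun s => t s ^+ 2)}.
    by apply: (@continuous_comp _ _ _ t (fun t : R => t ^+ 2)); [exact: ct|exact: exprn_continuous].
  by apply: continuousM; [exact: cst_continuous|apply: continuousB; [exact: cst_continuous|exact: k1]].
have nr (P : set R) : nbhs rho P -> nbhs (rho^'+) P by move=> h; exact: cvg_within.
have [s [rs s1 sd st sC]] : exists s, [/\ rho < s, s <= 1, s - rho < d, 1 - t s < d / 2 & C * (1 - t s ^+ 2) < e / 2].
  near (rho^'+) => s; exists s; split.
  - by near: s; exact: nbhs_right_gt.
  - by near: s; exact: nbhs_right_le.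
  - by rewrite ltrBlDr; near: s; apply: nbhs_right_lt; rewrite ltrDr.
  - rewrite ltrBlDr -ltrBlDl; near: s; apply: nr.
    by apply: (ct [set z | 1 - d / 2 < z]); apply: open_nbhs_nbhs; split; [exact: open_gt|rewrite /= t1 ltrBlDr ltrDl divr_gt0].
  - near: s; apply: nr.
    apply: (ct2 [set z | z < e / 2]); apply: open_nbhs_nbhs; split; first exact: open_lt.
    by rewrite /= t1 expr1n subrr mulr0 divr_gt0.
have hs : rho < s <= 1 by rewrite rs.
have [s0 ts1 ts2 s2] := sq1 hs; rewrite -/(t s) in ts1 ts2.
have ts0 : 0 <= t s by rewrite divr_ge0 // ltW.
have Ka y (Ky : K y) := oball_scale hM ts2 Ky; have Kb y (Ky : K y) := oball_scale hM s2 Ky.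
have k1 := contK_at oU1 cp1 Ka; have k3 := contK_at oUr cu1 Kb.
have ku := contK_cst K (u (rho *: xi)).
rewrite -(psif_const hs) distrC /psif.
have -> : u (rho *: xi) = M (fun y => u (rho *: xi) * pois (t s *: y) xi).
  by rewrite (pfZ pM _ k1) mean_pois_radial ?mulr1 // ts0.
rewrite -(pfB pM (contKM k1 k3) (contKM ku k1)).
have kb := contKD (contKM (contK_cst K (e / 2)) k1) (contKM (contK_cst K (C * (1 - t s ^+ 2))) (contK_cst K 1)).
apply: le_trans (pf_abs_le pM (contKB (contKM k1 k3) (contKM ku k1)) kb _) _; last first.
  rewrite (pfD pM (contKM (contK_cst K (e / 2)) k1) (contKM (contK_cst K (C * (1 - t s ^+ 2))) (contK_cst K 1))).
  rewrite (pfZ pM _ k1) (pfZ pM _ (contK_cst K 1)) M1 mean_pois_radial ?ts0 // !mulr1.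
  by rewrite [leRHS]splitr lerD2l ltW.
move=> y Ky.
have p0 : 0 <= pois (t s *: y) xi by apply: pois_ge0 (Ka y Ky) xixi.
rewrite (mulrC (u _)) -mulrBr normrM (ger0_norm p0) mulr1.
have ny : `|y| <= 1 by rewrite -(enorm1 (KS Ky)) norm_le_enorm.
have nxi : `|xi| <= 1 by rewrite -(enorm1 xixi) norm_le_enorm.
have h2 : 0 <= C * (1 - t s ^+ 2) by rewrite mulr_ge0 // subr_ge0 ltW.
(* Near xi, continuity of u gives e / 2 times the kernel; far from it, the kernel itself is
   small. *)
have [near_|far] := ltP `|y - xi| d.
  apply: ler_wpDr => //; rewrite mulrC; apply: ler_wpM2r => //.
  rewrite distrC ltW //; apply: hdl; rewrite -ball_normE /= distrC.
  have -> : s *: y - rho *: xi = s *: (y - xi) + (s - rho) *: xi.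
    by rewrite scalerBr scalerBl addrA subrK.
  apply: le_lt_trans (ler_normD _ _) _; rewrite !normrZ (gtr0_norm s0) (gtr0_norm (_ : 0 < s - rho)) ?subr_gt0 //.
  have a1 : s * `|y - xi| < d by apply: le_lt_trans near_; rewrite ler_piMl.
  have a2 : (s - rho) * `|xi| < d by apply: le_lt_trans sd; rewrite ler_piMr // subr_ge0 ltW.
  by rewrite (splitr dl) ltrD.
apply: ler_wpDl; first by rewrite mulr_ge0 // ltW ?divr_gt0.
have hb : `|u (s *: y) - u (rho *: xi)| <= 2 * B.
  by apply: le_trans (ler_normB _ _) _; rewrite mulr2n mulrDl !mul1r lerD // uB //; exact: Kb.
have hp : pois (t s *: y) xi <= (1 - t s ^+ 2) * (2 / d) ^+ n.
  rewrite /pois !einnerE (KS Ky) mulr1 -expr2; apply: ler_wpM2l; first by rewrite subr_ge0 ltW.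
  have q0 : 0 < pdist (t s *: y) xi := pdist_gt0 (Ka y Ky) xixi.
  suff hh : psi (t s *: y) xi <= 2 / d.
    have p1 : 0 <= psi (t s *: y) xi := ltW (psi_gt0 q0).
    have p2 : 0 <= 2 / d := le_trans p1 hh.
    by move: hh; apply: lerXn2r; rewrite nnegrE.
  rewrite /psi -[2 / d]invrK lef_pV2 ?posrE ?sqrtr_gt0 ?invr_gt0 ?divr_gt0 // invf_div /pdist -enormE.
  apply: le_trans (norm_le_enorm _).
  (* Since |y - xi| is at least d and 1 - t is below d / 2, the dilated point stays at distance at
     least d / 2 from xi. *)
  have -> : t s *: y - xi = (y - xi) - (1 - t s) *: y by apply/rowP => i; rewrite !mxE; ring.
  apply: le_trans (lerB_normD _ _); rewrite normrN normrZ ger0_norm ?subr_ge0 ?(ltW ts1) //.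
  have : (1 - t s) * `|y| <= d / 2 by apply: le_trans (ltW st); rewrite ler_piMr // subr_ge0 ltW.
  by lra.
apply: le_trans (_ : (1 - t s ^+ 2) * (2 / d) ^+ n * (2 * B) <= _); first exact: ler_pM.
by rewrite /C le_eqVlt; apply/orP; left; apply/eqP; ring.
Unshelve. all: by end_near. Qed.

End Rep.
End Unit.
End PoissonFormula.

(** * The sharp directional constant as an average of the kernel *)

Section Extremal.
Context {R : realType} {n : nat}.
Local Notation V := 'rV[R]_n.
Implicit Types (x y w g l xi : V) (r s a b rho : R).
Variables (K : set V) (M : (V -> R) -> R).
Hypotheses (n1 : (1 < n)%N) (hM : mean K setT n M) (M1 : M (fun=> 1) = 1).
Let pM := mean_pf hM.
Let KS x : K x -> einner x x = 1 := mean_sphere hM (x := x).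

Section Rep.
Variable f : V -> R.
Hypothesis cf : contK K f.

Definition prep z := M (fun y => pois z y * f y).
Definition prepG z : V := \row_i M (fun y => (f y *: poisG z y) 0 i).
Definition prepW i z : V := \row_j M (fun y => (f y *: poisW i z y) 0 j).

Let Q0 x : oball 1 x -> forall p, sliceK x K p -> 0 < pdist p.1 p.2.
Proof. by move=> Ux [z y] [/= -> Ky]; exact: pdist_gt0 Ux (KS Ky). Qed.

Let cf2 x : contK (sliceK x K) (fun p : V * V => f p.2).
Proof. by apply: (contK_push (contK_snd _)); apply: contKS cf => _ [[z y] [/= _ Ky] <-]. Qed.

Let j0 x : oball 1 x -> jcont K (fun z y => pois z y * f y) x.
Proof. by move=> Ux; apply: jcontE; exact: (contKM (contK_pois (Q0 Ux)) (@cf2 x)). Qed.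
Let j1 x i : oball 1 x -> jcont K (fun z y => (f y *: poisG z y) 0 i) x.
Proof. by move=> Ux; apply: jcontE; exact: (contK_coord i (contK_vZ (@cf2 x) (contK_poisG (Q0 Ux)))). Qed.
Let j2 x i j : oball 1 x -> jcont K (fun z y => (f y *: poisW i z y) 0 j) x.
Proof. by move=> Ux; apply: jcontE; exact: (contK_coord j (contK_vZ (@cf2 x) (contK_poisW (Q0 Ux) i))). Qed.

Lemma prep_harmd : harmd (oball 1) prep prepG prepW.
Proof.
have nU x : oball 1 x -> \forall z \near x, oball 1 z.
  by move=> Ux; exact: open_nbhs_nbhs (conj (@oball_open R n 1) Ux).
have hp z y : oball 1 z -> K y -> hasgrad (fun z => pois z y * f y) z (f y *: poisG z y).
  move=> Uz Ky; have [h _ _] := pois_harmd (KS Ky); have [hz _] := h z (pdist_gt0 Uz (KS Ky)).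
  by apply: hasgrad_eq (hasgradM hz (hasgrad_cst (f y) z)) _; rewrite scaler0 add0r.
have hpG z y i : oball 1 z -> K y -> hasgrad (fun z => (f y *: poisG z y) 0 i) z (f y *: poisW i z y).
  move=> Uz Ky; have [_ h _] := pois_harmd (KS Ky); have [hz _] := h i z (pdist_gt0 Uz (KS Ky)).
  have -> : (fun z => (f y *: poisG z y) 0 i) = (fun z => f y * poisG z y 0 i) by apply/funext => t; rewrite mxE.
  by apply: hasgrad_eq (hasgradM (hasgrad_cst (f y) z) hz) _; rewrite scaler0 addr0.
split.
- move=> x Ux; split.
    apply: (pf_hasgrad pM (F := fun z y => pois z y * f y) (G := fun z y => f y *: poisG z y) (j0 Ux) (fun i => j1 i Ux)).
    by apply: filterS (nU x Ux) => z Uz y; exact: hp.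
  by apply: cont_row => i; exact: (pf_continuous1 pM (j1 i Ux)).
- move=> i x Ux.
  have -> : (fun z => prepG z 0 i) = (fun z => M (fun y => (f y *: poisG z y) 0 i)) by apply/funext => z; rewrite mxE.
  split.
    apply: (pf_hasgrad pM (F := fun z y => (f y *: poisG z y) 0 i) (G := fun z y => f y *: poisW i z y) (j1 i Ux) (fun j => j2 i j Ux)).
    by apply: filterS (nU x Ux) => z Uz y; exact: hpG.
  by apply: cont_row => j; exact: (pf_continuous1 pM (j2 i j Ux)).
- move=> x Ux; under eq_bigr do rewrite mxE.
  have ci i : contK K (fun y => (f y *: poisW i x y) 0 i) := jcont_contK (j2 i i Ux).
  rewrite -[LHS](pf_sum pM _ ci) -[RHS](pf0 pM).
  apply: (pf_ext pM (contK_sum _ ci) (contK_cst K 0)) => y Ky.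
  have [_ _ h] := pois_harmd (KS Ky); have := h x (pdist_gt0 Ux (KS Ky)) => hs.
  by under eq_bigr do rewrite mxE; rewrite -mulr_sumr hs mulr0.
Qed.

Lemma prep_grad x l : oball 1 x -> einner l (prepG x) = M (fun y => einner l (poisG x y) * f y).
Proof.
move=> Ux; rewrite /prepG (pf_einner pM (H := fun y => f y *: poisG x y) l (fun i => jcont_contK (j1 i Ux))).
by congr M; apply/funext => y; rewrite einnerZr mulrC.
Qed.

Lemma prep_contK x : oball 1 x -> contK K (fun y => pois x y * f y).
Proof. by move=> Ux; exact: jcont_contK (j0 Ux). Qed.

End Rep.

Lemma contK_poisG_at x l : oball 1 x -> contK K (fun y => einner l (poisG x y)).
Proof.
move=> Ux; have Q0 p : sliceK x K p -> 0 < pdist p.1 p.2.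
  by case: p => z y [/= -> Ky]; exact: pdist_gt0 Ux (KS Ky).
apply: (@jcont_contK R V V K (fun z y => einner l (poisG z y)) x); apply: jcontE.
exact: (contK_einner (contK_vcst _ l) (contK_poisG Q0)).
Qed.

Lemma contK_pois_at x : oball 1 x -> contK K (pois x).
Proof.
move=> Ux; have := prep_contK (contK_cst K 1) Ux.
by congr contK; apply/funext => y; rewrite mulr1.
Qed.

(** Symmetry of the kernel in two unit vectors moves the average from the pole to the harmonic
    variable, where [mean_pois_radial] applies. *)
Lemma mean_pois x : oball 1 x -> M (pois x) = 1.
Proof.
move=> Ux; have [rho [xi [r0 rr xx E]]] := polar n1 x.
have r1 : rho < 1.
  by move: Ux; rewrite /oball /= -rr expr_lt1.
rewrite -(mean_pois_radial n1 hM M1 xx (rho := rho)) ?r0 //.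
have Ka y (Ky : K y) : oball 1 (rho *: y) by apply: (oball_scale hM) => //; rewrite expr_lt1.
have ck : contK K (fun y => pois (rho *: y) xi).
  apply: (contK_at (U := oball 1) (h := pois^~ xi)) Ka; first exact: oball_open.
  by move=> z Uz; have [h _ _] := pois_harmd xx; have [/hasgrad_cont] := h z (pdist_gt0 Uz xx).
by apply: (pf_ext pM (contK_pois_at Ux) ck) => y Ky; rewrite E pois_symm // KS.
Qed.

(** Near x the function agrees with the Poisson integral of its boundary values, so the gradients
    agree. The condition on x keeps a neighbourhood away from 0, as [poisson_rep] is stated for
    positive radius. *)
Lemma grad_rep r u Gu Wu B x l : 1 < r -> harmd (oball r) u Gu Wu -> (forall z, oball r z -> `|u z| <= B) ->
  oball 1 x -> x != 0 -> einner l (Gu x) = M (fun y => einner l (poisG x y) * u y).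
Proof.
move=> r1 hu uB Ux x0.
have [cu _ _] := hu.
have KU : K `<=` oball r by move=> y /KS yy; rewrite /oball /= yy.
have cuK : contK K u := c1_contK (@oball_open R n r) KU cu.
have Ur (z : V) : oball 1 z -> oball r z by rewrite /oball /= => /lt_trans; apply.
rewrite -(prep_grad cuK l Ux); congr (einner l _).
have [hx _] := cu x (Ur x Ux).
have [h1 _ _] := prep_harmd cuK; have [hp _] := h1 x Ux.
rewrite -(hasgrad_grad hp); symmetry; apply: hasgrad_grad; apply: hasgrad_near hx.
have ce : {for x, continuous (fun z : V => einner z z)} by apply: cont_einner; exact: cvg_id.
have n0 : \forall z \near x, 0 < einner z z.
  apply: (ce [set t | 0 < t]); apply: open_nbhs_nbhs; split; first exact: open_gt.
  by rewrite /= lt_neqAle einner_ge0 eq_sym einner_eq0 x0.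
have nU : \forall z \near x, oball 1 z := open_nbhs_nbhs (conj (@oball_open R n 1) Ux).
near=> z; have z0 : z != 0 by rewrite -einner_eq0 gt_eqF //; near: z.
have Uz : oball 1 z by near: z.
have [rho [xi [r0 rr xx E]]] := polar n1 z.
have rho1 : rho < 1 by move: Uz; rewrite /oball /= -rr expr_lt1.
have rho0 : 0 < rho.
  rewrite lt_neqAle r0 andbT eq_sym; apply: contra z0 => /eqP h.
  by rewrite E h scale0r.
rewrite E (poisson_rep n1 hM M1 xx r1 hu uB rho0 rho1) /prep -E.
have Ka y (Ky : K y) : oball 1 (rho *: y) by apply: (oball_scale hM) => //; rewrite expr_lt1.
have ck : contK K (fun y => pois (rho *: y) xi).
  apply: (contK_at (U := oball 1) (h := pois^~ xi)) Ka; first exact: oball_open.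
  by move=> t Ut; have [h _ _] := pois_harmd xx; have [/hasgrad_cont] := h t (pdist_gt0 Ut xx).
apply: (pf_ext pM (contKM ck cuK) (prep_contK cuK Uz)) => y Ky.
by rewrite E (pois_symm rho xx (KS Ky)).
Unshelve. all: by end_near. Qed.

(** A bounded harmonic function may have no continuous boundary values; its dilation by r < 1 is
    harmonic across the sphere, satisfies the bound by [grad_rep], and r tends to 1. *)
Lemma grad_upper u B x l : harmonic_on_ball u -> (forall z, unit_ball z -> `|u z| <= B) ->
  oball 1 x -> x != 0 -> `|einner l (grad u x)| <= M (fun y => `|einner l (poisG x y)|) * B.
Proof.
move=> /harmonic_harmd hu uB Ux x0; have [cu _ _] := hu.
have ckl := contK_poisG_at l Ux.
have step r : 0 < r -> r < 1 -> `|einner l (r *: grad u (r *: x))| <= M (fun y => `|einner l (poisG x y)|) * B.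
  move=> r0 r1.
  have ri : 1 < r ^- 2 by rewrite invf_gt1 ?exprn_gt0 // expr_lt1 // ltW.
  have sub : (oball (r ^- 2) : set V) `<=` [set z | oball 1 (r *: z)].
    by move=> z; rewrite /oball /= !einnerE mulrA -expr2 -(ltr_pdivlMl _ _ (exprn_gt0 2 r0)) mulr1.
  have h := harmdS sub (harmd_scale r hu).
  have hB z : oball (r ^- 2) z -> `|u (r *: z)| <= B by move=> /sub Uz; apply: uB; rewrite unit_ballE.
  rewrite (grad_rep l ri h hB Ux x0) mulrC -(pfZ pM B (contK_norm ckl)).
  have [ch _ _] := h.
  have KU : K `<=` oball (r ^- 2) by move=> y /KS yy; rewrite /oball /= yy.
  have cuK := c1_contK (@oball_open R n (r ^- 2)) KU ch.
  apply: (pf_abs_le pM (contKM ckl cuK) (contKM (contK_cst K B) (contK_norm ckl))) => y Ky.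
  by rewrite normrM mulrC ler_wpM2r // hB //; exact: KU.
apply/ler_addgt0Pr => e e0.
have cr : {for (1 : R), continuous (fun r => einner l (r *: grad u (r *: x)))}.
  apply: cont_einner; first exact: cst_continuous.
  apply: (@continuousZ _ _ _ (fun r => r)); first exact: cvg_id.
  apply: (@continuous_comp _ _ _ (fun r : R => r *: x) (grad u)); first exact: (@scalel_continuous _ _ x).
  by have [_] := cu x Ux; rewrite scale1r.
have nr (P : set R) : nbhs (1 : R) P -> nbhs ((1 : R)^'-) P by move=> h; exact: cvg_within.
have [r [r0 r1 hr]] : exists r, [/\ 0 < r, r < 1 & `|einner l (grad u x) - einner l (r *: grad u (r *: x))| < e].
  near ((1 : R)^'-) => r; exists r; split.
  - by near: r; apply: nbhs_left_gt; exact: ltr01.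
  - by near: r; exact: nbhs_left_lt.
  - near: r; apply: nr; move/cvgrPdist_lt : cr => /(_ e e0).
    by rewrite !scale1r.
rewrite -(subrK (einner l (r *: grad u (r *: x))) (einner l (grad u x))).
by rewrite addrC (le_trans (ler_normD _ _)) // lerD ?step // ltW.
Unshelve. all: by end_near. Qed.

Lemma supnorm_ub (u : V -> R) z : hinf u -> unit_ball z -> `|u z| <= supnorm u.
Proof.
move=> [_ [B hB]] Uz; apply: sup_upper_bound; last by exists z.
by split; [exists `|u z|, z|exists B => _ [t Ut <-]; exact: hB].
Qed.

Lemma unit_ball0 : unit_ball (0 : V).
Proof. by rewrite /unit_ball /= enorm0. Qed.

Lemma supnorm_le (u : V -> R) B : (forall z, unit_ball z -> `|u z| <= B) -> supnorm u <= B.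
Proof.
move=> hB; apply: sup_le_ub; last by move=> _ [t Ut <-]; exact: hB.
by exists `|u 0|, 0 => //; exact: unit_ball0.
Qed.

(** Test the constant c on the Poisson integral of a continuous approximation of the sign of the
    kernel; its values stay within [-1, 1] because the Poisson kernel is nonnegative with mass 1. *)
Lemma grad_lower c x l : oball 1 x -> (forall u, hinf u -> `|einner (grad u x) l| <= c * supnorm u) ->
  M (fun y => `|einner l (poisG x y)|) <= c.
Proof.
move=> Ux hc.
have harm_hinf (u : V -> R) G W B : harmd (oball 1) u G W -> (forall z, unit_ball z -> `|u z| <= B) -> hinf u.
  by move=> hu hB; split; [exact: harmd_harmonic hu|exists B].
have c0 : 0 <= c.
  have h1 : hinf (fun _ : V => 1 : R).
    by apply: (harm_hinf _ _ _ 1 (harmd_cst _ 1)) => z _; rewrite normr1.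
  have s1 : supnorm (fun _ : V => 1 : R) = 1.
    apply/eqP; rewrite eq_le supnorm_le => [|z _]; last by rewrite normr1.
    by have := supnorm_ub h1 unit_ball0; rewrite normr1.
  by have := hc _ h1; rewrite s1 mulr1; apply: le_trans.
have ck := contK_poisG_at l Ux.
apply/ler_addgt0Pr => e e0.
pose k y := einner l (poisG x y).
(* A smoothed sign of [k]: it is bounded by 1, and k f is at least |k| - e. *)
pose f y := k y / Num.sqrt (k y ^+ 2 + e ^+ 2).
have q0 y : 0 < k y ^+ 2 + e ^+ 2 by rewrite ltr_wpDl ?sqr_ge0 // exprn_gt0.
have sq0 y : 0 < Num.sqrt (k y ^+ 2 + e ^+ 2) by rewrite sqrtr_gt0.
have kle y : `|k y| <= Num.sqrt (k y ^+ 2 + e ^+ 2).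
  by rewrite -(sqrtr_sqr (k y)) ler_wsqrtr // lerDl sqr_ge0.
have cf : contK K f.
  apply: (contK_comp (h := fun t => t / Num.sqrt (t ^+ 2 + e ^+ 2))) ck => t.
  have h0 : 0 < t ^+ 2 + e ^+ 2 by rewrite ltr_wpDl ?sqr_ge0 // exprn_gt0.
  have s0 : Num.sqrt (t ^+ 2 + e ^+ 2) != 0 by rewrite lt0r_neq0 // sqrtr_gt0.
  have d := D_mul (D_id t) (D_inv (f := fun t => Num.sqrt (t ^+ 2 + e ^+ 2)) s0
    (D_sqrt (f := fun t => t ^+ 2 + e ^+ 2) h0 (D_add (D_pow 2 (D_id t)) (D_cst (e ^+ 2) t)))).
  exact: is_derive_cont d.
have f1 y : `|f y| <= 1.
  by rewrite /f normrM normfV (gtr0_norm (sq0 y)) ler_pdivrMr // mul1r.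
have hv := prep_harmd cf.
have v1 z : unit_ball z -> `|prep f z| <= 1.
  rewrite unit_ballE => Uz; rewrite -(mean_pois Uz).
  apply: (pf_abs_le pM (prep_contK cf Uz) (contK_pois_at Uz)) => y Ky.
  by rewrite normrM (ger0_norm (pois_ge0 Uz (KS Ky))) ler_piMr // pois_ge0 // KS.
have := hc _ (harm_hinf _ _ _ 1 hv v1).
have [h1 _ _] := hv; have [hx _] := h1 x Ux.
rewrite (hasgrad_grad hx) einnerC (prep_grad cf l Ux) => hle.
have {}hle : M (fun y => k y * f y) <= c.
  apply: le_trans (ler_norm _) _; apply: le_trans hle _.
  by rewrite ler_piMr // supnorm_le.
apply: le_trans (_ : M (fun y => k y * f y + e * 1) <= _); last first.
  by rewrite (pfD pM (contKM ck cf) (contKM (contK_cst K e) (contK_cst K 1))) (pfZ pM _ (contK_cst K 1)) M1 mulr1 lerD2r.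
apply: (pf_le pM (contK_norm ck) (contKD (contKM ck cf) (contKM (contK_cst K e) (contK_cst K 1)))) => y Ky.
rewrite mulr1 /f mulrA -expr2 -/(k y).
have := sq0 y; have := kle y; have : Num.sqrt (k y ^+ 2 + e ^+ 2) ^+ 2 = k y ^+ 2 + e ^+ 2 by rewrite sqr_sqrtr // ltW.
have := normr_ge0 (k y); rewrite -(real_normK (num_real (k y))).
move: (`|k y|) => t; move: (Num.sqrt _) => q t0 qq tq qq0.
(* With q^2 = t^2 + e^2 the claim is t (q - t) <= e q, true since t <= q and q - t <= e. *)
rewrite -lerBlDr ler_pdivlMr //; nra.
Qed.

End Extremal.

(** * Differentiating a family of elliptic-type integrals in its parameter *)

Section ParamIntegral.
Context {R : realType}.
Variables (j : nat) (a G H1 H2 a' G' H1' H2' : R -> R).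

(** The shape of the integrand after the substitution in [J_sub]: a polynomial in sin^2 w with
    coefficients depending on q, over sqrt (1 + a sin^2 w), weighted by cos^j w; [pF'] is its
    derivative in q. *)
Definition pz q w := (Num.sqrt (1 + a q * sin w ^+ 2))^-1.
Definition pB q w := G q + H1 q * sin w ^+ 2 + H2 q * (sin w ^+ 2) ^+ 2.
Definition pF q w := cos w ^+ j * (pB q w * pz q w).
Definition pF' q w := cos w ^+ j * ((G' q + H1' q * sin w ^+ 2 + H2' q * (sin w ^+ 2) ^+ 2) * pz q w
  - pB q w * (a' q * sin w ^+ 2 / 2 * pz q w ^+ 3)).

Lemma pz_arg_gt0 q w : 0 <= a q -> 0 < 1 + a q * sin w ^+ 2.
Proof. by move=> a0; rewrite ltr_wpDr // mulr_ge0 // sqr_ge0. Qed.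

Lemma D_param (q : R) : (\forall t \near q, is_derive t (1 : R) a (a' t)) -> (\forall t \near q, is_derive t (1 : R) G (G' t)) ->
  (\forall t \near q, is_derive t (1 : R) H1 (H1' t)) -> (\forall t \near q, is_derive t (1 : R) H2 (H2' t)) ->
  (\forall t \near q, {for t, continuous a'}) -> (\forall t \near q, {for t, continuous G'}) ->
  (\forall t \near q, {for t, continuous H1'}) -> (\forall t \near q, {for t, continuous H2'}) ->
  (\forall t \near q, 0 <= a t) ->
  is_derive q (1 : R) (fun q => integ 0 (pi / 2) (pF q)) (integ 0 (pi / 2) (pF' q)).
Proof.
move=> da dG dH1 dH2 ca' cG' cH1' cH2' a0.
set K : set R := `[0, pi / 2]%classic.
have cv (e e' : R -> R) (t : R) : (\forall s \near t, is_derive s (1 : R) e (e' s)) -> \forall s \near t, {for s, continuous e}.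
  by apply: filterS => s; exact: is_derive_cont.
have cX (t : R) : contK (sliceK t K) (fun p : R * R => sin p.2 ^+ 2) := contK_pow 2 (@contK_sndfun R K sin t (@continuous_sin R)).
have cC (t : R) : contK (sliceK t K) (fun p : R * R => cos p.2 ^+ j) := contK_pow j (@contK_sndfun R K cos t (@continuous_cos R)).
have cp (t : R) (e e1 e2 : R -> R) : (\forall s \near t, {for s, continuous e}) -> (\forall s \near t, {for s, continuous e1}) ->
    (\forall s \near t, {for s, continuous e2}) ->
    contK (sliceK t K) (fun p : R * R => e p.1 + e1 p.1 * sin p.2 ^+ 2 + e2 p.1 * (sin p.2 ^+ 2) ^+ 2).
  move=> c0 c1 c2; exact: (contKD (contKD (@contK_fstfun R R K _ _ c0) (contKM (@contK_fstfun R R K _ _ c1) (cX t)))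
    (contKM (@contK_fstfun R R K _ _ c2) (contK_pow 2 (cX t)))).
have cz (t : R) : (\forall s \near t, {for s, continuous a}) -> 0 <= a t -> contK (sliceK t K) (fun p : R * R => pz p.1 p.2).
  move=> c0 at0; apply: (contK_sqrtV (contKD (contK_cst _ 1) (contKM (@contK_fstfun R R K _ _ c0) (cX t)))).
  by move=> [z w] [/= -> _]; exact: pz_arg_gt0.
apply: (pf_derive (F := pF) (F' := pF') (integ_posfun 0 (pi / 2))).
- have Da := near_join da; have DG := near_join dG; have DH1 := near_join dH1; have DH2 := near_join dH2.
  near=> t; apply: (@jcont_contK R _ _ K pF t); apply: jcontE.
  have na : \forall s \near t, is_derive s (1 : R) a (a' s) by near: t.
  have nG : \forall s \near t, is_derive s (1 : R) G (G' s) by near: t.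
  have nH1 : \forall s \near t, is_derive s (1 : R) H1 (H1' s) by near: t.
  have nH2 : \forall s \near t, is_derive s (1 : R) H2 (H2' s) by near: t.
  have n0 : 0 <= a t by near: t.
  exact: (contKM (cC t) (contKM (cp _ _ _ _ (cv _ _ _ nG) (cv _ _ _ nH1) (cv _ _ _ nH2)) (cz _ (cv _ _ _ na) n0))).
- apply: jcontE; have n0 := nbhs_singleton a0.
  have z0 := cz _ (cv _ _ _ da) n0.
  exact: (contKM (cC q) (contKB (contKM (cp _ _ _ _ cG' cH1' cH2') z0)
    (contKM (cp _ _ _ _ (cv _ _ _ dG) (cv _ _ _ dH1) (cv _ _ _ dH2))
      (contKM (contKM (contKM (@contK_fstfun R R K _ _ ca') (cX q)) (contK_cst _ 2^-1)) (contK_pow 3 z0))))).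
- near=> t => w _.
  have na : is_derive t (1 : R) a (a' t) by near: t.
  have nG : is_derive t (1 : R) G (G' t) by near: t.
  have nH1 : is_derive t (1 : R) H1 (H1' t) by near: t.
  have nH2 : is_derive t (1 : R) H2 (H2' t) by near: t.
  have n0 : 0 <= a t by near: t.
  have r0 := pz_arg_gt0 w n0.
  have s0 : Num.sqrt (1 + a t * sin w ^+ 2) != 0 by rewrite lt0r_neq0 // sqrtr_gt0.
  pose X := sin w ^+ 2.
  have dz := D_inv (f := fun t => Num.sqrt (1 + a t * X)) s0
    (D_sqrt (f := fun t => 1 + a t * X) r0 (D_add (D_cst 1 t) (D_mul na (D_cst X t)))).
  have dB := D_add (D_add nG (D_mul nH1 (D_cst X t))) (D_mul nH2 (D_cst (X ^+ 2) t)).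
  have h := D_mul (D_cst (cos w ^+ j) t) (D_mul dB dz).
  apply: (D_eq h); rewrite /pF' /pB /pz -/X.
  by move: (Num.sqrt _) s0 => r rr0; field.
Unshelve. all: by end_near. Qed.

End ParamIntegral.

(** * The function Phi and its derivative *)

Section Monotone.
Context {R : realType}.
Variables (j : nat) (gam : R).
Hypothesis gam0 : 0 < gam.

(** [dfun q] is the root d in (0, 1) of d / (1 - d^2) = gam q / (1 - q^2), in a form of the
    quadratic formula without cancellation. Fixing gam amounts to fixing the ratio of the two
    arguments of [Jint]. *)
Definition dsig (q : R) := gam * q / (1 - q ^+ 2).
Definition dfun (q : R) := 2 * dsig q / (1 + Num.sqrt (1 + 4 * dsig q ^+ 2)).

Lemma dfun_bounds q : 0 < q < 1 -> 0 < dfun q < 1.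
Proof.
move=> /andP[q0 q1].
have s0 : 0 < dsig q by rewrite divr_gt0 ?mulr_gt0 // subr_gt0 expr_lt1 // ltW.
have h0 : 0 < 1 + 4 * dsig q ^+ 2 by rewrite ltr_wpDr // mulr_ge0 // sqr_ge0.
have r0 : 2 * dsig q < Num.sqrt (1 + 4 * dsig q ^+ 2).
  have -> : 2 * dsig q = Num.sqrt (4 * dsig q ^+ 2).
    have -> : 4 * dsig q ^+ 2 = (2 * dsig q) ^+ 2 by ring.
    by rewrite sqrtr_sqr ger0_norm // mulr_ge0 // ltW.
  by rewrite ltr_sqrt // ltrDr.
have r1 : 0 < 1 + Num.sqrt (1 + 4 * dsig q ^+ 2) by rewrite ltr_wpDr // sqrtr_ge0.
apply/andP; split; first by rewrite /dfun divr_gt0 // mulr_gt0.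
by rewrite /dfun ltr_pdivrMr // mul1r (lt_trans r0) // ltrDr.
Qed.

Lemma dfunE q : 0 < q < 1 -> dfun q / (1 - dfun q ^+ 2) = dsig q.
Proof.
move=> q01; have /andP[d0 d1] := dfun_bounds q01.
have h0 : 0 < 1 + 4 * dsig q ^+ 2 by rewrite ltr_wpDr // mulr_ge0 // sqr_ge0.
have rr : Num.sqrt (1 + 4 * dsig q ^+ 2) ^+ 2 = 1 + 4 * dsig q ^+ 2 by rewrite sqr_sqrtr // ltW.
have r0 : 0 <= Num.sqrt (1 + 4 * dsig q ^+ 2) by exact: sqrtr_ge0.
have d20 : 1 - dfun q ^+ 2 != 0 by rewrite lt0r_neq0 // subr_gt0 expr_lt1 // ltW.
apply: (mulIf d20); rewrite divfK //.
move: d20; rewrite /dfun; move: (dsig q) (Num.sqrt _) rr r0 => s r rr r0 d20.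
have r1 : 1 + r != 0 by rewrite lt0r_neq0 // ltr_wpDr.
apply/eqP; rewrite -subr_eq0; apply/eqP.
transitivity (s * (1 + 4 * s ^+ 2 - r ^+ 2) / (1 + r) ^+ 2); first by field.
by rewrite rr subrr mulr0 mul0r.
Qed.

(** Logarithmic differentiation of the relation in [dfunE]. *)
Definition ddfun (q : R) :=
  dfun q * (1 - dfun q ^+ 2) * (1 + q ^+ 2) / (q * (1 - q ^+ 2) * (1 + dfun q ^+ 2)).

Lemma D_dfun (q : R) : 0 < q < 1 -> is_derive q (1 : R) dfun (ddfun q).
Proof.
move=> q01; have /andP[q0 q1] := q01; have /andP[d0 d1] := dfun_bounds q01.
have q2 : 1 - q ^+ 2 != 0 by rewrite lt0r_neq0 // subr_gt0 expr_lt1 // ltW.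
have h0 : 0 < 1 + 4 * dsig q ^+ 2 by rewrite ltr_wpDr // mulr_ge0 // sqr_ge0.
have r0 : 0 < Num.sqrt (1 + 4 * dsig q ^+ 2) by rewrite sqrtr_gt0.
have r1 : 1 + Num.sqrt (1 + 4 * dsig q ^+ 2) != 0 by rewrite lt0r_neq0 // ltr_wpDr // ltW.
have ds := D_mul (D_mul (D_cst gam q) (D_id q))
  (D_inv (f := fun t => 1 - t ^+ 2) q2 (D_sub (D_cst 1 q) (D_pow 2 (D_id q)))).
have h := D_mul (D_mul (D_cst 2 q) ds) (D_inv (f := fun t => 1 + Num.sqrt (1 + 4 * dsig t ^+ 2)) r1
  (D_add (D_cst 1 q) (D_sqrt (f := fun t => 1 + 4 * dsig t ^+ 2) h0
    (D_add (D_cst 1 q) (D_mul (D_cst 4 q) (D_pow 2 ds)))))).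
apply: (D_eq h); rewrite /ddfun.
have dE := dfunE q01.
have d2 : 1 - dfun q ^+ 2 != 0 by rewrite lt0r_neq0 // subr_gt0 expr_lt1 // ltW.
have d2' : 1 + dfun q ^+ 2 != 0 by rewrite lt0r_neq0 // ltr_wpDr // sqr_ge0.
have d20 : 0 < 1 - dfun q ^+ 2 by rewrite subr_gt0 expr_lt1 // ltW.
have rE : Num.sqrt (1 + 4 * dsig q ^+ 2) = (1 + dfun q ^+ 2) / (1 - dfun q ^+ 2).
  have -> : 1 + 4 * dsig q ^+ 2 = ((1 + dfun q ^+ 2) / (1 - dfun q ^+ 2)) ^+ 2 by rewrite -dE; field.
  by rewrite sqrtr_sqr ger0_norm // divr_ge0 ?(ltW d20) // addr_ge0 // sqr_ge0.
have gE : gam = dfun q / (1 - dfun q ^+ 2) * (1 - q ^+ 2) / q.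
  by rewrite dE /dsig; field; rewrite q2 lt0r_neq0.
rewrite rE -/(dsig q) -dE gE; move: d0 d1 d2 d2' => /lt0r_neq0.
move: (dfun q) => d d0 d1 d2 d2'; have q0' := lt0r_neq0 q0.
field; rewrite d2 d2' q0' q2 /=.
have -> : 1 - d ^+ 2 + (1 + d ^+ 2) = 2 by ring.
by rewrite pnatr_eq0.
Qed.

(** These are the coefficients and the prefactor that [J_sub] produces, with d = dfun q and m = q d;
    the names starting with [d] are the derivatives. *)
Definition mfun (q : R) := q * dfun q.
Definition afun (q : R) := q ^+ 2 / (1 - q ^+ 2).
Definition Gfun (q : R) := dfun q ^+ 2 * (1 - q ^+ 2).
Definition H1fun (q : R) := (1 - mfun q) * (1 - 3 * mfun q).
Definition H2fun (q : R) := 2 * afun q * (1 - mfun q) ^+ 2.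
Definition dmfun (q : R) := dfun q + q * ddfun q.
Definition dafun (q : R) := 2 * q / (1 - q ^+ 2) ^+ 2.
Definition dGfun (q : R) := 2 * dfun q * ddfun q * (1 - q ^+ 2) - 2 * q * dfun q ^+ 2.
Definition dH1fun (q : R) := (6 * mfun q - 4) * dmfun q.
Definition dH2fun (q : R) := 2 * dafun q * (1 - mfun q) ^+ 2 - 4 * afun q * (1 - mfun q) * dmfun q.
Definition tau (q : R) := Num.sqrt (1 - mfun q ^+ 2).
Definition del (q : R) := Num.sqrt (1 - dfun q ^+ 2).
Definition pref (q : R) := 2 * tau q ^+ j.+1 * (del q)^-1 ^+ j.+2 * (1 - mfun q)^-1.
Definition dpref (q : R) := pref q * (- (j.+1%:R * mfun q * dmfun q / tau q ^+ 2) +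
  j.+2%:R * dfun q * ddfun q / del q ^+ 2 + dmfun q / (1 - mfun q)).

Lemma q_facts (q : R) : 0 < q < 1 -> [/\ 0 < 1 - q ^+ 2, 0 < 1 - dfun q ^+ 2, 0 < mfun q & 0 < 1 - mfun q].
Proof.
move=> q01; have /andP[d0 d1] := dfun_bounds q01; have /andP[q0 q1] := q01.
split; rewrite ?subr_gt0 ?expr_lt1 ?(ltW q0) ?(ltW d0) //; first by rewrite /mfun mulr_gt0.
by rewrite /mfun mulr_ilt1 // ltW.
Qed.

Lemma tau_sqr (q : R) : 0 < q < 1 -> 0 < tau q /\ tau q ^+ 2 = 1 - mfun q ^+ 2.
Proof.
move=> /q_facts[_ _ m0 m1]; have h : 0 < 1 - mfun q ^+ 2.
  by rewrite subr_gt0 expr_lt1 ?(ltW m0) // -subr_gt0.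
by rewrite /tau sqrtr_gt0 sqr_sqrtr // ltW.
Qed.

Lemma del_sqr (q : R) : 0 < q < 1 -> 0 < del q /\ del q ^+ 2 = 1 - dfun q ^+ 2.
Proof. by move=> /q_facts[_ h _ _]; rewrite /del sqrtr_gt0 sqr_sqrtr // ltW. Qed.

Lemma D_mfun (q : R) : 0 < q < 1 -> is_derive q (1 : R) mfun (dmfun q).
Proof. by move=> q01; have h := D_mul (D_id q) (D_dfun q01); apply: (D_eq h); rewrite mul1r. Qed.

Lemma D_afun (q : R) : 0 < q < 1 -> is_derive q (1 : R) afun (dafun q).
Proof.
move=> q01; have [q2 _ _ _] := q_facts q01; have q20 := lt0r_neq0 q2.
have h := D_mul (D_pow 2 (D_id q)) (D_inv (f := fun t => 1 - t ^+ 2) q20 (D_sub (D_cst 1 q) (D_pow 2 (D_id q)))).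
by apply: (D_eq h); rewrite /dafun; field.
Qed.

Lemma D_Gfun (q : R) : 0 < q < 1 -> is_derive q (1 : R) Gfun (dGfun q).
Proof.
move=> q01; have h := D_mul (D_pow 2 (D_dfun q01)) (D_sub (D_cst 1 q) (D_pow 2 (D_id q))).
by apply: (D_eq h); rewrite /dGfun; ring.
Qed.

Lemma D_H1fun (q : R) : 0 < q < 1 -> is_derive q (1 : R) H1fun (dH1fun q).
Proof.
move=> q01; have hm := D_mfun q01.
have h := D_mul (D_sub (D_cst 1 q) hm) (D_sub (D_cst 1 q) (D_mul (D_cst 3 q) hm)).
by apply: (D_eq h); rewrite /dH1fun; ring.
Qed.

Lemma D_H2fun (q : R) : 0 < q < 1 -> is_derive q (1 : R) H2fun (dH2fun q).
Proof.
move=> q01; have hm := D_mfun q01.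
have h := D_mul (D_mul (D_cst 2 q) (D_afun q01)) (D_pow 2 (D_sub (D_cst 1 q) hm)).
by apply: (D_eq h); rewrite /dH2fun; ring.
Qed.

Lemma D_pref (q : R) : 0 < q < 1 -> is_derive q (1 : R) pref (dpref q).
Proof.
move=> q01; have [q2 d2 m0 m1] := q_facts q01; have hm := D_mfun q01; have hd := D_dfun q01.
have [t0 tE] := tau_sqr q01; have [l0 lE] := del_sqr q01.
have tm : 0 < 1 - mfun q ^+ 2 by rewrite -tE exprn_gt0.
have dt := D_sqrt (f := fun t => 1 - mfun t ^+ 2) tm (D_sub (D_cst 1 q) (D_pow 2 hm)).
have dl := D_sqrt (f := fun t => 1 - dfun t ^+ 2) d2 (D_sub (D_cst 1 q) (D_pow 2 hd)).
have h := D_mul (D_mul (D_mul (D_cst 2 q) (D_pow j.+1 dt)) (D_pow j.+2 (D_inv (f := del) (lt0r_neq0 l0) dl)))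
  (D_inv (f := fun t => 1 - mfun t) (lt0r_neq0 m1) (D_sub (D_cst 1 q) hm)).
apply: (D_eq h); rewrite /dpref /pref -/(tau q) -/(del q) /=.
rewrite (exprS _ j.+1) (exprS (tau q) j).
move: t0 l0 m1 => /lt0r_neq0 + /lt0r_neq0 + /lt0r_neq0.
move: (tau q) (del q) (mfun q) (dfun q) (dmfun q) (ddfun q) => t l m d m' d' t0 l0 m1.
move: (t ^+ j) (l^-1 ^+ j.+1) => tj lj.
by field; rewrite m1 l0 t0.
Qed.

Lemma near01 (q : R) : 0 < q < 1 -> \forall t \near q, 0 < t < 1.
Proof.
move=> q01; have q01' : q \in `]0, 1[ by rewrite in_itv.
by apply: filterS (near_in_itvoo q01') => t; rewrite in_itv.
Qed.

Lemma cont_ddfun (q : R) : 0 < q < 1 -> {for q, continuous ddfun}.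
Proof.
move=> q01; have /andP[q0 q1] := q01; have [q2 d2 m0 m1] := q_facts q01; have hd := D_dfun q01.
have n0 : q * (1 - q ^+ 2) * (1 + dfun q ^+ 2) != 0.
  by rewrite !mulf_neq0 ?lt0r_neq0 // ltr_wpDr // sqr_ge0.
have hd2 := D_pow 2 hd; have hq2 := D_pow 2 (D_id q).
have h := D_mul (D_mul (D_mul hd (D_sub (D_cst 1 q) hd2)) (D_add (D_cst 1 q) hq2))
  (D_inv (f := fun q => q * (1 - q ^+ 2) * (1 + dfun q ^+ 2)) n0
    (D_mul (D_mul (D_id q) (D_sub (D_cst 1 q) hq2)) (D_add (D_cst 1 q) hd2))).
exact: is_derive_cont h.
Qed.

Definition Phi (q : R) := pref q * integ 0 (pi / 2) (pF j afun Gfun H1fun H2fun q).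

Let Fq := pF j afun Gfun H1fun H2fun.
Let Fq' := pF' j afun Gfun H1fun H2fun dafun dGfun dH1fun dH2fun.

Lemma afun_ge0 (q : R) : 0 < q < 1 -> 0 <= afun q.
Proof. by move=> /q_facts[q2 _ _ _]; rewrite divr_ge0 ?sqr_ge0 // ltW. Qed.

Lemma D_Phi (q : R) : 0 < q < 1 -> is_derive q (1 : R) Phi
  (dpref q * integ 0 (pi / 2) (Fq q) + pref q * integ 0 (pi / 2) (Fq' q)).
Proof.
move=> q01; apply: (D_mul (D_pref q01)).
have cc (e e' : R -> R) : (forall t : R, 0 < t < 1 -> is_derive t (1 : R) e (e' t)) -> forall t : R, 0 < t < 1 -> {for t, continuous e}.
  by move=> h t t01; exact: is_derive_cont (h t t01).
have N (P : R -> Prop) : (forall t, 0 < t < 1 -> P t) -> \forall t \near q, P t.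
  by move=> h; apply: filterS (near01 q01) => t; exact: h.
have cm := cc _ _ D_mfun; have ca := cc _ _ D_afun; have cd := cc _ _ D_dfun.
have ccst (c : R) (t : R) : {for t, continuous (fun _ : R => c)} by exact: cst_continuous.
have cM (e f : R -> R) (t : R) : {for t, continuous e} -> {for t, continuous f} -> {for t, continuous (fun t => e t * f t)}.
  by move=> ce cf; exact: continuousM ce cf.
have cD (e f : R -> R) (t : R) : {for t, continuous e} -> {for t, continuous f} -> {for t, continuous (fun t => e t + f t)}.
  by move=> ce cf; exact: continuousD ce cf.
have cB (e f : R -> R) (t : R) : {for t, continuous e} -> {for t, continuous f} -> {for t, continuous (fun t => e t - f t)}.
  by move=> ce cf; exact: continuousB ce cf.
have cid (t : R) : {for t, continuous (fun t : R => t)} by exact: cvg_id.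
have cX2 (e : R -> R) (t : R) : {for t, continuous e} -> {for t, continuous (fun t => e t ^+ 2)}.
  by move=> ce; exact: (cM _ _ _ ce ce).
have cdm (t : R) : 0 < t < 1 -> {for t, continuous dmfun}.
  by move=> t01; exact: (cD _ _ _ (cd _ t01) (cM _ _ _ (cid t) (cont_ddfun t01))).
have cda (t : R) : 0 < t < 1 -> {for t, continuous dafun}.
  move=> t01; have [/lt0r_neq0 q2 _ _ _] := q_facts t01.
  have q4 : (1 - t ^+ 2) ^+ 2 != 0 by rewrite sqrf_eq0.
  have h := D_mul (D_mul (D_cst 2 t) (D_id t)) (D_inv (f := fun t => (1 - t ^+ 2) ^+ 2) q4
    (D_pow 2 (D_sub (D_cst 1 t) (D_pow 2 (D_id t))))).
  exact: is_derive_cont h.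
apply: D_param; apply: N => t t01.
- exact: D_afun.
- exact: D_Gfun.
- exact: D_H1fun.
- exact: D_H2fun.
- exact: cda.
- exact: (cB _ _ _ (cM _ _ _ (cM _ _ _ (cM _ _ _ (ccst 2 t) (cd _ t01)) (cont_ddfun t01)) (cB _ _ _ (ccst 1 t) (cX2 _ _ (cid t))))
    (cM _ _ _ (cM _ _ _ (ccst 2 t) (cid t)) (cX2 _ _ (cd _ t01)))).
- exact: (cM _ _ _ (cB _ _ _ (cM _ _ _ (ccst 6 t) (cm _ t01)) (ccst 4 t)) (cdm _ t01)).
- exact: (cB _ _ _ (cM _ _ _ (cM _ _ _ (ccst 2 t) (cda _ t01)) (cX2 _ _ (cB _ _ _ (ccst 1 t) (cm _ t01))))
    (cM _ _ _ (cM _ _ _ (cM _ _ _ (ccst 4 t) (ca _ t01)) (cB _ _ _ (ccst 1 t) (cm _ t01))) (cdm _ t01))).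
- exact: afun_ge0.
Qed.

End Monotone.

(** * Positivity of the derivative of Phi *)

Section PhiMonotone.
Context {R : realType}.
Variables (j : nat).

(** The derivative of (b0 + b1 X) sin w cos^(j+1) w / sqrt (1 + a X) with X = sin^2 w. This
    primitive vanishes at 0 and pi/2, so the term can be added to an integrand at no cost. *)
Definition ibp_term (a b0 b1 w : R) : R :=
  let X := sin w ^+ 2 in let Z := 1 + a * X in
  cos w ^+ j * (((b0 + b1 * X) * ((1 - X) * Z - j.+1%:R * X * Z - a * X * (1 - X)) + 2 * b1 * X * (1 - X) * Z) *
    (Num.sqrt Z)^-1 ^+ 3).

Lemma pz_cont (a : R) : 0 <= a -> continuous (fun w : R => (Num.sqrt (1 + a * sin w ^+ 2))^-1).
Proof.
move=> a0 w; have z0 : 0 < 1 + a * sin w ^+ 2 by rewrite ltr_wpDr // mulr_ge0 // sqr_ge0.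
have s0 : Num.sqrt (1 + a * sin w ^+ 2) != 0 by rewrite lt0r_neq0 // sqrtr_gt0.
have h := D_inv (f := fun w => Num.sqrt (1 + a * sin w ^+ 2)) s0 (D_sqrt (f := fun w => 1 + a * sin w ^+ 2) z0
  (D_add (D_cst 1 w) (D_mul (D_cst a w) (D_pow 2 (D_sin (D_id w)))))).
exact: is_derive_cont h.
Qed.

Let K : set R := `[0, pi / 2]%classic.

Let cX : contK K (fun w : R => sin w ^+ 2) := contK_pow 2 (contK_continuous (@continuous_sin R)).
Let cC : contK K (fun w : R => cos w ^+ j) := contK_pow j (contK_continuous (@continuous_cos R)).

Lemma contK_ibp (a b0 b1 : R) : 0 <= a -> contK K (ibp_term a b0 b1).
Proof.
move=> a0; have ck (c : R) := contK_cst K c.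
have cZ : contK K (fun w => 1 + a * sin w ^+ 2) := contKD (ck 1) (contKM (ck a) cX).
have cY : contK K (fun w => 1 - sin w ^+ 2) := contKB (ck 1) cX.
exact: (contKM cC (contKM (contKD (contKM (contKD (ck b0) (contKM (ck b1) cX))
  (contKB (contKB (contKM cY cZ) (contKM (contKM (ck _) cX) cZ)) (contKM (contKM (ck a) cX) cY)))
  (contKM (contKM (contKM (ck (2 * b1)) cX) cY) cZ)) (contK_pow 3 (contK_continuous (pz_cont a0))))).
Qed.

Lemma ibp (a b0 b1 : R) : 0 <= a -> integ 0 (pi / 2) (ibp_term a b0 b1) = 0.
Proof.
move=> a0.
pose F w := (b0 + b1 * sin w ^+ 2) * sin w * cos w ^+ j.+1 * (Num.sqrt (1 + a * sin w ^+ 2))^-1.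
have dF (w : R) : is_derive w (1 : R) F (ibp_term a b0 b1 w).
  have z0 : 0 < 1 + a * sin w ^+ 2 by rewrite ltr_wpDr // mulr_ge0 // sqr_ge0.
  have s0 : Num.sqrt (1 + a * sin w ^+ 2) != 0 by rewrite lt0r_neq0 // sqrtr_gt0.
  have dX := D_pow 2 (D_sin (D_id w)).
  have dz := D_inv (f := fun w => Num.sqrt (1 + a * sin w ^+ 2)) s0 (D_sqrt (f := fun w => 1 + a * sin w ^+ 2) z0
    (D_add (D_cst 1 w) (D_mul (D_cst a w) dX))).
  have h := D_mul (D_mul (D_mul (D_add (D_cst b0 w) (D_mul (D_cst b1 w) dX)) (D_sin (D_id w)))
    (D_pow j.+1 (D_cos (D_id w)))) dz.
  apply: (D_eq h); rewrite /ibp_term /=.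
  have rr : Num.sqrt (1 + a * sin w ^+ 2) ^+ 2 = 1 + a * sin w ^+ 2 by rewrite sqr_sqrtr // ltW.
  have cs : cos w ^+ 2 = 1 - sin w ^+ 2 by rewrite -(cos2Dsin2 w) addrK.
  rewrite -cs (exprS (cos w) j).
  move: (sin w) (cos w) (cos w ^+ j) (Num.sqrt _) s0 rr => s c cj r r0 rr.
  rewrite -rr; field; exact: r0.
have cF : forall x, 0 <= x <= pi / 2 -> {for x, continuous F} by move=> x _; exact: is_derive_cont (dF x).
rewrite (@integ_FTC2 _ 0 (pi / 2) (ibp_term a b0 b1) F pihalf_gt0 (contK_ibp _ _ a0) cF (fun x _ => dF x)).
by rewrite /F cos_pihalf sin0 expr0n /= !mulr0 !mul0r subrr.
Qed.

(* The integrand that remains after the integrations by parts, in terms of [s = k * sin w ^ 2]. *)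
Definition epos (m k s : R) : R :=
  (j%:R * m * (1 - m) + (j%:R - 1) * m ^+ 2 * s) / k + 3 - 2 * m + m ^+ 2 - 3 * (1 - m) * (2 - m) * s +
  (1 - m) * (3 - 5 * m) * s ^+ 2 + 2 * m * (1 - m) * s ^+ 3.

(** The quotient by k is at least -m^2, since s <= k. The rest is expanded around s = 1, with t = s
    - 1, as 2m(1-m) t^2 (1+t) plus m times a square plus a nonnegative multiple of t^2 plus m^2, and
    the last summand compensates the loss. *)
Lemma epos_ge0 (m k s : R) : 0 < m < 1 -> 0 < k -> 0 <= s <= k -> 0 <= epos m k s.
Proof.
move=> /andP[m0 m1] k0 /andP[s0 sk].
have u0 : 0 < 1 - m by rewrite subr_gt0.
have h1 : - m ^+ 2 <= (j%:R * m * (1 - m) + (j%:R - 1) * m ^+ 2 * s) / k.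
  rewrite ler_pdivlMr // mulNr; apply: (@le_trans _ _ (- (m ^+ 2 * s))).
    by rewrite lerN2 ler_wpM2l // sqr_ge0.
  have j0 : 0 <= j%:R :> R := ler0n _ _.
  have a1 : 0 <= j%:R * m * (1 - m) by rewrite !mulr_ge0 // ltW.
  have a2 : 0 <= j%:R * (m ^+ 2 * s) by rewrite !mulr_ge0 // ltW.
  have -> : j%:R * m * (1 - m) + (j%:R - 1) * m ^+ 2 * s = j%:R * m * (1 - m) + (j%:R * (m ^+ 2 * s) - m ^+ 2 * s) by ring.
  lra.
pose t := s - 1; have t1 : -1 <= t by rewrite lerBrDr addNr.
have h2 : 0 <= 2 * m * (1 - m) * t ^+ 2 * (1 + t).
  apply: mulr_ge0; last by rewrite addrC -lerBlDr sub0r.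
  by apply: mulr_ge0 (sqr_ge0 t); rewrite !mulr_ge0 // ltW.
have h3 : 0 <= m * (1 - (1 - m) * t / 2) ^+ 2 by apply: mulr_ge0 (ltW m0) (sqr_ge0 _).
have h4 : 0 <= (1 - m) * (3 - m - m * (1 - m) / 4) * t ^+ 2.
  apply: mulr_ge0 (sqr_ge0 t); apply: mulr_ge0 (ltW u0) _.
  have : m * (1 - m) <= 1 by rewrite mulr_ile1 ?ltW // ltrBlDr ltrDl.
  lra.
apply: le_trans (_ : - m ^+ 2 + (2 * m * (1 - m) * t ^+ 2 * (1 + t) + m * (1 - (1 - m) * t / 2) ^+ 2 +
   (1 - m) * (3 - m - m * (1 - m) / 4) * t ^+ 2 + m ^+ 2) <= _).
  lra.
rewrite /epos.
have -> : 2 * m * (1 - m) * t ^+ 2 * (1 + t) + m * (1 - (1 - m) * t / 2) ^+ 2 +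
   (1 - m) * (3 - m - m * (1 - m) / 4) * t ^+ 2 + m ^+ 2 = 3 - 2 * m + m ^+ 2 - 3 * (1 - m) * (2 - m) * s +
  (1 - m) * (3 - 5 * m) * s ^+ 2 + 2 * m * (1 - m) * s ^+ 3 by rewrite /t; field.
by rewrite !addrA in h1 *; rewrite -!addrA lerD2r.
Qed.

Variable gam : R.
Hypothesis gam0 : 0 < gam.

Local Notation Fq := (pF j afun (Gfun gam) (H1fun gam) (H2fun gam)).
Local Notation Fq' := (pF' j afun (Gfun gam) (H1fun gam) (H2fun gam) dafun (dGfun gam) (dH1fun gam) (dH2fun gam)).

(** The left side collects the logarithmic derivative of the prefactor, the derivative of the
    integrand and the exact derivative, all freed of cos^j w and of the power -3/2 of Z. The
    coefficients b0 and b1 are chosen so that the sum factors as C times the polynomial of [epos] at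
    k X. *)
Lemma Phi_identity (q d X N : R) : q != 0 -> d != 0 -> 1 - q ^+ 2 != 0 -> 1 - d ^+ 2 != 0 -> 1 + d ^+ 2 != 0 ->
  1 - q * d != 0 -> 1 - (q * d) ^+ 2 != 0 ->
  let d' := d * (1 - d ^+ 2) * (1 + q ^+ 2) / (q * (1 - q ^+ 2) * (1 + d ^+ 2)) in
  let m := q * d in let m' := d + q * d' in
  let a := q ^+ 2 / (1 - q ^+ 2) in let a' := 2 * q / (1 - q ^+ 2) ^+ 2 in
  let k := q * (1 - m) / (d * (1 - q ^+ 2)) in
  let Z := 1 + a * X in let C := d ^+ 2 / (1 + d ^+ 2) in
  let B := d ^+ 2 * (1 - q ^+ 2) + (1 - m) * (1 - 3 * m) * X + 2 * a * (1 - m) ^+ 2 * X ^+ 2 in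
  let b0 := (1 - m) * (1 - 3 * m) * C in let b1 := 2 * (1 - m) * m * k * C in
  q * (- ((N + 1) * m * m' / (1 - m ^+ 2)) + (N + 2) * d * d' / (1 - d ^+ 2) + m' / (1 - m)) * B * Z +
  q * ((2 * d * d' * (1 - q ^+ 2) - 2 * q * d ^+ 2 + (6 * m - 4) * m' * X +
    (2 * a' * (1 - m) ^+ 2 - 4 * a * (1 - m) * m') * X ^+ 2) * Z - B * (a' * X / 2)) +
  ((b0 + b1 * X) * ((1 - X) * Z - (N + 1) * X * Z - a * X * (1 - X)) + 2 * b1 * X * (1 - X) * Z) =
  C * ((N * m * (1 - m) + (N - 1) * m ^+ 2 * (k * X)) / k + 3 - 2 * m + m ^+ 2 - 3 * (1 - m) * (2 - m) * (k * X) +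
  (1 - m) * (3 - 5 * m) * (k * X) ^+ 2 + 2 * m * (1 - m) * (k * X) ^+ 3).
Proof.
move=> q0 d0 q2 d2 d2' m1 m2 /=.
by field; rewrite q0 d0 q2 d2 d2' m1 m2.
Qed.

Section AtPoint.
Variable q : R.
Hypothesis q01 : 0 < q < 1.

Let a0 : 0 <= afun q. Proof. exact: (afun_ge0 gam0 q01). Qed.
Let cz : contK K (pz afun q) := contK_continuous (pz_cont a0).
Let ck (c : R) := contK_cst K c.

Lemma contK_pF : contK K (Fq q).
Proof.
exact: (contKM cC (contKM (contKD (contKD (ck _) (contKM (ck _) cX)) (contKM (ck _) (contK_pow 2 cX))) cz)).
Qed.

Lemma contK_pF' : contK K (Fq' q).
Proof.
exact: (contKM cC (contKB (contKM (contKD (contKD (ck _) (contKM (ck _) cX)) (contKM (ck _) (contK_pow 2 cX))) cz)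
  (contKM (contKD (contKD (ck _) (contKM (ck _) cX)) (contKM (ck _) (contK_pow 2 cX)))
    (contKM (contKM (contKM (ck _) cX) (ck _)) (contK_pow 3 cz))))).
Qed.

(** After extraction of [pref] / q and addition of the null integral of [ibp_term], the integrand is
    pointwise nonnegative by [Phi_identity] and [epos_ge0]. *)
Lemma dPhi_ge0 : 0 <= dpref j gam q * integ 0 (pi / 2) (Fq q) + pref j gam q * integ 0 (pi / 2) (Fq' q).
Proof.
have [q2 d2 m0 m1] := q_facts gam0 q01; have /andP[q0 q1] := q01.
have /andP[d0 d1] := dfun_bounds gam0 q01.
have [t0 tE] := tau_sqr gam0 q01; have [l0 lE] := del_sqr gam0 q01.
have P0 : 0 < pref j gam q by apply: (mulr_gt0 (mulr_gt0 (mulr_gt0 _ (exprn_gt0 _ t0)) (exprn_gt0 _ _)) _); rewrite ?invr_gt0.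
pose Lam := - (j.+1%:R * mfun gam q * dmfun gam q / tau gam q ^+ 2) +
  j.+2%:R * dfun gam q * ddfun gam q / del gam q ^+ 2 + dmfun gam q / (1 - mfun gam q).
have -> : dpref j gam q * integ 0 (pi / 2) (Fq q) + pref j gam q * integ 0 (pi / 2) (Fq' q) =
    pref j gam q / q * (q * Lam * integ 0 (pi / 2) (Fq q) + q * integ 0 (pi / 2) (Fq' q)).
  rewrite /dpref -/Lam; move: (pref j gam q) Lam (integ _ _ _) (integ _ _ _) => P L I1 I2.
  by field; rewrite lt0r_neq0.
apply: mulr_ge0; first by rewrite divr_ge0 ?ltW.
(* [C], [k], [b0] and [b1] are the values for which [Phi_identity] holds. *)
pose C := dfun gam q ^+ 2 / (1 + dfun gam q ^+ 2).
pose m := mfun gam q.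
pose k := q * (1 - m) / (dfun gam q * (1 - q ^+ 2)).
pose b0 := (1 - m) * (1 - 3 * m) * C; pose b1 := 2 * (1 - m) * m * k * C.
rewrite -[leRHS]addr0 -[X in _ <= _ + X](ibp b0 b1 a0).
have pI := integ_posfun 0 (pi / 2) : posfun K (integ 0 (pi / 2)).
have k1 := contKM (ck (q * Lam)) contK_pF; have k2 := contKM (ck q) contK_pF'.
have k3 := contK_ibp b0 b1 a0.
rewrite -(pfZ pI _ contK_pF) -(pfZ pI _ contK_pF') -(pfD pI k1 k2) -(pfD pI (contKD k1 k2) k3).
apply: (pf_ge0 pI (contKD (contKD k1 k2) k3)) => w; rewrite /K /= in_itv /= => /andP[w0 wpi].
have Z0 := pz_arg_gt0 w a0.
pose X := sin w ^+ 2; pose z := pz afun q w.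
have z0 : 0 < z by rewrite invr_gt0 sqrtr_gt0.
have zE : z ^+ 2 * (1 + afun q * X) = 1 by rewrite /z /pz exprVn sqr_sqrtr ?ltW // mulVf // lt0r_neq0.
have c0 : 0 <= cos w by apply: cos_ge0_pihalf; rewrite wpi andbT (le_trans _ w0) // oppr_le0 ltW // pihalf_gt0.
have k0 : 0 < k by rewrite divr_gt0 // mulr_gt0.
suff -> : q * Lam * Fq q w + q * Fq' q w + ibp_term (afun q) b0 b1 w = cos w ^+ j * (z ^+ 3 * (C * epos m k (k * X))).
  rewrite mulr_ge0 ?exprn_ge0 // mulr_ge0 ?exprn_ge0 ?(ltW z0) // mulr_ge0 //.
    by rewrite divr_ge0 ?sqr_ge0 // addr_ge0 // sqr_ge0.
  have X0 : 0 <= X by exact: sqr_ge0.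
  have X1 : X <= 1 by rewrite /X -(cos2Dsin2 w) lerDr sqr_ge0.
  apply: epos_ge0 => //; first by rewrite m0 -subr_gt0.
  by rewrite mulr_ge0 ?(ltW k0) //= ger_pMr.
have d2' : 1 + dfun gam q ^+ 2 != 0 by rewrite lt0r_neq0 // ltr_wpDr // sqr_ge0.
have tn : 1 - (q * dfun gam q) ^+ 2 != 0 by rewrite -/(mfun gam q) -tE sqrf_eq0 lt0r_neq0.
have id := @Phi_identity q (dfun gam q) X j%:R (lt0r_neq0 q0) (lt0r_neq0 d0) (lt0r_neq0 q2) (lt0r_neq0 d2) d2' (lt0r_neq0 m1) tn.
have zz : z = z ^+ 3 * (1 + afun q * X) by rewrite (exprS z 2) -mulrA zE mulr1.
transitivity (cos w ^+ j * (z ^+ 3 * (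
  q * Lam * pB (Gfun gam) (H1fun gam) (H2fun gam) q w * (1 + afun q * X) +
  q * ((dGfun gam q + dH1fun gam q * X + dH2fun gam q * X ^+ 2) * (1 + afun q * X) -
    pB (Gfun gam) (H1fun gam) (H2fun gam) q w * (dafun q * X / 2)) +
  ((b0 + b1 * X) * ((1 - X) * (1 + afun q * X) - j.+1%:R * X * (1 + afun q * X) - afun q * X * (1 - X)) +
    2 * b1 * X * (1 - X) * (1 + afun q * X))))).
  rewrite /pF /pF' /ibp_term -/X -/z.
  have -> : (Num.sqrt (1 + afun q * X))^-1 = z by [].
  move: (pB _ _ _ _ _) (dGfun _ _ + _ + _) (1 + afun q * X) zz => P Q Z zz.
  rewrite {1 2}zz; ring.
congr (_ * (_ * _)).
rewrite -[C * _]id /Lam tE lE /pB -(addn2 j) -(addn1 j) !natrD.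
reflexivity. Qed.
End AtPoint.

Lemma Phi_nondecr (q1 q2 : R) : 0 < q1 -> q1 <= q2 -> q2 < 1 -> Phi j gam q1 <= Phi j gam q2.
Proof.
move=> q10 q12 q21.
have h (x : R) : q1 <= x <= q2 -> 0 < x < 1.
  by move=> /andP[a b]; rewrite (lt_le_trans q10 a) (le_lt_trans b q21).
have ho (x : R) : q1 < x < q2 -> 0 < x < 1 by move=> /andP[a b]; apply: h; rewrite !ltW.
apply: (D_nondecr q12 (fun x hx => D_Phi j gam0 (ho x hx)) (fun x hx => dPhi_ge0 (ho x hx))).
by move=> x /h x01; exact: is_derive_cont (D_Phi j gam0 x01).
Qed.

End PhiMonotone.

(** * Substitution and folding of integrals *)

Section ChangeOfVariables.
Context {R : realType}.

Lemma integ_subst (b0 a b : R) (h beta dbeta : R -> R) : a < b -> continuous h ->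
  (forall x, a <= x <= b -> b0 < beta x) -> (forall x, a <= x <= b -> is_derive x (1 : R) beta (dbeta x)) ->
  continuous dbeta -> contK `[a, b]%classic beta -> beta a < beta b ->
  integ a b (fun x => h (beta x) * dbeta x) = integ (beta a) (beta b) h.
Proof.
move=> ab ch b0b db cdb cb bab.
pose F t := integ b0 t h.
have dF t : b0 < t -> is_derive t (1 : R) F (h t) by move=> bt; exact: integ_FTC1.
have ba : b0 < beta a by apply: b0b; rewrite lexx ltW.
have dFb (x : R) : a <= x <= b -> is_derive x (1 : R) (fun x => F (beta x)) (h (beta x) * dbeta x).
  by move=> hx; exact: D_comp (db x hx) (dF _ (b0b x hx)).
have cw (x : R) : a < x < b -> a <= x <= b by move=> /andP[p q]; rewrite !ltW.
have ci : contK `[a, b]%classic (fun x => h (beta x) * dbeta x).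
  exact: (contKM (contK_push cb (contK_continuous ch)) (contK_continuous cdb)).
rewrite (@integ_FTC2 _ a b _ (fun x => F (beta x)) ab ci (fun x hx => is_derive_cont (dFb x hx)) (fun x hx => dFb x (cw x hx))).
have bF (x : R) : beta a <= x <= beta b -> is_derive x (1 : R) F (h x).
  by move=> /andP[p _]; apply: dF; exact: lt_le_trans p.
have bw (x : R) : beta a < x < beta b -> beta a <= x <= beta b by move=> /andP[p q]; rewrite !ltW.
by rewrite (@integ_FTC2 _ (beta a) (beta b) h F bab (contK_continuous ch) (fun x hx => is_derive_cont (bF x hx)) (fun x hx => bF x (bw x hx))).
Qed.

Lemma integ_fold (c : R) (h : R -> R) : 0 < c -> continuous h ->
  integ (- c) c h = integ 0 c (fun t => h t + h (- t)).
Proof.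
move=> c0 ch.
pose F t := integ (- c - 1) t h.
have dF (t : R) : - c <= t -> is_derive t (1 : R) F (h t).
  by move=> ct; apply: integ_FTC1 => //; apply: lt_le_trans ct; rewrite ltrBlDr ltrDl.
have cc : - c < c by rewrite (lt_trans _ c0) // oppr_lt0.
have dF1 (x : R) : - c <= x <= c -> is_derive x (1 : R) F (h x) by move=> /andP[p _]; exact: dF.
have dF2 (x : R) : - c < x < c -> is_derive x (1 : R) F (h x) by move=> /andP[p _]; apply: dF; exact: ltW.
rewrite (@integ_FTC2 _ (- c) c h F cc (contK_continuous ch) (fun x hx => is_derive_cont (dF1 x hx)) dF2).
have dG (t : R) : 0 <= t <= c -> is_derive t (1 : R) (fun t => F t - F (- t)) (h t + h (- t)).
  move=> /andP[t0 tc]; have d1 : - c <= t by rewrite (le_trans _ t0) // oppr_le0 ltW.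
  have d2 : - c <= - t by rewrite lerN2.
  have dd := D_sub (dF t d1) (D_comp (D_opp (D_id t)) (dF _ d2)).
  by apply: (D_eq dd); ring.
have ci : contK `[0, c]%classic (fun t => h t + h (- t)).
  apply: contK_continuous => t; apply: continuousD; first exact: ch.
  by apply: (@continuous_comp _ _ _ (fun t : R => - t) h); [exact: (@continuousN _ R^o _ (fun t => t) t (@cvg_id _ _))|exact: ch].
have cw (x : R) : 0 < x < c -> 0 <= x <= c by move=> /andP[p q]; rewrite !ltW.
rewrite (@integ_FTC2 _ 0 c _ (fun t => F t - F (- t)) c0 ci (fun x hx => is_derive_cont (dG x hx)) (fun x hx => dG x (cw x hx))).
by rewrite oppr0 subrr subr0.
Qed.

End ChangeOfVariables.

(** * The integral J(e, f) *)

Section Jdef.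
Context {R : realType}.
Variable j : nat.

(** The exponents come from the transported kernel: -(j+5)/2 on the factor from the distance to x,
    -(j+1)/2 on what the Moebius denominator leaves. [Jint] is the folded form, over [0, pi/2], of
    an integral over [-pi/2, pi/2] ([Jint_fold]). *)
Definition Jker (e f y : R) := (Num.sqrt (1 + e * y))^-1 ^+ (j + 5) * (Num.sqrt (1 - f * y))^-1 ^+ j.+1.
Definition Jint (e f : R) :=
  integ 0 (pi / 2) (fun b => sin b ^+ 2 * cos b ^+ j * (Jker e f (sin b) + Jker e f (- sin b))).

Lemma Jarg_gt0 (e b : R) : `|e| < 1 -> 0 < 1 + e * sin b.
Proof.
move=> e1; have : `|e * sin b| < 1.
  rewrite normrM; apply: le_lt_trans e1; rewrite ler_piMr // ler_norml sin_geN1 sin_le1 //.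
by rewrite ltr_norml => /andP[h _]; rewrite -ltrBlDl sub0r.
Qed.

Lemma contK_Jker {T : topologicalType} (K : set T) (e f y : T -> R) : contK K e -> contK K f -> contK K y ->
  (forall t, K t -> 0 < 1 + e t * y t) -> (forall t, K t -> 0 < 1 - f t * y t) ->
  contK K (fun t => Jker (e t) (f t) (y t)).
Proof.
move=> ce cf cy e0 f0.
exact: (contKM (contK_pow _ (contK_sqrtV (contKD (contK_cst K 1) (contKM ce cy)) e0))
  (contK_pow _ (contK_sqrtV (contKB (contK_cst K 1) (contKM cf cy)) f0))).
Qed.

Lemma continuous_Jsin (e f : R) : `|e| < 1 -> `|f| < 1 ->
  continuous (fun b => sin b ^+ 2 * cos b ^+ j * Jker e f (sin b)).
Proof.
move=> e1 f1 b.
have cs := contK_continuous (K := setT) (@continuous_sin R); have cc := contK_continuous (K := setT) (@continuous_cos R).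
have f0 (t : R) : setT t -> 0 < 1 - f * sin t by move=> _; rewrite -mulNr Jarg_gt0 // normrN.
have := contKM (contKM (contK_pow 2 cs) (contK_pow j cc))
  (contK_Jker (contK_cst setT e) (contK_cst setT f) cs (fun t _ => Jarg_gt0 t e1) f0).
by move=> /(_ b I) /nbhs_singleton.
Qed.

Lemma Jint_fold (e f : R) : `|e| < 1 -> `|f| < 1 ->
  Jint e f = integ (- (pi / 2)) (pi / 2) (fun b => sin b ^+ 2 * cos b ^+ j * Jker e f (sin b)).
Proof.
move=> e1 f1; rewrite (integ_fold pihalf_gt0 (continuous_Jsin e1 f1)); congr integ.
by apply/funext => b; rewrite sinN cosN sqrrN mulrDr.
Qed.

End Jdef.

(** * The elliptic substitution *)

Section Substitution.
Context {R : realType}.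
Variables (q d : R).
Hypotheses (q0 : 0 < q) (q1 : q < 1) (d0 : 0 < d) (d1 : d < 1).

Let th := Num.sqrt (1 - q ^+ 2).
Let dl := Num.sqrt (1 - d ^+ 2).
Let q2 : 0 < 1 - q ^+ 2. Proof. by rewrite subr_gt0 expr_lt1 // ltW. Qed.
Let d2 : 0 < 1 - d ^+ 2. Proof. by rewrite subr_gt0 expr_lt1 // ltW. Qed.
Let th0 : 0 < th. Proof. by rewrite sqrtr_gt0. Qed.
Let dl0 : 0 < dl. Proof. by rewrite sqrtr_gt0. Qed.
Let thE : th ^+ 2 = 1 - q ^+ 2. Proof. by rewrite sqr_sqrtr // ltW. Qed.
Let dlE : dl ^+ 2 = 1 - d ^+ 2. Proof. by rewrite sqr_sqrtr // ltW. Qed.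

(** The new angle b is given by sin b = [sub_S w] and cos b = [sub_C w], with derivative [sub_db w].
    It maps [-pi/2, pi/2] onto itself and splits 1 + e sin b and 1 - f sin b into factors l + q sin
    w and l - q sin w of product 1 - q^2. *)
Definition sub_l (w : R) := Num.sqrt (1 - q ^+ 2 + q ^+ 2 * sin w ^+ 2).
Definition sub_den (w : R) := sub_l w + d * sin w.
Definition sub_S (w : R) := (sin w + d * sub_l w) / sub_den w.
Definition sub_C (w : R) := th * dl * cos w / sub_den w.
Definition sub_db (w : R) := th * dl / (sub_l w * sub_den w).

Lemma sub_arg_gt0 w : 0 < 1 - q ^+ 2 + q ^+ 2 * sin w ^+ 2.
Proof. by rewrite ltr_wpDr // mulr_ge0 // sqr_ge0. Qed.

Lemma sub_l_gt0 w : 0 < sub_l w. Proof. by rewrite sqrtr_gt0 sub_arg_gt0. Qed.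
Lemma sub_lE w : sub_l w ^+ 2 = 1 - q ^+ 2 + q ^+ 2 * sin w ^+ 2.
Proof. by rewrite sqr_sqrtr // ltW // sub_arg_gt0. Qed.

Lemma sub_den_gt0 w : 0 < sub_den w.
Proof.
have h : `|d * sin w| < sub_l w.
  rewrite -(@ltr_pXn2r _ 2) ?nnegrE ?normr_ge0 ?(ltW (sub_l_gt0 w)) // real_normK ?num_real // sub_lE exprMn.
  have := cos2Dsin2 w; have := sqr_ge0 (cos w); have := sqr_ge0 (sin w).
  move: (cos w ^+ 2) (sin w ^+ 2) => c s s0 c0 cs.
  have -> : s = 1 - c by rewrite -cs addrAC subrr add0r.
  rewrite -subr_gt0.
  have -> : 1 - q ^+ 2 + q ^+ 2 * (1 - c) - d ^+ 2 * (1 - c) = (1 - q ^+ 2) * c + (1 - d ^+ 2) * (1 - c) by ring.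
  have c1 : 0 <= 1 - c by rewrite -cs addrAC subrr add0r.
  move: c0; rewrite le_eqVlt => /predU1P[<-|c0].
    by rewrite mulr0 add0r subr0 mulr1.
  by rewrite ltr_pwDl ?mulr_gt0 // mulr_ge0 // ltW.
by move: h; rewrite ltr_norml => /andP[h _]; rewrite /sub_den -ltrBlDl sub0r.
Qed.

Lemma D_sub_l w : is_derive w (1 : R) sub_l (q ^+ 2 * sin w * cos w / sub_l w).
Proof.
have h := D_sqrt (f := fun w => 1 - q ^+ 2 + q ^+ 2 * sin w ^+ 2) (sub_arg_gt0 w)
  (D_add (D_cst (1 - q ^+ 2) w) (D_mul (D_cst (q ^+ 2) w) (D_pow 2 (D_sin (D_id w))))).
apply: (D_eq h); rewrite -/(sub_l w); have := lt0r_neq0 (sub_l_gt0 w).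
by move: (sub_l w) => l l0; field.
Qed.

Lemma sub_SC w : sub_S w ^+ 2 + sub_C w ^+ 2 = 1.
Proof.
rewrite /sub_S /sub_C.
have := lt0r_neq0 (sub_den_gt0 w); have := sub_lE w; rewrite /sub_den.
have cs : cos w ^+ 2 = 1 - sin w ^+ 2 by rewrite -(cos2Dsin2 w) addrK.
move: (sub_l w) (sin w) (cos w) cs => l s c cs lE n0.
apply/eqP; rewrite -subr_eq0; apply/eqP.
transitivity (((s + d * l) ^+ 2 + th ^+ 2 * dl ^+ 2 * c ^+ 2 - (l + d * s) ^+ 2) / (l + d * s) ^+ 2); first by field.
rewrite thE dlE cs.
have -> : (s + d * l) ^+ 2 + (1 - q ^+ 2) * (1 - d ^+ 2) * (1 - s ^+ 2) - (l + d * s) ^+ 2 =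
   (1 - d ^+ 2) * (1 - q ^+ 2 + q ^+ 2 * s ^+ 2 - l ^+ 2) by ring.
by rewrite lE subrr mulr0 mul0r.
Qed.

Lemma D_sub_S w : is_derive w (1 : R) sub_S (sub_C w * sub_db w).
Proof.
have n0 := lt0r_neq0 (sub_den_gt0 w); have l0 := lt0r_neq0 (sub_l_gt0 w).
have ds := D_sin (D_id w); have dl' := D_sub_l w.
have h := D_mul (D_add ds (D_mul (D_cst d w) dl')) (D_inv (f := sub_den) n0 (D_add dl' (D_mul (D_cst d w) ds))).
apply: (D_eq h); rewrite /sub_C /sub_db; move: n0 l0; rewrite /sub_den; have := sub_lE w.
move: (sub_l w) (sin w) (cos w) => l s c lE n0 l0.
apply/eqP; rewrite -subr_eq0; apply/eqP.
transitivity ((c / (l * (l + d * s) ^+ 2)) * ((1 - d ^+ 2) * (l ^+ 2 - (1 - q ^+ 2 + q ^+ 2 * s ^+ 2)) +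
  ((1 - d ^+ 2) * (1 - q ^+ 2) - dl ^+ 2 * th ^+ 2))); first by field; rewrite n0 l0.
by rewrite lE thE dlE !subrr mulr0 addr0 mulr0.
Qed.

Lemma D_sub_C w : is_derive w (1 : R) sub_C (- (sub_S w * sub_db w)).
Proof.
have n0 := lt0r_neq0 (sub_den_gt0 w); have l0 := lt0r_neq0 (sub_l_gt0 w).
have ds := D_sin (D_id w); have dl' := D_sub_l w.
have h := D_mul (D_mul (D_cst (th * dl) w) (D_cos (D_id w))) (D_inv (f := sub_den) n0 (D_add dl' (D_mul (D_cst d w) ds))).
apply: (D_eq h); rewrite /sub_S /sub_db; move: n0 l0; rewrite /sub_den; have := sub_lE w.
have cs : cos w ^+ 2 = 1 - sin w ^+ 2 by rewrite -(cos2Dsin2 w) addrK.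
move: (sub_l w) (sin w) (cos w) cs => l s c cs lE n0 l0.
apply/eqP; rewrite -subr_eq0; apply/eqP.
transitivity (- (th * dl / (l * (l + d * s) ^+ 2)) * (s * (l ^+ 2 - (1 - q ^+ 2 + q ^+ 2 * s ^+ 2)) +
   (q ^+ 2 * s + l * d) * (c ^+ 2 - (1 - s ^+ 2)))); first by field; rewrite n0 l0.
by rewrite lE cs !subrr !mulr0 addr0 mulr0.
Qed.

Lemma sub_C_ge0 w : - (pi / 2) <= w <= pi / 2 -> 0 <= sub_C w.
Proof.
move=> hw; rewrite /sub_C divr_ge0 ?(ltW (sub_den_gt0 w)) // mulr_ge0 ?cos_ge0_pihalf //.
by rewrite mulr_ge0 ?ltW.
Qed.

(** Half-angle formula for the angle of sine [sub_S] and cosine [sub_C]; it is smooth up to the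
    endpoints, because [sub_C] is nonnegative on the interval. *)
Definition sub_beta (w : R) := 2 * atan (sub_S w / (1 + sub_C w)).

Lemma sub_beta_trig w : 0 < 1 + sub_C w -> sin (sub_beta w) = sub_S w /\ cos (sub_beta w) = sub_C w.
Proof.
move=> c0; rewrite /sub_beta; set t := sub_S w / (1 + sub_C w).
have t2 : 0 < 1 + t ^+ 2 by rewrite ltr_wpDr // sqr_ge0.
have cE : cos (atan t) ^+ 2 = (1 + t ^+ 2)^-1 by rewrite cos_atan exprVn sqr_sqrtr // ltW.
have c00 : cos (atan t) != 0 by rewrite -sqrf_eq0 cE invr_neq0 // lt0r_neq0.
have sE : sin (atan t) = t * cos (atan t) by rewrite -{2}(atanK t) /tan divfK.
have c1 := lt0r_neq0 c0.
have tE : 1 + t ^+ 2 = 2 / (1 + sub_C w).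
  rewrite /t; have := sub_SC w; move: (sub_S w) (sub_C w) c1 => S C c1 SC.
  apply/eqP; rewrite -subr_eq0; apply/eqP.
  transitivity ((S ^+ 2 + C ^+ 2 - 1) / (1 + C) ^+ 2); first by field.
  by rewrite SC subrr mul0r.
have -> : 2 * atan t = atan t *+ 2 by rewrite mulr_natl.
rewrite sin_mulr2n cos_mulr2n sE.
have -> : cos (atan t) * (t * cos (atan t)) *+ 2 = 2 * t * cos (atan t) ^+ 2 by rewrite -mulr_natl; ring.
rewrite cE tE /t; split; first by field.
by rewrite -mulr_natl; field.
Qed.

Lemma D_sub_beta w : 0 < 1 + sub_C w -> is_derive w (1 : R) sub_beta (sub_db w).
Proof.
move=> c0; have c1 := lt0r_neq0 c0.
have datan (x : R) : is_derive x (1 : R) (@atan R) ((1 + x ^+ 2)^-1).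
  by apply: DeriveDef; [exact: derivable_atan|rewrite -derive1E derive1_atan].
have dq := D_mul (D_sub_S w) (D_inv (f := fun w => 1 + sub_C w) c1 (D_add (D_cst 1 w) (D_sub_C w))).
have h := D_mul (D_cst 2 w) (D_comp dq (datan _)).
apply: (D_eq h).
have := sub_SC w; move: (sub_S w) (sub_C w) (sub_db w) c1 c0 => S C db c1 c0 SC.
have n2 : (1 + C) ^+ 2 + S ^+ 2 != 0 by rewrite lt0r_neq0 // ltr_wpDr ?sqr_ge0 // exprn_gt0.
apply/eqP; rewrite -subr_eq0; apply/eqP.
transitivity (db * (S ^+ 2 + C ^+ 2 - 1) / ((1 + C) ^+ 2 + S ^+ 2)).
  by field; rewrite n2 c1.
by rewrite SC subrr mulr0 mul0r.
Qed.

Lemma sub_beta_pihalf : sub_beta (pi / 2) = pi / 2 /\ sub_beta (- (pi / 2)) = - (pi / 2).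
Proof.
have l1 w : sin w ^+ 2 = 1 -> sub_l w = 1 by move=> h; rewrite /sub_l h mulr1 subrK sqrtr1.
have lp : sub_l (pi / 2) = 1 by rewrite l1 // sin_pihalf expr1n.
have lm : sub_l (- (pi / 2)) = 1 by rewrite l1 // sinN sin_pihalf sqrrN expr1n.
rewrite /sub_beta /sub_S /sub_C /sub_den lp lm cosN sinN sin_pihalf cos_pihalf !mulr0 !mul0r !addr0 !divr1 !mulr1.
rewrite divff ?lt0r_neq0 ?addr_gt0 // mulrN1.
have -> : -1 + d = - (1 - d) by rewrite opprB addrC.
rewrite mulNr divff ?lt0r_neq0 ?subr_gt0 // atanN atan1.
by split; field.
Qed.

Lemma sub_cos1_gt0 w : - (pi / 2) <= w <= pi / 2 -> 0 < 1 + sub_C w.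
Proof. by move=> /sub_C_ge0 h; rewrite ltr_wpDr. Qed.

Lemma contK_sub_beta : contK `[- (pi / 2), pi / 2]%classic sub_beta.
Proof.
have cC : continuous sub_C by move=> w; exact: is_derive_cont (D_sub_C w).
have oU : open [set w | 0 < 1 + sub_C w].
  apply: (@open_comp _ _ (fun w => 1 + sub_C w) [set t | 0 < t]); last exact: open_gt.
  by move=> w _; apply: continuousD; [exact: cst_continuous|exact: cC].
apply: (contK_open oU) => [w|w c0].
  by rewrite /= in_itv /=; exact: sub_cos1_gt0.
exact: is_derive_cont (D_sub_beta c0).
Qed.

Lemma continuous_sub_db : continuous sub_db.
Proof.
move=> w; have n0 := lt0r_neq0 (sub_den_gt0 w); have l0 := lt0r_neq0 (sub_l_gt0 w).
have ds := D_sin (D_id w); have dl' := D_sub_l w.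
have nl : sub_l w * sub_den w != 0 by rewrite mulf_neq0.
have h := D_mul (D_cst (th * dl) w) (D_inv (f := fun w => sub_l w * sub_den w) nl
  (D_mul dl' (D_add dl' (D_mul (D_cst d w) ds)))).
exact: is_derive_cont h.
Qed.

Lemma sub_lq_gt0 w : 0 < sub_l w + q * sin w.
Proof.
have h : `|q * sin w| < sub_l w.
  rewrite -(@ltr_pXn2r _ 2) ?nnegrE ?normr_ge0 ?(ltW (sub_l_gt0 w)) // real_normK ?num_real // sub_lE exprMn.
  by rewrite ltrDr.
by move: h; rewrite ltr_norml => /andP[h _]; rewrite -ltrBlDl sub0r.
Qed.

Variable j : nat.
Let m := q * d.
Let m1 : 0 < 1 - m. Proof. by rewrite subr_gt0 /m mulr_ilt1 // ltW. Qed.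
Let m0 : 0 < m. Proof. by rewrite mulr_gt0. Qed.
Let ta := Num.sqrt (1 - m ^+ 2).
Let m2 : 0 < 1 - m ^+ 2. Proof. by rewrite subr_gt0 expr_lt1 // ?ltW // -subr_gt0. Qed.
Let ta0 : 0 < ta. Proof. by rewrite sqrtr_gt0. Qed.
Let taE : ta ^+ 2 = 1 - m ^+ 2. Proof. by rewrite sqr_sqrtr // ltW. Qed.
Let e := (q - d) / (1 - m).
Let f := (q + d) / (1 + m).

Definition sub_g (w : R) := cos w ^+ j * ((sin w + d * sub_l w) ^+ 2 / ((sub_l w + q * sin w) ^+ 2 * sub_l w)).

Lemma continuous_sub_g : continuous sub_g.
Proof.
move=> w; have n0 := lt0r_neq0 (sub_lq_gt0 w); have l0 := lt0r_neq0 (sub_l_gt0 w).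
have ds := D_sin (D_id w); have dl' := D_sub_l w.
have nl : (sub_l w + q * sin w) ^+ 2 * sub_l w != 0 by rewrite mulf_neq0 // sqrf_eq0.
have h := D_mul (D_pow j (D_cos (D_id w))) (D_mul (D_pow 2 (D_add ds (D_mul (D_cst d w) dl')))
  (D_inv (f := fun w => (sub_l w + q * sin w) ^+ 2 * sub_l w) nl
  (D_mul (D_pow 2 (D_add dl' (D_mul (D_cst q w) ds))) dl'))).
exact: is_derive_cont h.
Qed.

Lemma sub_integrand w : - (pi / 2) <= w <= pi / 2 ->
  sin (sub_beta w) ^+ 2 * cos (sub_beta w) ^+ j * ((Num.sqrt (1 + e * sin (sub_beta w)))^-1 ^+ (j + 5) *
    (Num.sqrt (1 - f * sin (sub_beta w)))^-1 ^+ j.+1) * sub_db w =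
  (ta / dl) ^+ j * ta * dl^-1 ^+ 5 * (1 - m) ^+ 2 * sub_g w.
Proof.
move=> /sub_cos1_gt0 /sub_beta_trig[-> ->].
have n0 := sub_den_gt0 w; have l0 := sub_l_gt0 w; have k0 := sub_lq_gt0 w.
have m1' := lt0r_neq0 m1; have m2' : 1 + m != 0 by rewrite lt0r_neq0 // addr_gt0.
have E1 : 1 + e * sub_S w = dl ^+ 2 * (sub_l w + q * sin w) / ((1 - m) * sub_den w).
  rewrite /e /sub_S dlE; move: (lt0r_neq0 n0); rewrite /sub_den /m in m1' *.
  by move: (sub_l w) (sin w) => l s ns; field; rewrite ns m1'.
have E2 : 1 - f * sub_S w = dl ^+ 2 * (sub_l w - q * sin w) / ((1 + m) * sub_den w).
  rewrite /f /sub_S dlE; move: (lt0r_neq0 n0); rewrite /sub_den /m in m2' *.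
  by move: (sub_l w) (sin w) => l s ns; field; rewrite ns m2'.
(* The product of the two roots no longer contains l + q sin w or l - q sin w, as these multiply to
   1 - q^2. *)
have PQ : Num.sqrt (1 + e * sub_S w) * Num.sqrt (1 - f * sub_S w) = dl ^+ 2 * th / (ta * sub_den w).
  have p0 : 0 <= 1 + e * sub_S w.
    by rewrite E1 divr_ge0 ?mulr_ge0 ?(ltW k0) ?(ltW n0) ?(ltW m1) ?(ltW dl0).
  rewrite -sqrtrM // E1 E2.
  have -> : dl ^+ 2 * (sub_l w + q * sin w) / ((1 - m) * sub_den w) *
      (dl ^+ 2 * (sub_l w - q * sin w) / ((1 + m) * sub_den w)) = (dl ^+ 2 * th / (ta * sub_den w)) ^+ 2.
    rewrite !expr_div_n !exprMn thE taE.
    have -> : 1 - q ^+ 2 = (sub_l w + q * sin w) * (sub_l w - q * sin w).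
      by rewrite [RHS]mulrC -subr_sqr sub_lE exprMn addrK.
    have -> : 1 - m ^+ 2 = (1 - m) * (1 + m) by ring.
    by field; rewrite m1' m2' lt0r_neq0.
  by rewrite sqrtr_sqr ger0_norm // divr_ge0 ?mulr_ge0 ?(ltW th0) ?(ltW n0) ?(ltW ta0) ?(ltW dl0).
have P2 : Num.sqrt (1 + e * sub_S w) ^+ 2 = dl ^+ 2 * (sub_l w + q * sin w) / ((1 - m) * sub_den w).
  by rewrite sqr_sqrtr E1 // divr_ge0 ?mulr_ge0 ?(ltW k0) ?(ltW n0) ?(ltW m1) ?(ltW dl0).
set P := Num.sqrt _ in PQ P2 *; set Q := Num.sqrt _ in PQ *.
(* The exponent j + 5 is split as (j + 1) + 4: the first part pairs with [Q], the second needs only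
   the square of [P]. *)
have -> : P^-1 ^+ (j + 5) * Q^-1 ^+ j.+1 = ((P * Q)^-1) ^+ j.+1 * (P ^+ 2)^-1 ^+ 2.
  by rewrite invfM exprMn -addSnnS exprD -exprVn -exprM; ring.
rewrite PQ P2 /sub_g /sub_S /sub_C /sub_db (exprS _ j).
have F : (th * dl * cos w / sub_den w) ^+ j * (dl ^+ 2 * th / (ta * sub_den w))^-1 ^+ j = (ta / dl) ^+ j * cos w ^+ j.
  rewrite -!exprMn; congr (_ ^+ j).
  by field; rewrite !lt0r_neq0.
transitivity (((th * dl * cos w / sub_den w) ^+ j * (dl ^+ 2 * th / (ta * sub_den w))^-1 ^+ j) *
  (((sin w + d * sub_l w) / sub_den w) ^+ 2 * (dl ^+ 2 * th / (ta * sub_den w))^-1 *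
   (dl ^+ 2 * (sub_l w + q * sin w) / ((1 - m) * sub_den w))^-1 ^+ 2 * (th * dl / (sub_l w * sub_den w)))).
  by ring.
rewrite F; move: ((ta / dl) ^+ j) (cos w ^+ j) => A B.
move: n0 l0 k0 => /lt0r_neq0 + /lt0r_neq0 + /lt0r_neq0.
move: (sub_den w) (sub_l w) (sin w) => D l s n0 l0 k0.
by field; rewrite n0 l0 k0 m1' !lt0r_neq0.
Qed.

Lemma sub_bounds : `|e| < 1 /\ `|f| < 1.
Proof.
have q1' : 0 < 1 - q by rewrite subr_gt0. have d1' : 0 < 1 - d by rewrite subr_gt0.
have qp : 0 < 1 + q by rewrite addr_gt0. have dp : 0 < 1 + d by rewrite addr_gt0.
have a1 := mulr_gt0 q1' dp; have a2 := mulr_gt0 qp d1'; have a3 := mulr_gt0 q1' d1'; have a4 := mulr_gt0 qp dp.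
have mp : 0 < 1 + m by rewrite addr_gt0.
split; rewrite ltr_norml /e /f ltr_pdivlMr // ltr_pdivrMr // /m; apply/andP; split; lra.
Qed.

(** Adding the values at w and -w leaves a quotient even in sin w, whose numerator is a quadratic in
    sin^2 w. *)
Lemma sub_g_fold w : sub_g w + sub_g (- w) = 2 / th ^+ 3 * (cos w ^+ j *
  ((d ^+ 2 * (1 - q ^+ 2) + (1 - m) * (1 - 3 * m) * sin w ^+ 2 +
     2 * (q ^+ 2 / (1 - q ^+ 2)) * (1 - m) ^+ 2 * (sin w ^+ 2) ^+ 2) *
   (Num.sqrt (1 + q ^+ 2 / (1 - q ^+ 2) * sin w ^+ 2))^-1)).
Proof.
have lE0 : sub_l w = th * Num.sqrt (1 + q ^+ 2 / (1 - q ^+ 2) * sin w ^+ 2).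
  rewrite -sqrtrM ?(ltW q2) // /sub_l; congr Num.sqrt.
  by field; exact: lt0r_neq0.
have lN : sub_l (- w) = sub_l w by rewrite /sub_l sinN sqrrN.
have k1 := sub_lq_gt0 w; have k2 := sub_lq_gt0 (- w); have l0 := sub_l_gt0 w.
rewrite lN sinN in k2.
have r0 : Num.sqrt (1 + q ^+ 2 / (1 - q ^+ 2) * sin w ^+ 2) = sub_l w / th by rewrite lE0 [RHS]mulrC mulKf // lt0r_neq0.
have q2' := lt0r_neq0 q2.
rewrite /sub_g lN sinN cosN r0; have := sub_lE w.
move: (lt0r_neq0 k1) (lt0r_neq0 k2) (lt0r_neq0 l0) (lt0r_neq0 th0).
move: (sub_l w) (sin w) (cos w ^+ j) => l s c n1 n2 n3 nt lE.
have th3 : th ^+ 3 = th * (1 - q ^+ 2) by rewrite exprS thE.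
rewrite -mulrDr [RHS]mulrCA; congr (_ * _).
have pr : (l + q * s) * (l + q * - s) = 1 - q ^+ 2.
  have -> : (l + q * s) * (l + q * - s) = l ^+ 2 - q ^+ 2 * s ^+ 2 by ring.
  by rewrite lE addrK.
transitivity (((s + d * l) ^+ 2 * (l + q * - s) ^+ 2 + (- s + d * l) ^+ 2 * (l + q * s) ^+ 2) /
  (((l + q * s) * (l + q * - s)) ^+ 2 * l)); first by field; rewrite n1 n2 n3.
rewrite pr th3.
transitivity (2 * ((d ^+ 2 * (1 - q ^+ 2) + (1 - m) * (1 - 3 * m) * s ^+ 2 +
     2 * (q ^+ 2 / (1 - q ^+ 2)) * (1 - m) ^+ 2 * (s ^+ 2) ^+ 2)) / ((1 - q ^+ 2) * l)); last first.
  by field; rewrite n3 nt q2'.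
have -> : (s + d * l) ^+ 2 * (l + q * - s) ^+ 2 + (- s + d * l) ^+ 2 * (l + q * s) ^+ 2 =
    2 * (l ^+ 2 * s ^+ 2 * (1 - m) ^+ 2 + (d * l ^+ 2 - q * s ^+ 2) ^+ 2) by rewrite /m; ring.
rewrite lE /m; field; rewrite n3 q2' //.
Qed.

(** Substitute, then fold. With m = q d, the factor sqrt (1 - e^2)^3 equals (th dl / (1 - m))^3 and
    cancels the th^3 that [sub_g_fold] leaves. *)
Lemma J_sub : Num.sqrt (1 - e ^+ 2) ^+ 3 * Jint j e f = 2 * ta ^+ j.+1 * dl^-1 ^+ j.+2 * (1 - m)^-1 *
  integ 0 (pi / 2) (fun w => cos w ^+ j *
  ((d ^+ 2 * (1 - q ^+ 2) + (1 - m) * (1 - 3 * m) * sin w ^+ 2 +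
     2 * (q ^+ 2 / (1 - q ^+ 2)) * (1 - m) ^+ 2 * (sin w ^+ 2) ^+ 2) *
   (Num.sqrt (1 + q ^+ 2 / (1 - q ^+ 2) * sin w ^+ 2))^-1)).
Proof.
have [e1 f1] := sub_bounds.
have [bp bm] := sub_beta_pihalf.
have ab : - (pi / 2) < pi / 2 :> R by rewrite (lt_trans _ (@pihalf_gt0 R)) // oppr_lt0 pihalf_gt0.
pose h b := sin b ^+ 2 * cos b ^+ j * Jker j e f (sin b).
have ch : continuous h := @continuous_Jsin R j e f e1 f1.
have b0 (x : R) : - (pi / 2) <= x <= pi / 2 -> - pi < sub_beta x.
  move=> _; have h1 := atan_gtNpi2 (sub_S x / (1 + sub_C x)); rewrite /sub_beta.
  by move: h1; move: (atan _) => t h1; lra.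
have sb := integ_subst ab ch b0 (fun x hx => D_sub_beta (sub_cos1_gt0 hx)) continuous_sub_db contK_sub_beta.
rewrite bp bm in sb.
rewrite (@Jint_fold R j e f e1 f1) -/h -(sb ab).
pose k := (ta / dl) ^+ j * ta * dl^-1 ^+ 5 * (1 - m) ^+ 2.
have cg : contK `[- (pi / 2), pi / 2]%classic sub_g := contK_continuous continuous_sub_g.
have -> : integ (- (pi / 2)) (pi / 2) (fun x => h (sub_beta x) * sub_db x) = k * integ (- (pi / 2)) (pi / 2) sub_g.
  rewrite -(pfZ (integ_posfun _ _) k cg).
  apply: (pf_ext (integ_posfun _ _) (contKM (contK_push contK_sub_beta (contK_continuous ch)) (contK_continuous continuous_sub_db))
    (contKM (contK_cst _ k) cg)) => w; rewrite /= in_itv /= => hw.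
  exact: sub_integrand hw.
rewrite (integ_fold pihalf_gt0 continuous_sub_g).
under eq_fun do rewrite sub_g_fold.
rewrite (pfZ (integ_posfun 0 (pi / 2))); last first.
  have cX := contK_pow 2 (contK_continuous (K := `[0, pi / 2]%classic) (@continuous_sin R)).
  have cC := contK_pow j (contK_continuous (K := `[0, pi / 2]%classic) (@continuous_cos R)).
  have ck (c : R) := contK_cst (`[0, pi / 2]%classic : set R) c.
  have a0 : 0 <= q ^+ 2 / (1 - q ^+ 2) by rewrite divr_ge0 ?sqr_ge0 // ltW.
  exact: (contKM cC (contKM (contKD (contKD (ck _) (contKM (ck _) cX)) (contKM (ck _) (contK_pow 2 cX))) (contK_continuous (pz_cont a0)))).
move: (integ _ _ _) => I.
have -> : Num.sqrt (1 - e ^+ 2) = th * dl / (1 - m).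
  have -> : 1 - e ^+ 2 = (th * dl / (1 - m)) ^+ 2.
    rewrite !expr_div_n !exprMn thE dlE /e /m; have := lt0r_neq0 m1; rewrite /m => n1; field; exact: n1.
  by rewrite sqrtr_sqr ger0_norm // divr_ge0 ?mulr_ge0 ?ltW.
have E1 : dl^-1 ^+ j.+2 = (dl ^+ j)^-1 * dl^-1 * dl^-1 by rewrite -exprVn !exprSr.
rewrite /k (expr_div_n ta dl j) (exprS ta j) E1.
have := lt0r_neq0 m1; have dj : dl ^+ j != 0 by rewrite expf_neq0 // lt0r_neq0.
move: (ta ^+ j) (dl ^+ j) dj => A B B0 n1.
by field; rewrite n1 B0 !lt0r_neq0.
Qed.

End Substitution.

(** * Monotonicity of the normalised integral along a ray f = kap e *)

Section JMonotone.
Context {R : realType}.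
Variables (j : nat) (kap : R).
Hypothesis kap1 : 1 < kap.

(** The cubed factor is the one that turns [Jint] into [gg] up to a constant, see [ggE]. *)
Definition Jn (e : R) := Num.sqrt (1 - e ^+ 2) ^+ 3 * Jint j e (kap * e).

(** With e = tanh a and kap e = tanh b, [qf e] is tanh ((a + b) / 2), and the companion d in
    [Jn_Phi] is tanh ((b - a) / 2). The ratio of d / (1 - d^2) to q / (1 - q^2) is then the constant
    [gam], which makes d equal to [dfun gam q]. *)
Let W (e : R) := Num.sqrt ((1 - e ^+ 2) * (1 - (kap * e) ^+ 2)).
Let qf (e : R) := (e + kap * e) / (1 + e * (kap * e) + W e).
Let gam := (kap - 1) / (kap + 1).

Let gam0 : 0 < gam. Proof. by rewrite divr_gt0 ?subr_gt0 // addr_gt0 // (lt_trans _ kap1). Qed.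
Let kap0 : 0 < kap. Proof. exact: lt_trans kap1. Qed.

Lemma W_facts e : 0 <= e -> kap * e < 1 -> [/\ e < 1, 0 < W e & W e ^+ 2 = (1 - e ^+ 2) * (1 - (kap * e) ^+ 2)].
Proof.
move=> e0 f1; have e1 : e < 1 by apply: le_lt_trans f1; rewrite ler_peMl // ltW.
have f0 : 0 <= kap * e by rewrite mulr_ge0 // ltW.
have p : 0 < (1 - e ^+ 2) * (1 - (kap * e) ^+ 2) by rewrite mulr_gt0 // subr_gt0 expr_lt1.
by rewrite /W sqrtr_gt0 sqr_sqrtr // ltW.
Qed.

Lemma qf_sigma e : 0 <= e -> kap * e < 1 -> qf e / (1 - qf e ^+ 2) = (1 + kap) * e / (2 * W e).
Proof.
move=> e0 f1; have [e1 W0 WE] := W_facts e0 f1; rewrite /qf.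
have f0 : 0 <= kap * e by rewrite mulr_ge0 // ltW.
have n0 : 0 < 1 + e * (kap * e) + W e by rewrite addr_gt0 // ltr_wpDr // mulr_ge0.
have E : (1 + e * (kap * e) + W e) ^+ 2 - (e + kap * e) ^+ 2 = 2 * W e * (1 + e * (kap * e) + W e).
  apply/eqP; rewrite -subr_eq0; apply/eqP.
  transitivity ((1 - e ^+ 2) * (1 - (kap * e) ^+ 2) - W e ^+ 2); first by ring.
  by rewrite WE subrr.
have -> : 1 - ((e + kap * e) / (1 + e * (kap * e) + W e)) ^+ 2 = 2 * W e / (1 + e * (kap * e) + W e).
  transitivity (((1 + e * (kap * e) + W e) ^+ 2 - (e + kap * e) ^+ 2) / (1 + e * (kap * e) + W e) ^+ 2).
    by field; rewrite lt0r_neq0.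
  by rewrite E; field; rewrite lt0r_neq0.
by field; rewrite !lt0r_neq0.
Qed.

Lemma Jn_Phi e : 0 < e -> kap * e < 1 -> 0 < qf e < 1 /\ Jn e = Phi j gam (qf e).
Proof.
move=> e0 f1; have [e1 W0 WE] := W_facts (ltW e0) f1.
have f0 : 0 < kap * e by rewrite mulr_gt0.
have fe : e < kap * e by rewrite ltr_pMl.
have u1 : 0 < 1 - e by rewrite subr_gt0.
have u2 : 0 < 1 - kap * e by rewrite subr_gt0.
have sg := qf_sigma (ltW e0) f1.
have ef1 : e * (kap * e) < 1 by rewrite mulr_ilt1 // ltW.
pose d := (kap * e - e) / (1 - e * (kap * e) + W e).
have P0 : 0 < 1 + e * (kap * e) + W e by rewrite !addr_gt0 // mulr_gt0.
have Q0 : 0 < 1 - e * (kap * e) + W e by rewrite addr_gt0 // subr_gt0.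
have q01 : 0 < qf e < 1.
  apply/andP; split; first by rewrite /qf divr_gt0 // addr_gt0.
  rewrite /qf ltr_pdivrMr // mul1r.
  have := mulr_gt0 u1 u2; lra.
have d01 : 0 < d < 1.
  apply/andP; split; first by rewrite /d divr_gt0 // subr_gt0.
  rewrite /d ltr_pdivrMr // mul1r.
  have := mulr_gt0 u2 (addr_gt0 ltr01 e0); lra.
split=> //.
have dE : dfun gam (qf e) = d.
  have sgE : dsig gam (qf e) = (kap * e - e) / (2 * W e).
    rewrite /dsig -mulrA sg; by rewrite /gam; field; rewrite (lt0r_neq0 W0) lt0r_neq0 // addr_gt0.
  rewrite /dfun sgE.
  have -> : 1 + 4 * ((kap * e - e) / (2 * W e)) ^+ 2 = ((1 - e * (kap * e)) / W e) ^+ 2.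
    apply/eqP; rewrite -subr_eq0; apply/eqP.
    transitivity ((W e ^+ 2 - (1 - e ^+ 2) * (1 - (kap * e) ^+ 2)) / W e ^+ 2); first by field; rewrite lt0r_neq0.
    by rewrite WE subrr mul0r.
  rewrite sqrtr_sqr ger0_norm; last by rewrite divr_ge0 ?(ltW W0) // subr_ge0 ltW.
  by rewrite /d; field; rewrite (lt0r_neq0 W0) (lt0r_neq0 Q0).
have /andP[q0 q1] := q01; have /andP[d0 d1] := d01.
have m1 : 0 < 1 - qf e * d by rewrite subr_gt0 mulr_ilt1 // ltW.
have m2 : 0 < 1 + qf e * d by rewrite addr_gt0 // mulr_gt0.
have eE : e = (qf e - d) / (1 - qf e * d).
  apply: (canRL (mulfK (lt0r_neq0 m1))); apply/eqP; rewrite -subr_eq0; apply/eqP.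
  transitivity (e * (W e ^+ 2 - (1 - e ^+ 2) * (1 - (kap * e) ^+ 2)) /
    ((1 + e * (kap * e) + W e) * (1 - e * (kap * e) + W e))).
    by rewrite /qf /d; field; rewrite !lt0r_neq0.
  by rewrite WE subrr mulr0 mul0r.
have fE : kap * e = (qf e + d) / (1 + qf e * d).
  apply: (canRL (mulfK (lt0r_neq0 m2))); apply/eqP; rewrite -subr_eq0; apply/eqP.
  transitivity (kap * e * (W e ^+ 2 - (1 - e ^+ 2) * (1 - (kap * e) ^+ 2)) /
    ((1 + e * (kap * e) + W e) * (1 - e * (kap * e) + W e))).
    by rewrite /qf /d; field; rewrite !lt0r_neq0.
  by rewrite WE subrr mulr0 mul0r.
have JS := J_sub q0 q1 d0 d1 j; rewrite -eE -fE in JS.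
apply: (etrans JS).
by rewrite /Phi /pref /tau /del /pF /pB /pz /afun /Gfun /H1fun /H2fun /mfun dE.
Qed.

(** By [qf_sigma], q / (1 - q^2) is proportional to e / W e, where W decreases; and q -> q / (1 -
    q^2) is increasing on (0, 1). *)
Lemma qf_homo e1 e2 : 0 < e1 -> e1 <= e2 -> kap * e2 < 1 -> qf e1 <= qf e2.
Proof.
move=> e10 e12 f2; have e20 := lt_le_trans e10 e12.
have f1 : kap * e1 < 1 by apply: le_lt_trans f2; rewrite ler_pM2l.
have [e11 W1 WE1] := W_facts (ltW e10) f1; have [e21 W2 WE2] := W_facts (ltW e20) f2.
have [/andP[q10 q11] _] := Jn_Phi e10 f1; have [/andP[q20 q21] _] := Jn_Phi e20 f2.
have f10 := mulr_gt0 kap0 e10; have f20 := mulr_gt0 kap0 e20.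
have f12 : kap * e1 <= kap * e2 by rewrite ler_pM2l.
have sq (a b : R) : 0 < a -> a <= b -> a ^+ 2 <= b ^+ 2.
  by move=> a0 ab; have b0 := lt_le_trans a0 ab; rewrite ler_pXn2r // nnegrE ltW.
have sq1 (a : R) : 0 < a -> a < 1 -> a ^+ 2 < 1 by move=> a0 a1; rewrite expr_lt1 // ltW.
have W12 : W e2 <= W e1.
  rewrite /W ler_wsqrtr //; apply: ler_pM.
  - by rewrite subr_ge0 ltW // sq1.
  - by rewrite subr_ge0 ltW // sq1.
  - by rewrite lerD2l lerN2 sq.
  - by rewrite lerD2l lerN2 sq.
have h : qf e1 / (1 - qf e1 ^+ 2) <= qf e2 / (1 - qf e2 ^+ 2).
  rewrite (qf_sigma (ltW e10) f1) (qf_sigma (ltW e20) f2).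
  apply: ler_pM; rewrite ?invr_ge0 ?mulr_ge0 ?addr_ge0 ?(ltW kap0) ?(ltW e10) ?(ltW W1) //.
    by rewrite ler_wpM2l // addr_ge0 // ltW.
  by rewrite lef_pV2 ?posrE ?mulr_gt0 // ler_wpM2l.
rewrite leNgt; apply/negP => q21'.
move: h; rewrite leNgt => /negP; apply.
have n2 : 0 < 1 - qf e2 ^+ 2 by rewrite subr_gt0 expr_lt1 // ltW.
have n1 : 0 < 1 - qf e1 ^+ 2 by rewrite subr_gt0 expr_lt1 // ltW.
have s12 : qf e2 ^+ 2 < qf e1 ^+ 2 by rewrite ltr_pXn2r ?nnegrE ?ltW.
apply: lt_le_trans (_ : qf e1 / (1 - qf e2 ^+ 2) <= _); first by rewrite ltr_pM2r // invr_gt0.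
by rewrite ler_wpM2l ?(ltW q10) // lef_pV2 ?posrE // lerD2l lerN2 ltW.
Qed.

Lemma Jn_cont0 : {for (0 : R), continuous Jn}.
Proof.
pose F (e b : R) := sin b ^+ 2 * cos b ^+ j * (Jker j e (kap * e) (sin b) + Jker j e (kap * e) (- sin b)).
have c1 : {for (0 : R), continuous (fun e : R => Num.sqrt (1 - e ^+ 2) ^+ 3)}.
  have p0 : 0 < 1 - (0 : R) ^+ 2 by rewrite expr0n subr0.
  exact: is_derive_cont (D_pow 3 (D_sqrt (f := fun t => 1 - t ^+ 2) p0 (D_sub (D_cst 1 0) (D_pow 2 (D_id (0 : R)))))).
set K : set R := `[0, pi / 2]%classic.
suff c2 : {for (0 : R), continuous (fun e : R => integ 0 (pi / 2) (F e))} by exact: continuousM c1 c2.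
apply: (pf_continuous1 (K := K) (integ_posfun 0 (pi / 2))); apply: jcontE.
have cs := @contK_sndfun R K sin 0 (@continuous_sin R); have cc := @contK_sndfun R K cos 0 (@continuous_cos R).
have ce : contK (sliceK 0 K) (fun p : R * R => p.1) := contK_fst _.
have cf := contKM (contK_cst (sliceK 0 K) kap) ce.
have pos (s : R * R -> R) : forall t : R * R, sliceK 0 K t -> 0 < 1 + t.1 * s t.
  by move=> [e b] [/= -> _]; rewrite mul0r addr0.
have neg (s : R * R -> R) : forall t : R * R, sliceK 0 K t -> 0 < 1 - kap * t.1 * s t.
  by move=> [e b] [/= -> _]; rewrite mulr0 mul0r subr0.
have k1 := @contK_Jker R j _ _ _ _ _ ce cf cs (pos _) (neg _).
have k2 := @contK_Jker R j _ _ _ _ _ ce cf (contKN cs) (pos _) (neg _).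
exact: (contKM (contKM (contK_pow 2 cs) (contK_pow j cc)) (contKD k1 k2)).
Qed.

(** For positive arguments combine [Jn_Phi], [qf_homo] and [Phi_nondecr]; the endpoint 0, where q
    leaves (0, 1), follows by continuity. *)
Lemma Jn_nondecr e1 e2 : 0 <= e1 -> e1 <= e2 -> kap * e2 < 1 -> Jn e1 <= Jn e2.
Proof.
have pos a b : 0 < a -> a <= b -> kap * b < 1 -> Jn a <= Jn b.
  move=> a0 ab f2; have b0 := lt_le_trans a0 ab.
  have f1 : kap * a < 1 by apply: le_lt_trans f2; rewrite ler_pM2l.
  have [/andP[q10 q11] ->] := Jn_Phi a0 f1; have [/andP[q20 q21] ->] := Jn_Phi b0 f2.
  exact: (Phi_nondecr j gam0 q10 (qf_homo a0 ab f2) q21).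
rewrite le_eqVlt => /predU1P[<-|e10]; last exact: pos.
rewrite le_eqVlt => /predU1P[->//|e20] f2.
apply/ler_addgt0Pr => e e0.
have nr (P : set R) : nbhs (0 : R) P -> nbhs ((0 : R)^'+) P by move=> h; exact: cvg_within.
have [x [x0 xe hx]] : exists x, [/\ 0 < x, x <= e2 & `|Jn 0 - Jn x| < e].
  near ((0 : R)^'+) => x; exists x; split.
  - by near: x; exact: nbhs_right_gt.
  - by near: x; exact: nbhs_right_le.
  - near: x; apply: nr; have c := Jn_cont0; move/cvgrPdist_lt : c => /(_ e e0); exact.
have h1 := pos x e2 x0 xe f2.
have h2 := ltW (le_lt_trans (ler_norm _) hx).
by move: h1 h2; lra.
Unshelve. all: by end_near. Qed.

End JMonotone.

(** * The angular density and the reflection argument *)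

Section Reflection.
Context {R : realType}.

Lemma integ_reflect (a b : R) (h : R -> R) : a < b -> continuous h ->
  integ a b h = integ a b (fun t => h (a + b - t)).
Proof.
move=> ab ch.
pose F t := integ (a - 1) t h.
have dF (t : R) : a <= t -> is_derive t (1 : R) F (h t).
  by move=> ct; apply: integ_FTC1 => //; apply: lt_le_trans ct; rewrite ltrBlDr ltrDl.
have dF1 (x : R) : a <= x <= b -> is_derive x (1 : R) F (h x) by move=> /andP[p _]; exact: dF.
have cw (x : R) : a < x < b -> a <= x <= b by move=> /andP[p q]; rewrite !ltW.
have dG (t : R) : a <= t <= b -> is_derive t (1 : R) (fun t => - F (a + b - t)) (h (a + b - t)).
  move=> /andP[t0 tb]; have d1 : a <= a + b - t by rewrite -addrA lerDl subr_ge0.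
  have dd := D_opp (D_comp (D_sub (D_cst (a + b) t) (D_id t)) (dF _ d1)).
  by apply: (D_eq dd); ring.
have cr : continuous (fun t => h (a + b - t)).
  move=> t; apply: (@continuous_comp _ _ _ (fun t : R => a + b - t) h); last exact: ch.
  exact: is_derive_cont (D_sub (D_cst (a + b) t) (D_id t)).
rewrite (@integ_FTC2 _ a b h F ab (contK_continuous ch) (fun x hx => is_derive_cont (dF1 x hx)) (fun x hx => dF1 x (cw x hx))).
rewrite (@integ_FTC2 _ a b _ (fun t => - F (a + b - t)) ab (contK_continuous cr) (fun x hx => is_derive_cont (dG x hx)) (fun x hx => dG x (cw x hx))).
have -> : a + b - b = a by ring.
have -> : a + b - a = b by ring.
by ring.
Qed.

Variables (j : nat) (e0 p mu : R).
Hypotheses (e00 : 0 < e0) (e0p : e0 < p) (p1 : p < 1) (mu0 : 0 < mu) (muE : mu ^+ 2 = 1 - e0 ^+ 2).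

(** [rr t] is the component of [circ t] along w0, and [gg] is the angular density of the averaged
    kernel: two powers of 1/Del come from the circle measure, one from the linear factor of the
    kernel. *)
Definition rr (t : R) := cos t / Del mu t.
Definition gg (t : R) := (Del mu t)^-1 ^+ 3 * Jint j (e0 * rr t) (p * rr t).

Let p0 : 0 < p. Proof. exact: lt_trans e0p. Qed.

Lemma Del_gt0' t : 0 < Del mu t. Proof. exact: Del_gt0. Qed.

Lemma Del_sqr t : Del mu t ^+ 2 = mu ^+ 2 + e0 ^+ 2 * cos t ^+ 2.
Proof.
rewrite (DelE mu0 t).
have -> : sin t ^+ 2 = 1 - cos t ^+ 2 by rewrite -(cos2Dsin2 t) addrAC subrr add0r.
by rewrite muE; ring.
Qed.

Lemma rr_le1 t : `|rr t| <= 1.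
Proof.
rewrite /rr normrM normfV (gtr0_norm (Del_gt0' t)) ler_pdivrMr ?Del_gt0' // mul1r.
rewrite -(@ler_pXn2r _ 2) ?nnegrE ?normr_ge0 ?(ltW (Del_gt0' t)) // real_normK ?num_real // (DelE mu0 t).
by rewrite lerDl mulr_ge0 // sqr_ge0.
Qed.

Lemma Jint_norm (e f x : R) : Jint j (e * x) (f * x) = Jint j (e * `|x|) (f * `|x|).
Proof.
have [x0|x0] := ger0P x; first by [].
rewrite /Jint; congr integ; apply/funext => b.
by congr (_ * _); rewrite [RHS]addrC /Jker !(mulrN, mulNr, opprK).
Qed.

(** Since mu^2 = 1 - e0^2, the root of 1 - e0^2 rr^2 is mu / Del, so the factor Del^-3 is the
    normalisation of [Jn]. *)
Lemma ggE t : gg t = mu^-1 ^+ 3 * Jn j (p / e0) (e0 * `|rr t|).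
Proof.
have D0 := Del_gt0' t.
have -> : Jn j (p / e0) (e0 * `|rr t|) = Num.sqrt (1 - (e0 * `|rr t|) ^+ 2) ^+ 3 * Jint j (e0 * `|rr t|) (p * `|rr t|).
  by rewrite /Jn mulrA divfK // lt0r_neq0.
have -> : Num.sqrt (1 - (e0 * `|rr t|) ^+ 2) = mu / Del mu t.
  have -> : 1 - (e0 * `|rr t|) ^+ 2 = (mu / Del mu t) ^+ 2.
    have n0 : Del mu t != 0 by rewrite lt0r_neq0.
    rewrite exprMn real_normK ?num_real // /rr [RHS]expr_div_n.
    have -> : mu ^+ 2 = Del mu t ^+ 2 - e0 ^+ 2 * cos t ^+ 2 by rewrite Del_sqr addrK.
    by field.
  by rewrite sqrtr_sqr ger0_norm // divr_ge0 ?ltW.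
rewrite /gg Jint_norm; move: (Jint _ _ _) => J.
by field; rewrite !lt0r_neq0.
Qed.

(** |rr| increases with |cos|, because rr^2 = cos^2 / (mu^2 + e0^2 cos^2); then [Jn_nondecr] applies
    with ratio p / e0 > 1. *)
Lemma gg_mono s t : `|cos s| <= `|cos t| -> gg s <= gg t.
Proof.
move=> st; rewrite !ggE; apply: ler_wpM2l; first by rewrite exprn_ge0 // invr_ge0 ltW.
apply: Jn_nondecr.
- by rewrite ltr_pdivlMr // mul1r.
- by rewrite mulr_ge0 ?normr_ge0 // ltW.
- apply: ler_wpM2l; first exact: ltW.
  rewrite -(@ler_pXn2r _ 2) ?nnegrE ?normr_ge0 // !real_normK ?num_real // /rr !expr_div_n.
  have sq : cos s ^+ 2 <= cos t ^+ 2.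
    by rewrite -(real_normK (num_real (cos s))) -(real_normK (num_real (cos t))) ler_pXn2r ?nnegrE ?normr_ge0.
  rewrite ler_pdivrMr ?exprn_gt0 ?Del_gt0' // mulrAC ler_pdivlMr ?exprn_gt0 ?Del_gt0' // !Del_sqr.
  rewrite !mulrDr (mulrCA (cos s ^+ 2) (e0 ^+ 2)) (mulrCA (cos t ^+ 2) (e0 ^+ 2)) (mulrC (cos t ^+ 2) (cos s ^+ 2)).
  by rewrite lerD2r ler_wpM2r // sqr_ge0.
- rewrite mulrA divfK ?lt0r_neq0 //; apply: le_lt_trans p1.
  by rewrite ler_piMr ?rr_le1 // ltW.
Qed.

Lemma cont_rr t : {for t, continuous rr}.
Proof. exact: is_derive_cont (D_ellc mu0 t). Qed.

Lemma cont_gg : continuous gg.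
Proof.
move=> t.
have c1 : {for t, continuous (fun t => (Del mu t)^-1 ^+ 3)}.
  exact: is_derive_cont (D_pow 3 (D_inv (f := Del mu) (lt0r_neq0 (Del_gt0' t)) (D_Del mu0 t))).
set K : set R := `[0, pi / 2]%classic.
pose F (t b : R) := sin b ^+ 2 * cos b ^+ j * (Jker j (e0 * rr t) (p * rr t) (sin b) + Jker j (e0 * rr t) (p * rr t) (- sin b)).
suff c2 : {for t, continuous (fun t => integ 0 (pi / 2) (F t))} by exact: continuousM c1 c2.
apply: (pf_continuous1 (K := K) (integ_posfun 0 (pi / 2))); apply: jcontE.
have cs := @contK_sndfun R K sin t (@continuous_sin R); have cc := @contK_sndfun R K cos t (@continuous_cos R).
have cr : contK (sliceK t K) (fun q : R * R => rr q.1).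
  by apply: (@contK_fstfun R R K rr t); near=> s; exact: cont_rr.
have ce := contKM (contK_cst (sliceK t K) e0) cr; have cf := contKM (contK_cst (sliceK t K) p) cr.
have h (e s b : R) : 0 < e -> e < 1 -> `|e * rr s| < 1.
  move=> e1 e2; rewrite normrM (gtr0_norm e1); apply: le_lt_trans e2; rewrite ler_piMr ?rr_le1 //; exact: ltW.
have e01 : e0 < 1 := lt_trans e0p p1.
have P (e : R) : 0 < e -> e < 1 -> forall q : R * R, sliceK t K q -> 0 < 1 + e * rr q.1 * sin q.2.
  by move=> x1 x2 q _; apply: Jarg_gt0; exact: h.
have N (e : R) : 0 < e -> e < 1 -> forall q : R * R, sliceK t K q -> 0 < 1 - e * rr q.1 * sin q.2.
  by move=> x1 x2 q _; rewrite -mulNr; apply: Jarg_gt0; rewrite normrN; exact: h.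
have P' (e : R) : 0 < e -> e < 1 -> forall q : R * R, sliceK t K q -> 0 < 1 + e * rr q.1 * - sin q.2.
  by move=> x1 x2 q Kq; rewrite mulrN; exact: N.
have N' (e : R) : 0 < e -> e < 1 -> forall q : R * R, sliceK t K q -> 0 < 1 - e * rr q.1 * - sin q.2.
  by move=> x1 x2 q Kq; rewrite mulrN opprK; exact: P.
have k1 := @contK_Jker R j _ _ _ _ _ ce cf cs (P e0 e00 e01) (N p p0 p1).
have k2 := @contK_Jker R j _ _ _ _ _ ce cf (contKN cs) (P' e0 e00 e01) (N' p p0 p1).
exact: (contKM (contKM (contK_pow 2 cs) (contK_pow j cc)) (contKD k1 k2)).
Unshelve. all: by end_near. Qed.

(* Antisymmetrise in the reflection [t -> al - t], which exchanges the two cosines. *)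
Lemma reflection_ineq (al a : R) : a = al / 2 - pi / 2 ->
  integ a (a + pi) (fun t => `|cos (t - al)| * gg t) <= integ a (a + pi) (fun t => `|cos t| * gg t).
Proof.
move=> aE; have ab : a < a + pi by rewrite ltrDl pi_gt0.
have ca (b : R) : continuous (fun t : R => `|cos (t - b)|).
  move=> t; apply: (@continuous_comp _ _ _ (fun t : R => cos (t - b)) (fun x : R => `|x|)); last exact: norm_continuous.
  exact: is_derive_cont (D_cos (D_sub (D_id t) (D_cst b t))).
have c0 : continuous (fun t : R => `|cos t|).
  move=> t; apply: (@continuous_comp _ _ _ cos (fun x : R => `|x|)); last exact: norm_continuous.
  exact: continuous_cos.
pose h t := (`|cos t| - `|cos (t - al)|) * gg t.
have cM (u v : R -> R) : continuous u -> continuous v -> continuous (fun t => u t * v t).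
  by move=> cu cv t; exact: continuousM (cu t) (cv t).
have cB (u v : R -> R) : continuous u -> continuous v -> continuous (fun t => u t - v t).
  by move=> cu cv t; exact: continuousB (cu t) (cv t).
have ch : continuous h := cM _ _ (cB _ _ c0 (ca al)) cont_gg.
have pI := integ_posfun a (a + pi).
have k1 := contK_continuous (K := `[a, a + pi]%classic) (cM _ _ c0 cont_gg).
have k2 := contK_continuous (K := `[a, a + pi]%classic) (cM _ _ (ca al) cont_gg).
rewrite -subr_ge0 -(pfB pI k1 k2).
have -> : (fun t => `|cos t| * gg t - `|cos (t - al)| * gg t) = h by apply/funext => t; rewrite /h mulrBl.
have crf : continuous (fun t => h (a + (a + pi) - t)).
  move=> t; apply: (@continuous_comp _ _ _ (fun t : R => a + (a + pi) - t) h); last exact: ch.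
  exact: is_derive_cont (D_sub (D_cst _ t) (D_id t)).
have kh := contK_continuous (K := `[a, a + pi]%classic) ch; have kr := contK_continuous (K := `[a, a + pi]%classic) crf.
(* As a + (a + pi) = al, reflecting the interval is t -> al - t. The sum of h and its reflection is
   a product of two differences, which have the same sign by [gg_mono]. *)
have h2 : 0 <= integ a (a + pi) h + integ a (a + pi) h.
  rewrite {2}(integ_reflect ab ch) -(pfD pI kh kr).
  apply: (pf_ge0 pI (contKD kh kr)) => t _; rewrite /h.
  have -> : a + (a + pi) - t = al - t by rewrite aE; field.
  have -> : al - t - al = - t by ring.
  rewrite cosN; have -> : cos (al - t) = cos (t - al) by rewrite -cosN opprB.
  have -> : (`|cos t| - `|cos (t - al)|) * gg t + (`|cos (t - al)| - `|cos t|) * gg (al - t) =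
     (`|cos t| - `|cos (t - al)|) * (gg t - gg (al - t)) by ring.
  have ct : `|cos (al - t)| = `|cos (t - al)| by rewrite -cosN opprB.
  have [le|/ltW le] := leP `|cos t| `|cos (t - al)|.
    by rewrite mulr_le0 // subr_le0 // gg_mono // ct.
  by rewrite mulr_ge0 // subr_ge0 // gg_mono // ct.
by move: h2; lra.
Qed.

End Reflection.

(** * The kernel profile averaged over the join *)

Section JoinEval.
Context {R : realType} {n : nat}.
Local Notation V := 'rV[R]_n.
Variables (j : nat) (e0 p mu : R).
Hypotheses (e00 : 0 < e0) (e0p : e0 < p) (p1 : p < 1) (mu0 : 0 < mu) (muE : mu ^+ 2 = 1 - e0 ^+ 2).
Variables (w0 w1 : V) (K2 D2 : set V) (B : (V -> R) -> R) (a0 : R).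
Hypotheses (w00 : einner w0 w0 = 1) (w11 : einner w1 w1 = 1) (w01 : einner w0 w1 = 0).
Hypotheses (hB : mean K2 D2 j.+1 B) (K20 : forall y, K2 y -> einner w0 y = 0) (K21 : forall y, K2 y -> einner w1 y = 0).

(** The absolute kernel in direction al after the Moebius change of variable, without its constant,
    see [kernel_profile]. *)
Definition kprof (al : R) (z : V) : R :=
  `|mu * cos al * einner w0 z + sin al * einner w1 z| * Jker j e0 p (- einner w0 z).

Let e01 : e0 < 1. Proof. exact: lt_trans p1. Qed.
Let p0 : 0 < p. Proof. exact: lt_trans e0p. Qed.

Lemma ker_arg (e y : R) : 0 < e -> e < 1 -> `|y| <= 1 -> 0 < 1 + e * y.
Proof.
move=> h0 h1 y1; have : `|e * y| < 1.
  by rewrite normrM (gtr0_norm h0); apply: le_lt_trans h1; rewrite ler_piMr // ltW.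
by rewrite ltr_norml => /andP[h _]; rewrite -ltrBlDl sub0r.
Qed.

Lemma contK_kprof {T : topologicalType} (K : set T) (al : R) (z : T -> V) : contK K z ->
  (forall t, K t -> `|einner w0 (z t)| <= 1) -> contK K (fun t => kprof al (z t)).
Proof.
move=> cz z1; have c0 := contK_einner (contK_vcst K w0) cz; have c1 := contK_einner (contK_vcst K w1) cz.
have P t : K t -> 0 < 1 + e0 * - einner w0 (z t) by move=> /z1 h; rewrite ker_arg // normrN.
have N t : K t -> 0 < 1 - p * - einner w0 (z t) by move=> /z1 h; rewrite mulrN opprK ker_arg.
have k := @contK_Jker R j _ _ _ _ _ (contK_cst K e0) (contK_cst K p) (contKN c0) P N.
exact: (contKM (contK_norm (contKD (contKM (contK_cst K (mu * cos al)) c0) (contKM (contK_cst K (sin al)) c1))) k).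
Qed.

Let einner0circ t : einner w0 (circ w0 w1 mu t) = rr mu t.
Proof. by rewrite /circ !einnerE w00 w01 mulr1 mulr0 addr0. Qed.
Let einner1circ t : einner w1 (circ w0 w1 mu t) = mu * sin t / Del mu t.
Proof. by rewrite /circ !einnerE w11 (einnerC w1) w01 mulr1 mulr0 add0r. Qed.

(** The profile depends only on the components along w0 and w1, both constant on [K2], so [B]
    contributes only its mass. By the parametrisation of the circle, the linear factor becomes mu
    cos (t - al) / Del. *)
Lemma inner_eval al b t s : (s = 1 \/ s = -1) ->
  B (fun y => sin b ^+ 1 * cos b ^+ j * kprof al (join_point b (s *: circ w0 w1 mu t) y)) =
  mu * B (fun=> 1) * (sin b * `|sin b| * cos b ^+ j * (`|cos (t - al)| * (Del mu t)^-1) * Jker j (e0 * rr mu t) (p * rr mu t) (- (s * sin b))).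
Proof.
move=> hs.
have ns : `|s| = 1 by case: hs => ->; rewrite ?normrN normr1.
have cj : contK K2 (fun y => join_point b (s *: circ w0 w1 mu t) y).
  exact: (contK_vD (contK_vcst K2 (sin b *: (s *: circ w0 w1 mu t))) (contK_vZ (contK_cst K2 (cos b)) (contK_id K2))).
have E0 y : K2 y -> einner w0 (join_point b (s *: circ w0 w1 mu t) y) = sin b * (s * rr mu t).
  by move=> Ky; rewrite join_pointE (K20 Ky) mulr0 addr0 einnerZr einner0circ.
have E1 y : K2 y -> einner w1 (join_point b (s *: circ w0 w1 mu t) y) = sin b * (s * (mu * sin t / Del mu t)).
  by move=> Ky; rewrite join_pointE (K21 Ky) mulr0 addr0 einnerZr einner1circ.
have b1 y : K2 y -> `|einner w0 (join_point b (s *: circ w0 w1 mu t) y)| <= 1.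
  move=> /E0 ->; rewrite normrM (normrM s) ns mul1r.
  apply: mulr_ile1; rewrite ?normr_ge0 //; first by rewrite ler_norml sin_geN1 sin_le1.
  exact: rr_le1 mu0 t.
have ck := contK_kprof al cj b1.
set c := sin b * `|sin b| * cos b ^+ j * (`|cos (t - al)| * (Del mu t)^-1) * Jker j (e0 * rr mu t) (p * rr mu t) (- (s * sin b)).
transitivity (B (fun y => (mu * c) * 1)); last first.
  by rewrite (pfZ (mean_pf hB) _ (contK_cst K2 1)); ring.
apply: (pf_ext (mean_pf hB) (contKM (contK_cst K2 _) ck) (contKM (contK_cst K2 (mu * c)) (contK_cst K2 1))) => y Ky.
rewrite /kprof E0 // E1 // mulr1 /c.
have -> : mu * cos al * (sin b * (s * rr mu t)) + sin al * (sin b * (s * (mu * sin t / Del mu t))) =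
    sin b * s * (mu * (cos t * cos al + sin t * sin al) / Del mu t) by rewrite /rr; ring.
rewrite -cosB !normrM ns (gtr0_norm mu0) normfV (gtr0_norm (Del_gt0 mu0 t)).
have -> : Jker j e0 p (- (sin b * (s * rr mu t))) = Jker j (e0 * rr mu t) (p * rr mu t) (- (s * sin b)).
  rewrite /Jker; have -> : e0 * - (sin b * (s * rr mu t)) = e0 * rr mu t * - (s * sin b) by ring.
  by have -> : p * - (sin b * (s * rr mu t)) = p * rr mu t * - (s * sin b) by ring.
by rewrite expr1; ring.
Qed.

(** Swap the integrals over b and t. At fixed t the integral in b is [Jint], whose two summands come
    from the points [circ t] and [- circ t]. *)
Lemma join_eval al : join 2 j.+1 (circ_mean w0 w1 mu a0) B (kprof al) =
  mu * B (fun=> 1) * integ a0 (a0 + pi) (fun t => `|cos (t - al)| * gg j e0 p mu t).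
Proof.
have ab : a0 < a0 + pi by rewrite ltrDl pi_gt0.
pose f (b t : R) := mu * B (fun=> 1) * (Del mu t ^- 2 * (`|cos (t - al)| * (Del mu t)^-1)) *
  (sin b * `|sin b| * cos b ^+ j * (Jker j (e0 * rr mu t) (p * rr mu t) (sin b) + Jker j (e0 * rr mu t) (p * rr mu t) (- sin b))).
have -> : join 2 j.+1 (circ_mean w0 w1 mu a0) B (kprof al) = integ 0 (pi / 2) (fun b => integ a0 (a0 + pi) (f b)).
  congr integ; apply/funext => b; congr integ; apply/funext => t.
  have := inner_eval al b t (or_introl erefl); rewrite scale1r mul1r => ->.
  have := inner_eval al b t (or_intror erefl); rewrite scaleN1r mulN1r opprK => ->.
  by rewrite /f; ring.
have cT (e : R -> R) : continuous e -> contK (setT : set (R * R)) (fun q : R * R => e q.1).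
  by move=> ce; apply: (contK_push (contK_fst _)); exact: contK_continuous.
have cT2 (e : R -> R) : continuous e -> contK (setT : set (R * R)) (fun q : R * R => e q.2).
  by move=> ce; apply: (contK_push (contK_snd _)); exact: contK_continuous.
have cDel2 : continuous (fun t => Del mu t ^- 2) := continuous_Delm2 mu0.
have cDel1 : continuous (fun t => (Del mu t)^-1).
  by move=> t; exact: is_derive_cont (D_inv (f := Del mu) (lt0r_neq0 (Del_gt0 mu0 t)) (D_Del mu0 t)).
have ccos : continuous (fun t : R => `|cos (t - al)|).
  move=> t; apply: (@continuous_comp _ _ _ (fun t : R => cos (t - al)) (fun x : R => `|x|)); last exact: norm_continuous.
  exact: is_derive_cont (D_cos (D_sub (D_id t) (D_cst al t))).
have crr : continuous (rr mu) := cont_rr mu0.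
have cs := cT _ (@continuous_sin R); have cc := cT _ (@continuous_cos R).
set S : set (R * R) := setT.
have ce := contKM (contK_cst S e0) (cT2 _ crr); have cf := contKM (contK_cst S p) (cT2 _ crr).
have bnd (q : R * R) : `|rr mu q.2 * sin q.1| <= 1.
  by rewrite normrM mulr_ile1 ?normr_ge0 ?(rr_le1 mu0) // ler_norml sin_geN1 sin_le1.
have P (e : R) : 0 < e -> e < 1 -> forall q : R * R, S q -> 0 < 1 + e * rr mu q.2 * sin q.1.
  by move=> x1 x2 q _; rewrite -mulrA ker_arg.
have N (e : R) : 0 < e -> e < 1 -> forall q : R * R, S q -> 0 < 1 - e * rr mu q.2 * sin q.1.
  by move=> x1 x2 q _; rewrite -mulrA -mulrN ker_arg // normrN.
have P' (e : R) : 0 < e -> e < 1 -> forall q : R * R, S q -> 0 < 1 + e * rr mu q.2 * - sin q.1.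
  by move=> x1 x2 q Kq; rewrite mulrN; exact: N.
have N' (e : R) : 0 < e -> e < 1 -> forall q : R * R, S q -> 0 < 1 - e * rr mu q.2 * - sin q.1.
  by move=> x1 x2 q Kq; rewrite mulrN opprK; exact: P.
have k1 := @contK_Jker R j _ _ _ _ _ ce cf cs (P e0 e00 e01) (N p p0 p1).
have k2 := @contK_Jker R j _ _ _ _ _ ce cf (contKN cs) (P' e0 e00 e01) (N' p p0 p1).
have cF : continuous (fun q : R * R => f q.1 q.2).
  have h := contKM (contKM (contK_cst S (mu * B (fun=> 1))) (contKM (cT2 _ cDel2) (contKM (cT2 _ ccos) (cT2 _ cDel1))))
    (contKM (contKM (contKM cs (contK_norm cs)) (contK_pow j cc)) (contKD k1 k2)).
  by move=> q; exact: nbhs_singleton (h q I).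
rewrite (integ_swap _ _ pihalf_gt0 cF).
have pI := integ_posfun a0 (a0 + pi).
have cG : contK `[a0, a0 + pi]%classic (fun t => `|cos (t - al)| * gg j e0 p mu t).
  have cgg : continuous (gg j e0 p mu) := cont_gg e00 e0p p1 mu0.
  exact: (contKM (contK_continuous ccos) (contK_continuous cgg)).
rewrite -(pfZ pI _ cG); congr integ; apply/funext => t.
have er : `|e0 * rr mu t| < 1.
  by rewrite normrM (gtr0_norm e00); apply: le_lt_trans e01; rewrite ler_piMr ?(rr_le1 mu0) // ltW.
have pr : `|p * rr mu t| < 1.
  by rewrite normrM (gtr0_norm p0); apply: le_lt_trans p1; rewrite ler_piMr ?(rr_le1 mu0) // ltW.
set c := mu * B (fun=> 1) * (Del mu t ^- 2 * (`|cos (t - al)| * (Del mu t)^-1)).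
transitivity (c * Jint j (e0 * rr mu t) (p * rr mu t)); last first.
  by rewrite /gg /c -exprVn; ring.
set K : set R := `[0, pi / 2]%classic.
have cb (q : R) : {for q, continuous (fun b => f b t)}.
  by apply: (@continuous_comp _ _ _ (fun b : R => (b, t)) (fun q : R * R => f q.1 q.2)); [apply: cont_pair; [exact: cvg_id|exact: cst_continuous]|exact: cF].
have cJ : contK K (fun b => sin b ^+ 2 * cos b ^+ j * (Jker j (e0 * rr mu t) (p * rr mu t) (sin b) + Jker j (e0 * rr mu t) (p * rr mu t) (- sin b))).
  apply: contK_continuous => b.
  have cJs := @continuous_Jsin R j (e0 * rr mu t) (p * rr mu t) er pr.
  have h1 := cJs b; have h2 := cJs (- b).
  have h3 : {for b, continuous (fun b => sin (- b) ^+ 2 * cos (- b) ^+ j * Jker j (e0 * rr mu t) (p * rr mu t) (sin (- b)))}.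
    apply: (@continuous_comp _ _ _ (fun b : R => - b) (fun b => sin b ^+ 2 * cos b ^+ j * Jker j (e0 * rr mu t) (p * rr mu t) (sin b))); last exact: h2.
    exact: is_derive_cont (D_opp (D_id b)).
  have h := continuousD h1 h3; move: h; congr (continuous_at _ _).
  by apply/funext => c'; rewrite /= !fctE sinN cosN sqrrN mulrDr.
rewrite /Jint -(pfZ (integ_posfun 0 (pi / 2)) c cJ).
apply: (pf_ext (integ_posfun 0 (pi / 2)) (contK_continuous cb) (contKM (contK_cst K c) cJ)) => b.
rewrite /= in_itv /= => /andP[b0 bpi].
have s0 : 0 <= sin b by apply: sin_ge0_pi; rewrite b0 (le_trans bpi) // ler_pdivrMr // ler_peMr ?pi_ge0 // ler1n.
by rewrite /f -/c (ger0_norm s0).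
Qed.

End JoinEval.

(** * The conformal parameters that simplify the kernel *)

Section MobiusParameters.
Context {R : realType} {j : nat}.
Local Notation N := (j.+3%:R : R).
Variable rho : R.
Hypotheses (rho0 : 0 < rho) (rho1 : rho < 1).

(** At x = rho w0 the derivative of the Poisson kernel along cos al w0 + sin al w1 is |x - y|^-(N+2)
    times kapp cos al (y1 - pp) + nup sin al y2. Thus [pp] is the height where the normal derivative
    vanishes; as Moebius parameter it brings this latitude to z1 = 0. [ep] and [Ep] are such that |x
    - y|^2 = Ep (1 - ep z1) / (1 + pp z1), and [wp] is the root of 1 - pp^2 by [wp_pp]. *)
Definition nup : R := N * (1 - rho ^+ 2).
Definition kapp : R := nup + 4 * rho ^+ 2.
Definition pp : R := rho * (nup + 2 + 2 * rho ^+ 2) / kapp.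
Definition ep : R := (N - 2) / N * rho.
Definition mup : R := Num.sqrt (1 - ep ^+ 2).
Definition wp : R := nup * mup / kapp.
Definition Ep : R := 1 + rho ^+ 2 - 2 * rho * pp.

Let N0 : 0 < N. Proof. by rewrite ltr0n. Qed.
Let r2 : 0 < 1 - rho ^+ 2. Proof. by rewrite subr_gt0 expr_lt1 // ltW. Qed.

Lemma nup_gt0 : 0 < nup. Proof. exact: mulr_gt0. Qed.
Lemma kapp_gt0 : 0 < kapp.
Proof. by rewrite /kapp addr_gt0 ?nup_gt0 // mulr_gt0 // exprn_gt0. Qed.

Lemma ep_gt0 : 0 < ep.
Proof. by rewrite /ep mulr_gt0 // divr_gt0 // subr_gt0 ltr_nat. Qed.

Lemma ep_lt_rho : ep < rho.
Proof. by rewrite /ep gtr_pMl // ltr_pdivrMr // mul1r gtrBl. Qed.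

Lemma mup_facts : 0 < mup /\ mup ^+ 2 = 1 - ep ^+ 2.
Proof.
have h : 0 < 1 - ep ^+ 2 by rewrite subr_gt0 expr_lt1 ?(ltW ep_gt0) // (lt_trans ep_lt_rho).
by rewrite /mup sqrtr_gt0 sqr_sqrtr // ltW.
Qed.

Lemma kapp_pp : kapp * pp = rho * (nup + 2 + 2 * rho ^+ 2).
Proof. by rewrite /pp mulrC divfK // lt0r_neq0 // kapp_gt0. Qed.

Lemma kapp_wp : kapp * wp = nup * mup.
Proof. by rewrite /wp mulrC divfK // lt0r_neq0 // kapp_gt0. Qed.

Lemma wp_gt0 : 0 < wp.
Proof. by rewrite /wp divr_gt0 ?kapp_gt0 // mulr_gt0 ?nup_gt0 //; case: mup_facts. Qed.

Lemma wp_pp : wp ^+ 2 + pp ^+ 2 = 1.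
Proof.
have k0 := lt0r_neq0 kapp_gt0; have [_ m2] := mup_facts.
have k2 : kapp ^+ 2 != 0 by rewrite sqrf_eq0.
apply: (mulfI k2); rewrite mulr1 mulrDr -!exprMn kapp_pp kapp_wp exprMn m2 /kapp /nup /ep.
by field; rewrite lt0r_neq0.
Qed.

Lemma pp_bounds : ep < pp /\ pp < 1.
Proof.
have p0 : 0 < pp.
  apply: divr_gt0 kapp_gt0; apply: mulr_gt0 => //.
  by have := nup_gt0; have := exprn_gt0 2 rho0; lra.
split.
  apply: (lt_le_trans ep_lt_rho); rewrite -(ler_pM2l kapp_gt0) kapp_pp mulrC ler_pM2l // /kapp.
  have := r2; lra.
by rewrite -(@ltr_pXn2r _ 2) ?nnegrE ?(ltW p0) ?ler01 // expr1n -wp_pp ltrDr exprn_gt0 // wp_gt0.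
Qed.

Lemma kapp_Ep : kapp * Ep = nup * (1 - rho ^+ 2).
Proof.
have E : kapp * Ep = kapp * (1 + rho ^+ 2) - 2 * rho * (kapp * pp) by rewrite /Ep; ring.
by rewrite E kapp_pp /kapp; ring.
Qed.

Lemma Ep_gt0 : 0 < Ep.
Proof. by rewrite -(pmulr_rgt0 _ kapp_gt0) kapp_Ep mulr_gt0 ?nup_gt0. Qed.

Lemma ep_Ep : 2 * rho - pp * (1 + rho ^+ 2) = ep * Ep.
Proof.
apply: (mulfI (lt0r_neq0 kapp_gt0)); rewrite (mulrCA kapp ep) kapp_Ep.
have -> : kapp * (2 * rho - pp * (1 + rho ^+ 2)) = 2 * rho * kapp - kapp * pp * (1 + rho ^+ 2) by ring.
by rewrite kapp_pp /kapp /ep /nup; field; rewrite lt0r_neq0.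
Qed.

Section Pointwise.
Local Notation V := 'rV[R]_(j.+3).
Variables (w0 w1 z eta : V).
Hypothesis etaE : eta = mob_pt w0 pp wp z.
Hypotheses (w00 : einner w0 w0 = 1) (w01 : einner w0 w1 = 0).
Let d := mob_den w0 pp z.
Let z1 := einner w0 z.
Let z2 := einner w1 z.
Hypotheses (d0 : 0 < d) (ee : einner eta eta = 1) (z11 : 0 < 1 - ep * z1).

Let eta1 : einner w0 eta = (z1 + pp) / d.
Proof.
rewrite etaE /mob_pt !einnerE w00 -/z1 -/d; have := lt0r_neq0 d0.
by move: d => D D0; field.
Qed.

Let eta2 : einner w1 eta = wp * z2 / d.
Proof.
rewrite etaE /mob_pt !einnerE (einnerC w1 w0) w01 -/z1 -/z2 -/d; have := lt0r_neq0 d0.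
by move: d => D D0; field.
Qed.

Let dE : d = 1 + pp * z1. Proof. by []. Qed.

Let pdE : pdist (rho *: w0) eta = Ep * (1 - ep * z1) / d.
Proof.
rewrite pdistE !einnerE ee w00 eta1.
have -> : Ep * (1 - ep * z1) = Ep - (ep * Ep) * z1 by ring.
rewrite -ep_Ep /Ep; have := d0; rewrite dE => /lt0r_neq0 D0.
by field.
Qed.

(** After the change of variable, the component y1 - pp is wp^2 z1 / d and y2 is wp z2 / d. Hence
    the derivative is homogeneous linear in (z1, z2), and kapp wp = nup mup produces the coefficient
    mup. *)
Lemma kernel_profile al :
  d^-1 ^+ j.+2 * `|einner (cos al *: w0 + sin al *: w1) (poisG (rho *: w0) eta)| =
  nup * wp * (Num.sqrt Ep)^-1 ^+ (j + 5) * kprof j ep pp mup w0 w1 al z.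
Proof.
have pd0 : 0 < pdist (rho *: w0) eta by rewrite pdE divr_gt0 // mulr_gt0 ?Ep_gt0.
set s := psi (rho *: w0) eta.
have s0 : 0 < s := psi_gt0 pd0.
have D0 := lt0r_neq0 d0.
have [m0 m2] := mup_facts.
have key : einner (cos al *: w0 + sin al *: w1) (poisG (rho *: w0) eta) =
    s ^+ (j + 5) * (nup * wp / d * (mup * cos al * z1 + sin al * z2)).
  have sD : s ^+ j.+3 = s ^+ (j + 5) * (1 + rho ^+ 2 - 2 * rho * ((z1 + pp) / d)).
    rewrite (_ : (j + 5 = j.+3 + 2)%N); last by rewrite addnS addn4 addn2.
    rewrite exprD -mulrA; have := psi_sqr pd0; rewrite -/s pdistE !einnerE ee w00 eta1 => h.
    by rewrite (_ : s ^+ 2 * _ = 1) ?mulr1 //; rewrite -[RHS]h; ring.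
  rewrite /poisG -/s !einnerE w00 (einnerC w1 w0) w01 eta1 eta2 sD.
  rewrite (_ : j.+3.+2 = (j + 5)%N); last by rewrite addnS addn4.
  move: (s ^+ (j + 5)) => S.
  have kp0 := lt0r_neq0 kapp_gt0.
  have nE : nup = kapp - 4 * rho ^+ 2 by rewrite /kapp addrK.
  transitivity (S * (cos al * (kapp * ((z1 + pp) / d) - kapp * pp) + nup * sin al * (wp * z2 / d))).
    by rewrite kapp_pp /kapp /nup; ring.
  have -> : kapp * ((z1 + pp) / d) - kapp * pp = (kapp * wp) * wp * z1 / d.
    have w2 : wp * wp = 1 - pp ^+ 2 by rewrite -wp_pp -expr2 addrK.
    rewrite -(mulrA kapp) w2; move: D0; rewrite dE => D0; by field.
  by rewrite kapp_wp; ring.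
have sE : s = Num.sqrt d * (Num.sqrt Ep)^-1 * (Num.sqrt (1 - ep * z1))^-1.
  rewrite /s /psi pdE sqrtrM ?mulr_ge0 ?(ltW Ep_gt0) ?(ltW z11) // sqrtrV ?(ltW d0) // sqrtrM ?(ltW Ep_gt0) //.
  by rewrite !invfM invrK mulrC mulrA.
have q0 : 0 < Num.sqrt d by rewrite sqrtr_gt0.
have qd : d = Num.sqrt d ^+ 2 by rewrite sqr_sqrtr // ltW.
rewrite key normrM (ger0_norm (exprn_ge0 _ (ltW s0))) normrM (ger0_norm (_ : 0 <= nup * wp / d)); last first.
  by rewrite divr_ge0 ?(ltW d0) // mulr_ge0 // ltW ?nup_gt0 ?wp_gt0.
rewrite /kprof -/z1 -/z2 /Jker mulrN mulrN opprK -dE sE.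
move: (`|_ + _|) (Num.sqrt Ep) (Num.sqrt (1 - ep * z1)) => A e f.
rewrite !exprMn.
have -> : d^-1 ^+ j.+2 * (Num.sqrt d ^+ (j + 5) * e^-1 ^+ (j + 5) * f^-1 ^+ (j + 5) * (nup * wp / d * A)) =
   (d^-1 ^+ j.+2 * d^-1 * Num.sqrt d ^+ (j + 5)) * (nup * wp * e^-1 ^+ (j + 5) * (A * f^-1 ^+ (j + 5))) by ring.
(* Powers of d: the Jacobian gives j + 2, the linear factor one more, and the distance returns (j +
   5)/2, which leaves (j + 1)/2 in the denominator. *)
have -> : d^-1 ^+ j.+2 * d^-1 * Num.sqrt d ^+ (j + 5) = (Num.sqrt d)^-1 ^+ j.+1.
  rewrite -exprSr qd sqrtr_sqr (ger0_norm (ltW q0)) -exprVn -exprM.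
  have -> : (2 * j.+3 = j.+1 + (j + 5))%N by rewrite mul2n -addnn !addSn !addnS addn0.
  rewrite exprD -mulrA -exprMn mulVf ?lt0r_neq0 // expr1n mulr1 //.
by ring.
Qed.

End Pointwise.
End MobiusParameters.

(** * Orthonormal frames by Householder reflections *)

Section Frame.
Context {R : realType} {n : nat}.
Local Notation V := 'rV[R]_n.
Implicit Types (u v a : V).

Definition refl a v : V := v - (2 * einner v a / einner a a) *: a.

Lemma refl_isom a u v : einner (refl a u) (refl a v) = einner u v.
Proof.
have [->|a0] := eqVneq a 0; first by rewrite /refl !scaler0 !subr0.
have aa : einner a a != 0 by rewrite einner_eq0.
by rewrite /refl !einnerE (einnerC a v); field.
Qed.

Lemma reflK a v : refl a (refl a v) = v.
Proof.
have [->|a0] := eqVneq a 0; first by rewrite /refl !scaler0 !subr0.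
have aa : einner a a != 0 by rewrite einner_eq0.
apply/rowP => i; rewrite /refl !mxE !einnerE; by field.
Qed.

Lemma refl_swap u v : einner u u = einner v v -> refl (u - v) u = v.
Proof.
move=> uv; have [->|a0] := eqVneq u v; first by rewrite /refl subrr scaler0 subr0.
have aa : einner (u - v) (u - v) != 0 by rewrite einner_eq0 subr_eq0.
have E : 2 * einner u (u - v) = einner (u - v) (u - v) by rewrite !einnerE -uv (einnerC v u); ring.
by rewrite /refl E divff // scale1r opprB addrC subrK.
Qed.

Lemma refl_fix a v : einner v a = 0 -> refl a v = v.
Proof. by move=> h; rewrite /refl h mulr0 mul0r scale0r subr0. Qed.

Lemma refl_adj a u v : einner (refl a u) v = einner u (refl a v).
Proof. by rewrite -(refl_isom a u (refl a v)) reflK. Qed.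

Lemma refl_linear a : linear (refl a).
Proof.
by move=> c u v; apply/rowP => i; rewrite /refl !mxE einnerDl einnerZl; ring.
Qed.
HB.instance Definition _ a := GRing.isLinear.Build R V V _ (refl a) (refl_linear a).

Lemma refl_span (w : 'I_n -> V) a : (forall v, v = \sum_i einner v (w i) *: w i) ->
  forall v, v = \sum_i einner v (refl a (w i)) *: refl a (w i).
Proof.
move=> h v; rewrite -[LHS](reflK a) (h (refl a v)) linear_sum; apply: eq_bigr => i _.
by rewrite linearZ refl_adj.
Qed.

(* A product of two Householder reflections moves two vectors of the standard basis to prescribed ones. *)
Lemma frame (i0 i1 : 'I_n) (w0 l : V) : i0 != i1 -> einner w0 w0 = 1 -> einner l l = 1 ->
  exists (w : 'I_n -> V) (al : R), [/\ forall i k, einner (w i) (w k) = (i == k)%:R,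
    forall v, v = \sum_i einner v (w i) *: w i, w i0 = w0 & l = cos al *: w i0 + sin al *: w i1].
Proof.
move=> i01 ww ll.
have ebE i k : einner (ebasis R i) (ebasis R k) = (i == k)%:R :> R by rewrite einner_ebasis mxE eqxx eq_sym.
pose g1 := refl (ebasis R i0 - w0).
have g10 : g1 (ebasis R i0) = w0 by apply: refl_swap; rewrite ebE eqxx ww.
pose c := einner l w0.
have c1 : -1 <= c <= 1.
  by rewrite -ler_norml; have := cauchy_schwarz l w0; rewrite !enorm1 // mulr1.
have al := acosK c1.
pose m0 := l - c *: w0.
have m0w : einner m0 w0 = 0 by rewrite /m0 einnerBl einnerZl ww mulr1 subrr.
have m0m : einner m0 m0 = sin (acos c) ^+ 2.
  have -> : sin (acos c) ^+ 2 = 1 - c ^+ 2 by rewrite -(cos2Dsin2 (acos c)) al addrAC subrr add0r.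
  by rewrite /m0 !einnerE ll ww (einnerC w0 l) -/c; ring.
have g1o : einner (g1 (ebasis R i1)) w0 = 0 by rewrite -g10 /g1 refl_isom ebE eq_sym (negPf i01).
have [m [mm mw lE]] : exists m, [/\ einner m m = 1, einner m w0 = 0 & l = c *: w0 + sin (acos c) *: m].
  (* If l is w0 or -w0, any unit vector orthogonal to w0 may serve as second vector, for instance
     the image of the second basis vector. *)
  have [s0|s0] := eqVneq (sin (acos c)) 0.
    exists (g1 (ebasis R i1)); split => //; first by rewrite /g1 refl_isom ebE eqxx.
    have : m0 = 0 by apply/eqP; rewrite -einner_eq0 m0m s0 expr0n.
    by rewrite s0 scale0r addr0 => /eqP; rewrite subr_eq0 => /eqP.
  exists ((sin (acos c))^-1 *: m0); split.
  - by rewrite einnerZl einnerZr m0m; field.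
  - by rewrite einnerZl m0w mulr0.
  - by rewrite scalerA divff // scale1r /m0 addrC subrK.
pose g2 := refl (g1 (ebasis R i1) - m).
have g21 : g2 (g1 (ebasis R i1)) = m by apply: refl_swap; rewrite /g1 refl_isom ebE eqxx mm.
have g20 : g2 w0 = w0 by apply: refl_fix; rewrite einnerBr !(einnerC w0) g1o mw subrr.
exists (fun i => g2 (g1 (ebasis R i))), (acos c); split.
- by move=> i k; rewrite /g2 /g1 !refl_isom ebE.
- apply: refl_span; apply: refl_span => v; rewrite [LHS]einner_sum_basis.
  by apply: eq_bigr => i _; rewrite einnerC einner_ebasis.
- by rewrite g10 g20.
- by rewrite g10 g20 g21 al.
Qed.

End Frame.

(** * Comparison of an arbitrary direction with the normal one *)

Section SpecialMean.
Context {R : realType}.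

Lemma mean_scale {n : nat} (K D : set 'rV[R]_n) N M (a : R) : 0 < a -> mean K D N M -> mean K D N (fun f => a * M f).
Proof.
move=> a0 [pM sph dv ctr m1]; split => //.
- split; first exact: pf_compact pM.
  + by move=> k f g cf cg; rewrite (pf_lin pM k cf cg); ring.
  + by move=> f cf f0; rewrite mulr_ge0 ?(ltW a0) // (pf_ge0 pM cf f0).
- by move=> U f G v oU KU cf Dv; rewrite (dv U f G v) ?mulr0.
- by move=> v Dv; rewrite ctr ?mulr0.
- exact: mulr_gt0.
Qed.

Variable j : nat.
Local Notation V := 'rV[R]_(j.+3).

(** The functional is tailored to al: the circle in the plane of the first two frame vectors, joined
    with the sphere of the remaining ones, transported by the Moebius map and normalised. Both
    averages equal the same nonnegative constant times an integral of |cos (t - b)| [gg], for b = al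
    and b = 0, and [reflection_ineq] compares these. *)
Lemma special_mean (w : 'I_j.+3 -> V) (rho al : R) (i1 : 'I_j.+3) : i1 = lift ord0 ord0 ->
  (forall i k, einner (w i) (w k) = (i == k)%:R) -> (forall v, v = \sum_i einner v (w i) *: w i) ->
  0 < rho -> rho < 1 ->
  exists (K : set V) (M : (V -> R) -> R), [/\ mean K setT j.+3 M, M (fun=> 1) = 1 &
    M (fun y => `|einner (cos al *: w ord0 + sin al *: w i1) (poisG (rho *: w ord0) y)|) <=
    M (fun y => `|einner (w ord0) (poisG (rho *: w ord0) y)|)].
Proof.
move=> i1E ww wspan rho0 rho1.
have w00 : einner (w ord0) (w ord0) = 1 by rewrite ww eqxx.
have w11 : einner (w i1) (w i1) = 1 by rewrite ww eqxx.
have w01 : einner (w ord0) (w i1) = 0 by rewrite ww i1E.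
pose s := [seq w (lift ord0 (lift ord0 i)) | i <- enum 'I_j.+1].
have ss : size s = j.+1 by rewrite size_map size_enum_ord.
have sw v : v \in s -> exists i, v = w (lift ord0 (lift ord0 i)) by move=> /mapP[i _ ->]; exists i.
have winj : injective w.
  move=> i k E; have := ww i k; rewrite -E ww eqxx.
  by case: (i =P k) => // _ /eqP; rewrite oner_eq0.
have s0 : s != [::] by rewrite -size_eq0 ss.
have us : uniq s by rewrite map_inj_uniq ?enum_uniq // => i k /winj /lift_inj /lift_inj.
have os v v' : v \in s -> v' \in s -> einner v v' = (v == v')%:R.
  by move=> /sw[i ->] /sw[k ->]; rewrite ww (inj_eq winj).
have s0w v : v \in s -> einner (w ord0) v = 0 by move=> /sw[i ->]; rewrite ww.
have s1w v : v \in s -> einner (w i1) v = 0 by move=> /sw[i ->]; rewrite ww i1E (inj_eq lift_inj).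
have [K2 [D2 [B [hB sD Ds sK]]]] := frame_mean s0 us os.
rewrite ss in hB.
have K20 y : K2 y -> einner (w ord0) y = 0 by apply: sK.
have K21 y : K2 y -> einner (w i1) y = 0 by apply: sK.
have [mu0 mu2] := @mup_facts R j rho rho0 rho1.
have [epp pp1] := @pp_bounds R j rho rho0 rho1.
have ep0 := @ep_gt0 R j rho rho0.
(* The half-turn is centred at al / 2, so that t -> al - t preserves it. *)
pose a0 := al / 2 - pi / 2.
have hA := circ_mean_mean a0 w00 w11 w01 mu0.
set K1 := [set _ | _ in _] in hA; set D1 := [set v | _] in hA.
have K12 x y : K1 x -> K2 y -> einner x y = 0.
  by move=> [[t e] _ <-] Ky; rewrite /= /circ einnerZl einnerDl !einnerZl K20 // K21 // !mulr0 addr0 mulr0.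
have D1K2 v y : D1 v -> K2 y -> einner v y = 0.
  by move=> [a [b ->]] Ky; rewrite einnerDl !einnerZl K20 // K21 // !mulr0 addr0.
have D2K1 v x : D2 v -> K1 x -> einner v x = 0.
  move=> /Ds vs [[t e] _ <-]; rewrite /= /circ einnerZr einnerDr !einnerZr.
  by rewrite !(einnerC v) s0w // s1w // !mulr0 addr0 mulr0.
pose M0 := join 2 j.+1 (circ_mean (w ord0) (w i1) (@mup R j rho) a0) B.
have hJ := @join_mean R j.+3 K1 K2 D1 D2 2 j.+1 _ B isT isT hA hB K12 D1K2 D2K1; rewrite -/M0 in hJ.
set KJ := [set _ | _ in _] in hJ.
have Dw0 : (D1 `|` D2) (w ord0) by left; exists 1, 0; rewrite scale1r scale0r addr0.
have pw := @wp_pp R j rho rho0 rho1; have pw0 := @wp_gt0 R j rho rho0 rho1.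
have hM := @mob_mean R j.+3 KJ _ j.+3 M0 (w ord0) _ _ hJ isT w00 Dw0 pw0 pw.
(* The transported functional satisfies the divergence identity along w0 and along directions of the
   join orthogonal to w0; every frame vector is of one of these kinds, so [mean_span] yields all
   directions. *)
have Dall i : [set v | v = w ord0 \/ (D1 `|` D2) v /\ einner v (w ord0) = 0] (w i).
  have [k ->|->] := unliftP ord0 i; last by left.
  right; split; last by rewrite ww.
  have [k' ->|->] := unliftP ord0 k; last by left; exists 0, 1; rewrite scale1r scale0r add0r i1E.
  by right; apply: sD; rewrite map_f // mem_enum.
have hS := mean_span hM Dall wspan.
set Mo := mob _ _ _ _ _ in hS; set KM := [set _ | _ in _] in hS.
have Mo1 := mean_gt0 hS.
have Mi : 0 < (Mo (fun=> 1))^-1 by rewrite invr_gt0.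
exists KM, (fun f => (Mo (fun=> 1))^-1 * Mo f); split.
- exact: mean_scale hS.
- by rewrite mulVf // lt0r_neq0.
apply: ler_wpM2l; first exact: ltW.
pose C := @nup R j rho * @wp R j rho * (Num.sqrt (@Ep R j rho))^-1 ^+ (j + 5).
have rx : oball 1 (rho *: w ord0) by rewrite /oball /= !einnerE w00 mulr1 -expr2 expr_lt1 // ltW.
have z1 z : KJ z -> `|einner (w ord0) z| <= 1.
  move=> Kz; have := cauchy_schwarz (w ord0) z.
  by rewrite !enorm1 ?mulr1 // (mean_sphere hJ Kz).
have ep1 : @ep R j rho < 1 := lt_trans epp pp1.
have ck b : contK KJ (fun z => kprof j (@ep R j rho) (@pp R j rho) (@mup R j rho) (w ord0) (w i1) b z).
  exact: (contK_kprof j (@mup R j rho) ep0 epp pp1 (w i1) b (contK_id KJ) z1).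
have E b : Mo (fun y => `|einner (cos b *: w ord0 + sin b *: w i1) (poisG (rho *: w ord0) y)|) =
    C * (@mup R j rho * B (fun=> 1) * integ a0 (a0 + pi) (fun t => `|cos (t - b)| * gg j (@ep R j rho) (@pp R j rho) (@mup R j rho) t)).
  rewrite -(join_eval ep0 epp pp1 mu0 a0 w00 w11 w01 hB K20 K21 b) -/M0.
  rewrite -(pfZ (mean_pf hJ) C (ck b)).
  have cl := contK_norm (contK_poisG_at hS (cos b *: w ord0 + sin b *: w i1) rx).
  apply: (pf_ext (mean_pf hJ) (contK_mob hJ w00 pw0 pw cl) (contKM (contK_cst KJ C) (ck b))) => z Kz.
  apply: (@kernel_profile R j rho rho0 rho1 (w ord0) (w i1) z _ erefl w00 w01).
  - exact: (mob_K hJ w00 pw0 pw Kz).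
  - exact: (mob_sphere hJ w00 pw0 pw Kz).
  - by rewrite -mulrN ker_arg // normrN z1.
have E0 : w ord0 = cos 0 *: w ord0 + sin 0 *: w i1 by rewrite cos0 sin0 scale1r scale0r addr0.
rewrite [X in _ <= Mo (fun y => `|einner X _|)]E0 !E.
have C0 : 0 <= C.
  rewrite /C mulr_ge0 ?exprn_ge0 ?invr_ge0 ?sqrtr_ge0 // mulr_ge0 ?(ltW pw0) //.
  exact: ltW (@nup_gt0 R j rho rho0 rho1).
apply: ler_wpM2l => //; apply: ler_wpM2l.
  by rewrite mulr_ge0 ?(ltW mu0) // ltW // (mean_gt0 hB).
have := reflection_ineq j ep0 epp pp1 mu0 mu2 (erefl a0).
by under [X in _ -> _ <= integ _ _ X]eq_fun do rewrite subr0.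
Qed.

End SpecialMean.

(** * The two sets of admissible constants coincide *)

Theorem theorem1p2 (R : realType) (n : nat) (hn : (3 <= n)%N) (x : 'rV[R]_n)
  (hx : unit_ball x) (hx0 : x != 0) :
  Cgrad x = Cdir x ((enorm x)^-1 *: x).
Proof.
case: n hn x hx hx0 => [|[|[|j]]] // _ x hx hx0.
have x0 : 0 < enorm x by rewrite lt_neqAle enorm_ge0 eq_sym -sqrf_eq0 enorm_sqr einner_eq0 hx0.
have n1 : (1 < j.+3)%N by [].
have x1 : enorm x < 1 := hx.
have Ux : oball 1 x by rewrite -unit_ballE.
set nx := (enorm x)^-1 *: x.
have nn : einner nx nx = 1 by rewrite /nx einnerZl einnerZr -enorm_sqr; field; rewrite lt0r_neq0.
have xE : x = enorm x *: nx by rewrite /nx scalerA divff ?lt0r_neq0 // scale1r.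
rewrite /Cgrad /Cdir; congr inf; apply/seteqP; split=> c /= hc u hu.
  apply: le_trans (hc u hu); apply: le_trans (cauchy_schwarz _ _) _.
  by rewrite (enorm1 nn) mulr1.
(* A zero gradient has no direction; the bound then only says that c times the supremum is
   nonnegative. *)
have [g0|g0] := eqVneq (grad u x) 0.
  by rewrite g0 enorm0; apply: le_trans (hc u hu); exact: normr_ge0.
have e0 : enorm (grad u x) != 0 by rewrite -sqrf_eq0 enorm_sqr einner_eq0.
set l := (enorm (grad u x))^-1 *: grad u x.
have ll : einner l l = 1 by rewrite /l einnerZl einnerZr -enorm_sqr; field.
have i01 : ord0 != lift ord0 ord0 :> 'I_j.+3 by [].
have [w [al [ww wspan w0 lE]]] := frame i01 nn ll.
(* The functional depends on the direction l of this gradient. This is harmless: [grad_upper] is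
   used for l and [grad_lower] for the normal with the same [M], and [le] links the two. *)
have [K [M [hM M1 le]]] := special_mean al (erefl _) ww wspan x0 x1.
rewrite -lE w0 -xE in le.
have hB z : unit_ball z -> `|u z| <= supnorm u by exact: supnorm_ub.
have := grad_upper n1 hM M1 l hu.1 hB Ux hx0.
have -> : einner l (grad u x) = enorm (grad u x) by rewrite /l einnerZl -enorm_sqr expr2 mulKf.
rewrite (ger0_norm (enorm_ge0 _)) => /le_trans; apply; apply: ler_wpM2r.
  by apply: (le_trans _ (hB 0 (@unit_ball0 R j.+3))); exact: normr_ge0.
exact: (le_trans le (grad_lower n1 hM M1 Ux hc)).
Qed.
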